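(* Let $h,f,b$ be any three entire holomorphic functions of $w\in\mathbb{C}$. Define $a:=e^{2\,\mathrm{Re}(h)}$, and let $c$ (complex-valued) and $d$ (real-valued) be solutions to $$c_{\bar w}=a\bar f,\qquad d_{\bar w w}=a|f|^2+\frac1a\qquad\text{on }\mathbb{C}.$$ Then the function $$u(z,w)=a(w)|z|^2+b(w)z^2+\overline{b(w)z^2}+c(w)z+\overline{c(w)z}+d(w)$$ is an entire real-analytic plurisubharmonic solution to $\det(\partial\bar\partial u)=1$ on $\mathbb{C}^2$. Moreover, the induced Kähler metric $\partial\bar\partial u$ is flat.
   Context: Coordinates on $\mathbb{C}^2$ are $(z,w)$; subscripts $w,\bar w$ denote the derivatives $\partial/\partial w,\partial/\partial\bar w$. For a real-valued function $u$ on $\mathbb{C}^2$, $\partial\bar\partial u$ denotes its complex Hessian, the $2\times 2$ matrix $\begin{bmatrix} u_{\bar z z} & u_{z\bar w}\\ u_{\bar z w} & u_{\bar w w}\end{bmatrix}$. When this is positive definite, $g_{\alpha\bar\beta}=(\partial\bar\partial u)_{\alpha\bar\beta}$ defines a Kähler metric, which is flat if its curvature tensor vanishes identically. *)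

(* Defs.v *)
(* Stdlib real numbers with Coquelicot; [C] is Coquelicot's [R * R]. *)
From Stdlib Require Import Reals.
From Coquelicot Require Import Coquelicot.

Definition entire (h : C -> C) : Prop :=
  forall w : C, @ex_derive C_AbsRing C_NormedModule h w.

(* Real (Frechet) differentiability on the whole plane. *)
Definition real_differentiable (F : C -> C) : Prop :=
  forall w : C,
    @ex_filterdiff R_AbsRing C_R_NormedModule C_R_NormedModule F (locally w).

(** Wirtinger derivatives.  [Derive] is total, so these are meaningful only
    where the corresponding partial derivatives exist. *)

Definition partial_x (F : C -> C) (p : C) : C :=
  (Derive (fun t => Re (F (t, Im p))) (Re p),
   Derive (fun t => Im (F (t, Im p))) (Re p)).

Definition partial_y (F : C -> C) (p : C) : C :=
  (Derive (fun t => Re (F (Re p, t))) (Im p),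
   Derive (fun t => Im (F (Re p, t))) (Im p)).

Definition wirtinger (F : C -> C) (p : C) : C :=
  ((partial_x F p - Ci * partial_y F p) / 2)%C.

Definition wirtinger_bar (F : C -> C) (p : C) : C :=
  ((partial_x F p + Ci * partial_y F p) / 2)%C.

(* The two coordinates (z, w) of C^2. *)
Inductive coord : Set := cz | cw.

Definition dhol (i : coord) (F : C * C -> C) (p : C * C) : C :=
  match i with
  | cz => wirtinger (fun z => F (z, snd p)) (fst p)
  | cw => wirtinger (fun w => F (fst p, w)) (snd p)
  end.

Definition dbar (i : coord) (F : C * C -> C) (p : C * C) : C :=
  match i with
  | cz => wirtinger_bar (fun z => F (z, snd p)) (fst p)
  | cw => wirtinger_bar (fun w => F (fst p, w)) (snd p)
  end.

Definition csum (F : coord -> C) : C := (F cz + F cw)%C.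

Definition cmat : Type := coord -> coord -> C.

Definition cdet (G : cmat) : C := (G cz cz * G cw cw - G cz cw * G cw cz)%C.

(* Adjugate over determinant; an inverse when [cdet G <> 0]. *)
Definition cinv (G : cmat) : cmat := fun i j =>
  match i, j with
  | cz, cz => (G cw cw / cdet G)%C
  | cz, cw => (- G cz cw / cdet G)%C
  | cw, cz => (- G cw cz / cdet G)%C
  | cw, cw => (G cz cz / cdet G)%C
  end.

(* Rows carry the holomorphic index, columns the antiholomorphic one. *)
Definition complex_hessian (u : C * C -> R) (p : C * C) : cmat := fun i j =>
  dhol i (dbar j (fun q => RtoC (u q))) p.

Definition hermitian_posdef (G : cmat) : Prop :=
  (forall i j, G j i = Cconj (G i j)) /\
  (forall v : coord -> C, (exists i, v i <> RtoC 0) ->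
     0 < Re (csum (fun i => csum (fun j => G i j * v i * Cconj (v j))%C))).

(** Curvature of the Kaehler metric g_{i jbar} = [g p i j].  The Levi-Civita
    (= Chern) connection has coefficients
      Gamma^l_{k i} = sum_m g^{l mbar} d_k g_{i mbar},
    and R_{i jbar k lbar} = - sum_m g_{m jbar} dbar_l Gamma^m_{k i}; the other
    components of the curvature tensor are zero or determined by these ones
    through the symmetries of the tensor.  With rows of g holomorphic,
    g^{l mbar} is the entry (m, l) of the inverse matrix. *)

Definition christoffel (g : C * C -> cmat) (l k i : coord) (p : C * C) : C :=
  csum (fun m => cinv (g p) m l * dhol k (fun q => g q i m) p)%C.

Definition curvature (g : C * C -> cmat) (i j k l : coord) (p : C * C) : C :=
  (- csum (fun m => g p m j * dbar l (christoffel g m k i) p))%C.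

Definition flat_metric (g : C * C -> cmat) : Prop :=
  forall (p : C * C) (i j k l : coord), curvature g i j k l p = RtoC 0.

(** Plurisubharmonicity of a finite-valued function on C^2: upper
    semicontinuity and the sub-mean value inequality on every circle of every
    complex line.  Riemann integrability over the circles is required because
    [RInt] has an arbitrary value otherwise. *)

Definition upper_semicontinuous (u : C * C -> R) : Prop :=
  forall (p : C * C) (eps : posreal), locally p (fun q => u q < u p + eps).

Definition on_circle (u : C * C -> R) (p v : C * C) (t : R) : R :=
  let e : C := (cos t, sin t) in
  u ((fst p + e * fst v)%C, (snd p + e * snd v)%C).

Definition plurisubharmonic (u : C * C -> R) : Prop :=
  upper_semicontinuous u /\
  forall p v : C * C,
    ex_RInt (on_circle u p v) 0 (2 * PI) /\
    u p <= / (2 * PI) * RInt (on_circle u p v) 0 (2 * PI).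

(** Real analyticity on C^2 = R^4: near every point the function is the sum of
    an absolutely convergent power series in the four real coordinates.  Partial
    sums are taken over the boxes {0..N}^4. *)

Definition box_sum (T : nat -> nat -> nat -> nat -> R) (N : nat) : R :=
  sum_n (fun i => sum_n (fun j => sum_n (fun k =>
    sum_n (fun l => T i j k l) N) N) N) N.

Definition real_analytic (u : C * C -> R) : Prop :=
  forall p : C * C,
  exists (A : nat -> nat -> nat -> nat -> R) (r : posreal),
  forall x1 y1 x2 y2 : R,
    Rabs x1 < r -> Rabs y1 < r -> Rabs x2 < r -> Rabs y2 < r ->
    let T := fun i j k l => A i j k l * x1 ^ i * y1 ^ j * x2 ^ k * y2 ^ l in
    (exists M : R, forall N : nat,
       box_sum (fun i j k l => Rabs (T i j k l)) N <= M) /\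
    is_lim_seq (box_sum T)
      (Finite (u ((fst p + (x1, y1))%C, (snd p + (x2, y2))%C))).

(* Main.v *)
Require Import Defs.
From Stdlib Require Import Reals Lra Lia Psatz ClassicalEpsilon FunctionalExtensionality.
From Coquelicot Require Import Coquelicot.

(** The potential is, up to a pluriharmonic function, the Euclidean potential in
    other holomorphic coordinates. Put [E = exp h], let [G] be a primitive of
    [E f] and [K] a primitive of [1 / E]. The equation for [c] says that
    [k = c - E * conj G] is entire. The equation for [d] says that
    [d - |G|^2 - |K|^2] is harmonic, hence equal to [2 Re Phi] with [Phi] entire.
    Completing the square gives
      [u = |E z + G|^2 + |K|^2 + 2 Re (b z^2 + k z + Phi)]
    ([potential_normal_form]).

    All the conclusions are read off from this formula. The complex Hessian is
    [J J^*], where [J] is the Jacobian matrix of [(z, w) |-> (E z + G, K)], which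
    is triangular with diagonal [E, 1 / E]; so it is positive definite of
    determinant 1. The connection is [(dJ) J^-1], which is holomorphic, so the
    curvature vanishes ([flat_normal_form]). On every complex line [|E z + G|^2]
    and [|K|^2] are subharmonic and the last term is harmonic
    ([plurisubharmonic_normal_form]). Finally [u] is a polynomial in [z], in entire
    functions of [w] and in their conjugates, and germs given by absolutely
    convergent real power series form a ring, by Cauchy products
    ([sums_to_conv], [real_analytic_normal_form]).

    The function theory starts from the mere existence of the complex derivative.
    Goursat's bisection argument gives primitives on the plane
    ([goursat], [holo_primitive]). It still applies to the difference quotient of
    an entire function, whose only possible singularity can be placed at a corner
    of the rectangles ([goursat_punctured]). The primitive of that quotient makes
    its circle integrals vanish, which is Cauchy's formula ([cauchy_formula]).
    Expanding the Cauchy kernel yields the Taylor series ([taylor]), the mean value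
    property, and the differentiability of the derivative ([holo_derivative]).

    Differentiability is handled throughout in the form
    [F (p + v) = F p + al * v + be * conj v + o(v)], in which [al] and [be] are the
    Wirtinger derivatives ([wdiff]). *)

(** Algebraic goals stated over one of the several structures carried by [C]. *)
Ltac Cring := match goal with |- @eq _ ?a ?b => change (@eq C a b); ring end.
Ltac Cfield := match goal with |- @eq _ ?a ?b => change (@eq C a b); field end.

Lemma RtoC_conj (r : R) : Cconj (RtoC r) = RtoC r.
Proof. unfold Cconj, RtoC; simpl. f_equal; ring. Qed.

Ltac push_conj := repeat first [rewrite Cplus_conj | rewrite Cminus_conj | rewrite Cmult_conj
  | rewrite Cconj_conj | rewrite RtoC_conj].

(** * Wirtinger calculus *)

Definition little_o (E : C -> C) : Prop :=
  forall eps, 0 < eps -> exists del, 0 < del /\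
    forall v, Cmod v < del -> Cmod (E v) <= eps * Cmod v.

(** Real differentiability at [p] with differential [v |-> al v + be conj v]:
    the two coefficients are the Wirtinger derivatives, and [be = 0] is complex
    differentiability. *)
Definition wdiff (F : C -> C) (p al be : C) : Prop :=
  little_o (fun v => F (p + v) - F p - (al * v + be * Cconj v))%C.

Lemma little_o_ext E1 E2 : (forall v, E1 v = E2 v) -> little_o E1 -> little_o E2.
Proof.
  intros H H1 eps He. destruct (H1 eps He) as [d [Hd K]].
  exists d; split; auto. intros v Hv. rewrite <- H; auto.
Qed.

Lemma little_o_plus E1 E2 :
  little_o E1 -> little_o E2 -> little_o (fun v => E1 v + E2 v)%C.
Proof.
  intros H1 H2 eps He.
  destruct (H1 (eps / 2) ltac:(lra)) as [d1 [Hd1 K1]].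
  destruct (H2 (eps / 2) ltac:(lra)) as [d2 [Hd2 K2]].
  exists (Rmin d1 d2); split. { now apply Rmin_glb_lt. }
  intros v Hv.
  specialize (K1 v (Rlt_le_trans _ _ _ Hv (Rmin_l _ _))).
  specialize (K2 v (Rlt_le_trans _ _ _ Hv (Rmin_r _ _))).
  eapply Rle_trans; [apply Cmod_triangle|lra].
Qed.

Definition near_bounded (G : C -> C) : Prop :=
  exists M del, 0 < del /\ forall v, Cmod v < del -> Cmod (G v) <= M.

Lemma little_o_mult_bounded G E :
  near_bounded G -> little_o E -> little_o (fun v => G v * E v)%C.
Proof.
  intros [M [d [Hd K]]] HE eps He.
  assert (HM : 0 < Rabs M + 1) by (pose proof (Rabs_pos M); lra).
  destruct (HE (eps / (Rabs M + 1)) ltac:(now apply Rdiv_lt_0_compat)) as [d2 [Hd2 K2]].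
  exists (Rmin d d2); split. { now apply Rmin_glb_lt. }
  intros v Hv.
  specialize (K v (Rlt_le_trans _ _ _ Hv (Rmin_l _ _))).
  specialize (K2 v (Rlt_le_trans _ _ _ Hv (Rmin_r _ _))).
  rewrite Cmod_mult.
  apply Rle_trans with ((Rabs M + 1) * (eps / (Rabs M + 1) * Cmod v)).
  - apply Rmult_le_compat; try apply Cmod_ge_0; auto.
    pose proof (Rle_abs M); lra.
  - right; field; lra.
Qed.

Lemma little_o_quadratic E M :
  (exists del, 0 < del /\ forall v, Cmod v < del -> Cmod (E v) <= M * Cmod v ^ 2) ->
  little_o E.
Proof.
  intros [d [Hd H]] eps He.
  assert (HM : 0 < Rabs M + 1) by (pose proof (Rabs_pos M); lra).
  exists (Rmin d (eps / (Rabs M + 1))); split.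
  { apply Rmin_glb_lt; auto. now apply Rdiv_lt_0_compat. }
  intros v Hv.
  assert (H1 := H v (Rlt_le_trans _ _ _ Hv (Rmin_l _ _))).
  assert (H2 := Rlt_le_trans _ _ _ Hv (Rmin_r _ _)).
  apply Rle_trans with (1 := H1).
  assert (H0 := Cmod_ge_0 v).
  apply Rle_trans with ((Rabs M + 1) * Cmod v * Cmod v).
  - pose proof (Rle_abs M). nra.
  - apply Rmult_le_compat_r; auto.
    apply (Rmult_lt_compat_l (Rabs M + 1)) in H2; auto.
    replace ((Rabs M + 1) * (eps / (Rabs M + 1))) with eps in H2 by (field; lra). lra.
Qed.

Lemma wdiff_ext F G p al be :
  (forall v, F v = G v) -> wdiff F p al be -> wdiff G p al be.
Proof.
  intros H. apply little_o_ext. intros v. now rewrite !H.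
Qed.

Lemma Cmod_linear_le al be v :
  Cmod (al * v + be * Cconj v)%C <= (Cmod al + Cmod be) * Cmod v.
Proof.
  eapply Rle_trans; [apply Cmod_triangle|].
  rewrite !Cmod_mult, Cmod_conj. lra.
Qed.

Lemma wdiff_lipschitz F p al be : wdiff F p al be ->
  exists M del, 0 < M /\ 0 < del /\
    forall v, Cmod v < del -> Cmod (F (p + v) - F p)%C <= M * Cmod v.
Proof.
  intros H. destruct (H 1 Rlt_0_1) as [d [Hd K]].
  exists (1 + (Cmod al + Cmod be)), d.
  pose proof (Cmod_ge_0 al); pose proof (Cmod_ge_0 be).
  split; [lra|split; auto].
  intros v Hv. specialize (K v Hv).
  replace (F (p + v) - F p)%C with
    ((F (p + v) - F p - (al * v + be * Cconj v)) + (al * v + be * Cconj v))%C by ring.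
  eapply Rle_trans; [apply Cmod_triangle|].
  pose proof (Cmod_linear_le al be v). lra.
Qed.

Lemma wdiff_cont F p al be : wdiff F p al be ->
  forall eps, 0 < eps -> exists del, 0 < del /\
    forall v, Cmod v < del -> Cmod (F (p + v) - F p)%C < eps.
Proof.
  intros H eps He. destruct (wdiff_lipschitz _ _ _ _ H) as [M [d [HM [Hd K]]]].
  exists (Rmin d (eps / M)); split.
  { apply Rmin_glb_lt; auto. now apply Rdiv_lt_0_compat. }
  intros v Hv.
  assert (H2 := Rlt_le_trans _ _ _ Hv (Rmin_r _ _)).
  eapply Rle_lt_trans; [apply K, (Rlt_le_trans _ _ _ Hv (Rmin_l _ _))|].
  apply (Rmult_lt_compat_l M) in H2; auto.
  replace (M * (eps / M)) with eps in H2 by (field; lra). lra.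
Qed.

Lemma wdiff_near_bounded F p al be : wdiff F p al be ->
  near_bounded (fun v => F (p + v))%C.
Proof.
  intros H. destruct (wdiff_cont _ _ _ _ H 1 Rlt_0_1) as [d [Hd K]].
  exists (1 + Cmod (F p)), d; split; auto. intros v Hv.
  replace (F (p + v))%C with ((F (p + v) - F p) + F p)%C by ring.
  eapply Rle_trans; [apply Cmod_triangle|]. specialize (K v Hv). lra.
Qed.

Lemma near_bounded_const (k : C) : near_bounded (fun _ => k).
Proof. exists (Cmod k), 1; split; [lra|]. intros; lra. Qed.

Lemma wdiff_affine (k al be p : C) :
  wdiff (fun v => k + (al * v + be * Cconj v))%C p al be.
Proof.
  intros eps He. exists 1; split; [lra|]. intros v _.
  replace (_ - _)%C with (RtoC 0).
  - rewrite Cmod_0. pose proof (Cmod_ge_0 v). nra.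
  - rewrite Cplus_conj. ring.
Qed.

Lemma wdiff_const k p : wdiff (fun _ => k) p 0 0.
Proof.
  apply wdiff_ext with (2 := wdiff_affine k 0 0 p). intros v; ring.
Qed.

Lemma wdiff_id p : wdiff (fun v => v) p 1 0.
Proof.
  apply wdiff_ext with (2 := wdiff_affine 0 1 0 p). intros v; ring.
Qed.

Lemma wdiff_plus F G p al be ga de :
  wdiff F p al be -> wdiff G p ga de ->
  wdiff (fun v => F v + G v)%C p (al + ga) (be + de).
Proof.
  intros HF HG. generalize (little_o_plus _ _ HF HG).
  apply little_o_ext. intros v; ring.
Qed.

(** The error splits as [o(v) * G(p + v)], a product of two increments, which is
    quadratic, and [F p * o(v)]. *)
Lemma wdiff_mult F G p al be ga de :
  wdiff F p al be -> wdiff G p ga de ->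
  wdiff (fun v => F v * G v)%C p (al * G p + F p * ga) (be * G p + F p * de).
Proof.
  intros HF HG.
  assert (H1 := little_o_mult_bounded _ _ (wdiff_near_bounded _ _ _ _ HG) HF).
  assert (H2 := little_o_mult_bounded _ _ (near_bounded_const (F p)) HG).
  assert (H3 : little_o (fun v => (al * v + be * Cconj v) * (G (p + v) - G p))%C).
  { destruct (wdiff_lipschitz _ _ _ _ HG) as [M [d [HM [Hd K]]]].
    apply little_o_quadratic with ((Cmod al + Cmod be) * M).
    exists d; split; auto. intros v Hv. rewrite Cmod_mult.
    replace ((Cmod al + Cmod be) * M * Cmod v ^ 2)
      with (((Cmod al + Cmod be) * Cmod v) * (M * Cmod v)) by ring.
    apply Rmult_le_compat; try apply Cmod_ge_0; auto using Cmod_linear_le. }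
  generalize (little_o_plus _ _ H1 (little_o_plus _ _ H2 H3)).
  apply little_o_ext. intros v; ring.
Qed.

Lemma wdiff_conj F p al be :
  wdiff F p al be -> wdiff (fun v => Cconj (F v)) p (Cconj be) (Cconj al).
Proof.
  intros H eps He. destruct (H eps He) as [d [Hd K]].
  exists d; split; auto. intros v Hv. rewrite <- Cmod_conj.
  replace (Cconj _) with (F (p + v) - F p - (al * v + be * Cconj v))%C; auto.
  rewrite !Cminus_conj, !Cplus_conj, !Cmult_conj, !Cconj_conj. ring.
Qed.

Lemma wdiff_eq F p al be al' be' :
  wdiff F p al be -> al = al' -> be = be' -> wdiff F p al' be'.
Proof. intros; now subst. Qed.

Lemma wdiff_scal k F p al be :
  wdiff F p al be -> wdiff (fun v => k * F v)%C p (k * al) (k * be).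
Proof.
  intros H. eapply wdiff_eq; [apply (wdiff_mult _ _ _ _ _ _ _ (wdiff_const k p) H)| |]; ring.
Qed.

Lemma wdiff_minus F G p al be ga de :
  wdiff F p al be -> wdiff G p ga de ->
  wdiff (fun v => F v - G v)%C p (al - ga) (be - de).
Proof.
  intros HF HG.
  apply wdiff_ext with (fun v => F v + (- (1)) * G v)%C; [intros; ring|].
  eapply wdiff_eq; [apply (wdiff_plus _ _ _ _ _ _ _ HF (wdiff_scal (- (1)) _ _ _ _ HG))| |]; ring.
Qed.

Lemma wdiff_comp F G p al be ga de :
  wdiff G p ga de -> wdiff F (G p) al be ->
  wdiff (fun v => F (G v)) p (al * ga + be * Cconj de) (al * de + be * Cconj ga).
Proof.
  intros HG HF.
  assert (H1 : little_o (fun v => F (G (p + v)) - F (G p)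
      - (al * (G (p + v) - G p) + be * Cconj (G (p + v) - G p)))%C).
  { intros eps He. destruct (wdiff_lipschitz _ _ _ _ HG) as [M [d [HM [Hd K]]]].
    destruct (HF (eps / M) ltac:(now apply Rdiv_lt_0_compat)) as [d2 [Hd2 K2]].
    exists (Rmin d (d2 / M)); split.
    { apply Rmin_glb_lt; auto. now apply Rdiv_lt_0_compat. }
    intros v Hv.
    specialize (K v (Rlt_le_trans _ _ _ Hv (Rmin_l _ _))).
    assert (Hv2 := Rlt_le_trans _ _ _ Hv (Rmin_r _ _)).
    apply (Rmult_lt_compat_l M) in Hv2; auto.
    replace (M * (d2 / M)) with d2 in Hv2 by (field; lra).
    specialize (K2 (G (p + v) - G p)%C (Rle_lt_trans _ _ _ K Hv2)).
    replace (G p + (G (p + v) - G p))%C with (G (p + v))%C in K2 by ring.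
    eapply Rle_trans; [apply K2|].
    replace (eps * Cmod v) with (eps / M * (M * Cmod v)) by (field; lra).
    apply Rmult_le_compat_l; auto. apply Rlt_le; now apply Rdiv_lt_0_compat. }
  assert (H2 := little_o_mult_bounded _ _ (near_bounded_const al) HG).
  assert (H3 := little_o_mult_bounded _ _ (near_bounded_const be) (wdiff_conj _ _ _ _ HG)).
  generalize (little_o_plus _ _ H1 (little_o_plus _ _ H2 H3)).
  apply little_o_ext. intros v. rewrite !Cminus_conj. ring.
Qed.

Lemma real_scal_C (k : R) (z : C) : @scal R_AbsRing C_R_NormedModule k z = (RtoC k * z)%C.
Proof.
  unfold scal; simpl. unfold prod_scal, Cmult, RtoC; simpl.
  unfold scal; simpl. unfold mult; simpl. f_equal; ring.
Qed.

Lemma norm_C_R (z : C) : @norm R_AbsRing C_R_NormedModule z = Cmod z.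
Proof. symmetry. exact (Cmod_norm z). Qed.

Lemma wdiff_filterdiff F p al be : wdiff F p al be ->
  @filterdiff R_AbsRing C_R_NormedModule C_R_NormedModule F (locally p)
    (fun v => al * v + be * Cconj v)%C.
Proof.
  intros H. split.
  - split.
    + intros x y.
      change (al * (x + y) + be * Cconj (x + y)
        = (al * x + be * Cconj x) + (al * y + be * Cconj y))%C.
      rewrite Cplus_conj. ring.
    + intros k x.
      rewrite !real_scal_C. rewrite Cmult_conj.
      rewrite RtoC_conj.
      Cring.
    + exists (Cmod al + Cmod be + 1). pose proof (Cmod_ge_0 al); pose proof (Cmod_ge_0 be).
      split; [lra|]. intros x.
      rewrite !norm_C_R.
      eapply Rle_trans; [apply Cmod_linear_le|]. pose proof (Cmod_ge_0 x); nra.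
  - intros x Hx.
    apply (@is_filter_lim_locally_unique R_AbsRing C_R_NormedModule) in Hx. subst x.
    intros eps. destruct (H eps (cond_pos eps)) as [d [Hd K]].
    apply (@locally_le_locally_norm R_AbsRing C_R_NormedModule p). exists (mkposreal d Hd). intros y Hy.
    unfold ball_norm in Hy. rewrite norm_C_R in Hy. rewrite !norm_C_R.
    change (Cmod (F y - F p - (al * (y - p) + be * Cconj (y - p))) <= eps * Cmod (y - p))%C.
    replace (F y) with (F (p + (y - p)))%C by (f_equal; ring).
    now apply K.
Qed.

Lemma wdiff_curve F (g : R -> C) t dg al be :
  @is_derive R_AbsRing C_R_NormedModule g t dg -> wdiff F (g t) al be ->
  @is_derive R_AbsRing C_R_NormedModule (fun s => F (g s)) t
    (al * dg + be * Cconj dg)%C.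
Proof.
  intros Hg HF.
  eapply filterdiff_ext_lin.
  - apply (filterdiff_comp' g F t _ _ Hg (wdiff_filterdiff _ _ _ _ HF)).
  - intros y. simpl. rewrite !real_scal_C, Cmult_conj.
    rewrite RtoC_conj.
    Cring.
Qed.

Lemma is_derive_C_pair (x y : R -> R) t dx dy :
  is_derive x t dx -> is_derive y t dy ->
  @is_derive R_AbsRing C_R_NormedModule (fun s => (x s, y s)) t (dx, dy).
Proof.
  intros H1 H2.
  assert (K1 := @is_derive_scal_l R_AbsRing C_R_NormedModule x t dx (RtoC 1) H1).
  assert (K2 := @is_derive_scal_l R_AbsRing C_R_NormedModule y t dy Ci H2).
  assert (K := is_derive_plus _ _ _ _ _ K1 K2). simpl in K.
  rewrite !real_scal_C in K.
  replace (dx, dy) with (RtoC dx * 1 + RtoC dy * Ci)%C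
    by (unfold Cplus, Cmult, Ci, RtoC; simpl; f_equal; ring).
  eapply is_derive_ext; [|exact K].
  intros s; simpl. rewrite !real_scal_C.
  change plus with Cplus. unfold Cplus, Cmult, Ci, RtoC; simpl. f_equal; ring.
Qed.

Lemma is_derive_C_Re (g : R -> C) t dg :
  @is_derive R_AbsRing C_R_NormedModule g t dg -> is_derive (fun s => Re (g s)) t (Re dg).
Proof.
  intros H.
  apply (filterdiff_comp' g (fun z : C_R_NormedModule => fst z) t _ _ H
    (filterdiff_linear _ (@is_linear_fst R_AbsRing R_NormedModule R_NormedModule))).
Qed.

Lemma is_derive_C_Im (g : R -> C) t dg :
  @is_derive R_AbsRing C_R_NormedModule g t dg -> is_derive (fun s => Im (g s)) t (Im dg).
Proof.
  intros H.
  apply (filterdiff_comp' g (fun z : C_R_NormedModule => snd z) t _ _ H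
    (filterdiff_linear _ (@is_linear_snd R_AbsRing R_NormedModule R_NormedModule))).
Qed.

Lemma is_derive_horizontal (y t : R) :
  @is_derive R_AbsRing C_R_NormedModule (fun s => (s, y)) t (RtoC 1).
Proof. apply is_derive_C_pair; auto_derive; auto. Qed.

Lemma is_derive_vertical (x t : R) :
  @is_derive R_AbsRing C_R_NormedModule (fun s => (x, s)) t Ci.
Proof. apply is_derive_C_pair; auto_derive; auto. Qed.

Lemma C_eta (z : C) : (Re z, Im z) = z.
Proof. now destruct z. Qed.

Lemma wdiff_wirtinger F p al be :
  wdiff F p al be -> wirtinger F p = al /\ wirtinger_bar F p = be.
Proof.
  intros H.
  assert (Hx : partial_x F p = (al + be)%C).
  { rewrite <- (C_eta p) in H.
    assert (K := wdiff_curve F _ (Re p) _ _ _ (is_derive_horizontal (Im p) (Re p)) H).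
    unfold partial_x.
    etransitivity.
    { apply f_equal2; apply is_derive_unique.
      - exact (is_derive_C_Re _ _ _ K).
      - exact (is_derive_C_Im _ _ _ K). }
    rewrite C_eta. unfold Cconj, RtoC, Cplus, Cmult; simpl; f_equal; ring. }
  assert (Hy : partial_y F p = (Ci * (al - be))%C).
  { rewrite <- (C_eta p) in H.
    assert (K := wdiff_curve F _ (Im p) _ _ _ (is_derive_vertical (Re p) (Im p)) H).
    unfold partial_y.
    etransitivity.
    { apply f_equal2; apply is_derive_unique.
      - exact (is_derive_C_Re _ _ _ K).
      - exact (is_derive_C_Im _ _ _ K). }
    rewrite C_eta. unfold Cconj, Ci, Cplus, Cmult, Cminus, Copp; simpl; f_equal; ring. }
  unfold wirtinger, wirtinger_bar. rewrite Hx, Hy.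
  assert (I2 : (Ci * Ci = - (1))%C)
    by (unfold Ci, Cmult, Copp, RtoC; simpl; f_equal; ring).
  split.
  - replace (al + be - Ci * (Ci * (al - be)))%C
      with (al + be - (Ci * Ci) * (al - be))%C by ring.
    rewrite I2. field.
  - replace (al + be + Ci * (Ci * (al - be)))%C
      with (al + be + (Ci * Ci) * (al - be))%C by ring.
    rewrite I2. field.
Qed.

Lemma filterdiff_wdiff F p al be :
  @filterdiff R_AbsRing C_R_NormedModule C_R_NormedModule F (locally p)
    (fun v => al * v + be * Cconj v)%C -> wdiff F p al be.
Proof.
  intros [_ H] eps He.
  destruct (@locally_norm_le_locally R_AbsRing C_R_NormedModule p _ (H p (fun P K => K) (mkposreal eps He))) as [d K].
  exists d; split; [apply cond_pos|]. intros v Hv.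
  specialize (K (p + v)%C).
  replace (Cmod v) with (Cmod (p + v - p)%C) in Hv by (f_equal; ring).
  unfold ball_norm in K. rewrite !norm_C_R in K. specialize (K Hv).
  change (Cmod (F (p + v) - F p - (al * (p + v - p) + be * Cconj (p + v - p)))
    <= eps * Cmod (p + v - p))%C in K.
  now replace (p + v - p)%C with v in K by ring.
Qed.

Lemma real_differentiable_wdiff F p :
  real_differentiable F -> wdiff F p (wirtinger F p) (wirtinger_bar F p).
Proof.
  intros H. destruct (H p) as [l Hl].
  (* the real-linear map [l] is [v |-> al v + be conj v] for these two numbers *)
  set (l1 := l (RtoC 1) : C). set (li := l Ci : C).
  pose (al := ((l1 - Ci * li) / 2)%C). pose (be := ((l1 + Ci * li) / 2)%C).
  assert (W : wdiff F p al be).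
  { apply filterdiff_wdiff. eapply filterdiff_ext_lin; [exact Hl|].
    intros v. destruct Hl as [[Lp Ls _] _].
    assert (E : l v = (RtoC (Re v) * l1 + RtoC (Im v) * li)%C).
    { unfold l1, li. rewrite <- !real_scal_C, <- !Ls. etransitivity; [|apply Lp]. f_equal.
      rewrite !real_scal_C. change plus with Cplus.
      destruct v; unfold Cplus, Cmult, Ci, RtoC; simpl; f_equal; ring. }
    rewrite E. unfold al, be.
    destruct l1 as [a b], li as [c d], v as [x y].
    unfold Cdiv, Cinv, Cconj, Ci, Cplus, Cmult, Cminus, Copp, RtoC; simpl; f_equal; field. }
  destruct (wdiff_wirtinger _ _ _ _ W) as [-> ->]. exact W.
Qed.

Lemma is_derive_wdiff F p l :
  @is_derive C_AbsRing C_NormedModule F p l -> wdiff F p l 0.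
Proof.
  intros [_ H] eps He.
  destruct (H p (fun P K => K) (mkposreal eps He)) as [d K].
  exists d; split; [apply cond_pos|]. intros v Hv.
  specialize (K (p + v)%C).
  replace (Cmod v) with (Cmod (p + v - p)%C) in Hv by (f_equal; ring).
  specialize (K Hv).
  change (Cmod (F (p + v) - F p - (p + v - p) * l) <= eps * Cmod (p + v - p))%C in K.
  replace (p + v - p)%C with v in K by ring.
  replace (l * v + 0 * Cconj v)%C with (v * l)%C by ring. exact K.
Qed.

(** The derivative is a parameter: the rules below compute it, and no
    derivative has to be chosen. *)
Definition holo (F dF : C -> C) : Prop := forall p, wdiff F p (dF p) 0.

Lemma entire_holo F : entire F -> exists dF, holo F dF.
Proof.
  intros H. exists (C_derive F). intros p. apply is_derive_wdiff.
  apply C_derive_correct; auto.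
Qed.

Lemma holo_const k : holo (fun _ => k) (fun _ => 0%C).
Proof. intros p; apply wdiff_const. Qed.

Lemma holo_id : holo (fun v => v) (fun _ => 1%C).
Proof. intros p; apply wdiff_id. Qed.

Lemma holo_plus F G dF dG :
  holo F dF -> holo G dG -> holo (fun v => F v + G v)%C (fun v => dF v + dG v)%C.
Proof.
  intros HF HG p. eapply wdiff_eq; [apply (wdiff_plus _ _ _ _ _ _ _ (HF p) (HG p))|auto|ring].
Qed.

Lemma holo_minus F G dF dG :
  holo F dF -> holo G dG -> holo (fun v => F v - G v)%C (fun v => dF v - dG v)%C.
Proof.
  intros HF HG p. eapply wdiff_eq; [apply (wdiff_minus _ _ _ _ _ _ _ (HF p) (HG p))|auto|ring].
Qed.

Lemma holo_mult F G dF dG :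
  holo F dF -> holo G dG ->
  holo (fun v => F v * G v)%C (fun v => dF v * G v + F v * dG v)%C.
Proof.
  intros HF HG p. eapply wdiff_eq; [apply (wdiff_mult _ _ _ _ _ _ _ (HF p) (HG p))|auto|ring].
Qed.

Lemma holo_comp F G dF dG :
  holo F dF -> holo G dG -> holo (fun v => F (G v)) (fun v => dF (G v) * dG v)%C.
Proof.
  intros HF HG p. eapply wdiff_eq; [apply (wdiff_comp _ _ _ _ _ _ _ (HG p) (HF (G p)))|ring|ring].
Qed.

(** * Integrals of complex functions of a real variable *)

Definition is_CInt : (R -> C) -> R -> R -> C -> Prop := @is_RInt C_R_NormedModule.
Definition CInt : (R -> C) -> R -> R -> C := @RInt C_R_CompleteNormedModule.

Definition curve_continuous (f : R -> C) : Prop :=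
  forall t, @continuous R_UniformSpace C_R_NormedModule f t.

Definition plane_continuous (F : C -> C) : Prop :=
  forall p eps, 0 < eps -> exists del, 0 < del /\
    forall v, Cmod v < del -> Cmod (F (p + v) - F p)%C < eps.

Lemma plane_continuous_at F (p : C) : plane_continuous F ->
  @continuous C_R_NormedModule C_R_NormedModule F p.
Proof.
  intros HF P HP.
  apply (@locally_norm_le_locally R_AbsRing C_R_NormedModule) in HP. destruct HP as [e He].
  destruct (HF p e (cond_pos e)) as [d [Hd Kd]].
  apply (@locally_le_locally_norm R_AbsRing C_R_NormedModule p).
  exists (mkposreal d Hd). intros y Hy. apply He.
  unfold ball_norm in *. rewrite norm_C_R in *.
  replace y with (p + (y - p))%C by Cring. now apply Kd.
Qed.

Lemma plane_continuous_comp F (g : R -> C) :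
  plane_continuous F -> curve_continuous g -> curve_continuous (fun t => F (g t)).
Proof.
  intros HF Hg t.
  exact (@continuous_comp R_UniformSpace C_R_NormedModule C_R_NormedModule g F t (Hg t)
    (plane_continuous_at F (g t) HF)).
Qed.

Lemma holo_continuous F dF : holo F dF -> plane_continuous F.
Proof. intros H p. exact (wdiff_cont _ _ _ _ (H p)). Qed.

Lemma curve_derive_continuous (g dg : R -> C) :
  (forall t, @is_derive R_AbsRing C_R_NormedModule g t (dg t)) -> curve_continuous g.
Proof.
  intros H t. apply (@ex_derive_continuous R_AbsRing C_R_NormedModule). now exists (dg t).
Qed.

Lemma curve_continuous_horizontal y : curve_continuous (fun s => (s, y)).
Proof.
  apply curve_derive_continuous with (fun _ => RtoC 1). intros t; apply is_derive_horizontal.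
Qed.

Lemma curve_continuous_vertical x : curve_continuous (fun s => (x, s)).
Proof.
  apply curve_derive_continuous with (fun _ => Ci). intros t; apply is_derive_vertical.
Qed.

Lemma is_CInt_unique f a b l : is_CInt f a b l -> CInt f a b = l.
Proof. apply (@is_RInt_unique C_R_CompleteNormedModule). Qed.

Lemma CInt_correct f a b : curve_continuous f -> is_CInt f a b (CInt f a b).
Proof.
  intros H. apply (@RInt_correct C_R_CompleteNormedModule).
  apply (@ex_RInt_continuous C_R_CompleteNormedModule). intros z _; apply H.
Qed.

Lemma is_CInt_mult c f a b l :
  is_CInt f a b l -> is_CInt (fun t => c * f t)%C a b (c * l)%C.
Proof.
  intros H.
  assert (H1 := is_RInt_fct_extend_fst _ _ _ _ H).
  assert (H2 := is_RInt_fct_extend_snd _ _ _ _ H).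
  simpl in H1, H2.
  apply (@is_RInt_fct_extend_pair R_NormedModule R_NormedModule).
  - exact (is_RInt_minus _ _ _ _ _ _ (is_RInt_scal _ _ _ (fst c) _ H1)
      (is_RInt_scal _ _ _ (snd c) _ H2)).
  - exact (is_RInt_plus _ _ _ _ _ _ (is_RInt_scal _ _ _ (fst c) _ H2)
      (is_RInt_scal _ _ _ (snd c) _ H1)).
Qed.

Lemma is_CInt_plus f g a b l m :
  is_CInt f a b l -> is_CInt g a b m -> is_CInt (fun t => f t + g t)%C a b (l + m)%C.
Proof. intros H1 H2. exact (is_RInt_plus _ _ _ _ _ _ H1 H2). Qed.

Lemma is_CInt_minus f g a b l m :
  is_CInt f a b l -> is_CInt g a b m -> is_CInt (fun t => f t - g t)%C a b (l - m)%C.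
Proof. intros H1 H2. exact (is_RInt_minus _ _ _ _ _ _ H1 H2). Qed.

Lemma is_CInt_const c a b : is_CInt (fun _ => c) a b (RtoC (b - a) * c)%C.
Proof.
  rewrite <- real_scal_C. apply (@is_RInt_const C_R_NormedModule).
Qed.

Lemma is_CInt_derive (g dg : R -> C) a b :
  (forall t, @is_derive R_AbsRing C_R_NormedModule g t (dg t)) -> curve_continuous dg ->
  is_CInt dg a b (g b - g a)%C.
Proof.
  intros H1 H2. apply (@is_RInt_derive C_R_CompleteNormedModule); intros; auto.
Qed.

Lemma CInt_Chasles f a b c :
  curve_continuous f -> (CInt f a b + CInt f b c)%C = CInt f a c.
Proof.
  intros H. apply (@RInt_Chasles C_R_CompleteNormedModule);
  apply (@ex_RInt_continuous C_R_CompleteNormedModule); intros z _; apply H.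
Qed.

Lemma CInt_swap f a b : curve_continuous f -> CInt f b a = (- CInt f a b)%C.
Proof.
  intros H. apply is_CInt_unique.
  exact (@is_RInt_swap C_R_NormedModule _ _ _ _ (CInt_correct f a b H)).
Qed.

Lemma is_CInt_Cmod_le f a b l M : a <= b ->
  (forall t, a <= t <= b -> Cmod (f t) <= M) -> is_CInt f a b l -> Cmod l <= (b - a) * M.
Proof.
  intros Hab H HI. rewrite <- norm_C_R.
  apply (@norm_RInt_le_const C_R_NormedModule f a b l M Hab); auto.
  intros x Hx. rewrite norm_C_R. auto.
Qed.

Lemma CInt_near f a b c eps : curve_continuous f ->
  (forall t, Rmin a b <= t <= Rmax a b -> Cmod (f t - c)%C <= eps) ->
  Cmod (CInt f a b - RtoC (b - a) * c)%C <= eps * Rabs (b - a).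
Proof.
  intros Hf.
  assert (L : forall a b, a <= b -> (forall t, Rmin a b <= t <= Rmax a b -> Cmod (f t - c)%C <= eps) ->
    Cmod (CInt f a b - RtoC (b - a) * c)%C <= eps * Rabs (b - a)).
  { clear a b. intros a b Hab H. rewrite Rmin_left, Rmax_right in H by auto.
    rewrite Rabs_pos_eq by lra. rewrite Rmult_comm.
    apply (is_CInt_Cmod_le (fun t => f t - c)%C a b); auto.
    apply is_CInt_minus; [now apply CInt_correct|apply is_CInt_const]. }
  intros H. destruct (Rle_dec a b) as [Hab|Hab]; auto.
  rewrite CInt_swap by auto.
  rewrite Rmin_comm, Rmax_comm in H.
  specialize (L b a ltac:(lra) H).
  rewrite <- Cmod_opp, <- Rabs_Ropp.
  replace (- (b - a)) with (a - b) by ring.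
  replace (- (- CInt f b a - RtoC (b - a) * c))%C with (CInt f b a - RtoC (a - b) * c)%C; auto.
  replace (RtoC (a - b)) with (- RtoC (b - a))%C. ring.
  rewrite <- RtoC_opp. f_equal; ring.
Qed.

(** * Goursat's lemma and primitives *)

Definition hseg (F : C -> C) (y x0 x1 : R) : C := CInt (fun t => F (t, y)) x0 x1.
Definition vseg (F : C -> C) (x y0 y1 : R) : C := (Ci * CInt (fun t => F (x, t)) y0 y1)%C.

(** The contour integral of [F(w) dw], counterclockwise when [x0 <= x1] and
    [y0 <= y1]. *)
Definition rect (F : C -> C) (x0 x1 y0 y1 : R) : C :=
  (hseg F y0 x0 x1 + vseg F x1 y0 y1 - hseg F y1 x0 x1 - vseg F x0 y0 y1)%C.

Section Segments.

Variable F : C -> C.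
Hypothesis HF : plane_continuous F.

Lemma horizontal_continuous y : curve_continuous (fun t => F (t, y)).
Proof. apply plane_continuous_comp; auto using curve_continuous_horizontal. Qed.

Lemma vertical_continuous x : curve_continuous (fun t => F (x, t)).
Proof. apply plane_continuous_comp; auto using curve_continuous_vertical. Qed.

Lemma hseg_Chasles y a b c : (hseg F y a b + hseg F y b c)%C = hseg F y a c.
Proof. apply CInt_Chasles, horizontal_continuous. Qed.

Lemma vseg_Chasles x a b c : (vseg F x a b + vseg F x b c)%C = vseg F x a c.
Proof.
  unfold vseg. rewrite <- (CInt_Chasles _ a b c) by apply vertical_continuous. ring.
Qed.

Lemma hseg_near y a b c eps :
  (forall t, Rmin a b <= t <= Rmax a b -> Cmod (F (t, y) - c)%C <= eps) ->
  Cmod (hseg F y a b - RtoC (b - a) * c)%C <= eps * Rabs (b - a).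
Proof. apply CInt_near, horizontal_continuous. Qed.

Lemma vseg_near x a b c eps :
  (forall t, Rmin a b <= t <= Rmax a b -> Cmod (F (x, t) - c)%C <= eps) ->
  Cmod (vseg F x a b - Ci * (RtoC (b - a) * c))%C <= eps * Rabs (b - a).
Proof.
  intros H. unfold vseg.
  match goal with |- Cmod (Ci * ?X - Ci * ?Y)%C <= _ =>
    replace (Ci * X - Ci * Y)%C with (Ci * (X - Y))%C by ring end.
  rewrite Cmod_mult, Cmod_Ci, Rmult_1_l. now apply CInt_near; [apply vertical_continuous|].
Qed.

Lemma rect_split_x x0 x x1 y0 y1 :
  rect F x0 x1 y0 y1 = (rect F x0 x y0 y1 + rect F x x1 y0 y1)%C.
Proof. unfold rect. rewrite <- (hseg_Chasles y0 x0 x x1), <- (hseg_Chasles y1 x0 x x1). ring. Qed.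

Lemma rect_split_y x0 x1 y0 y y1 :
  rect F x0 x1 y0 y1 = (rect F x0 x1 y0 y + rect F x0 x1 y y1)%C.
Proof. unfold rect. rewrite <- (vseg_Chasles x0 y0 y y1), <- (vseg_Chasles x1 y0 y y1). ring. Qed.

Lemma rect_swap_x x0 x1 y0 y1 : rect F x1 x0 y0 y1 = (- rect F x0 x1 y0 y1)%C.
Proof.
  unfold rect, hseg. rewrite (CInt_swap _ x0 x1), (CInt_swap _ x0 x1) by apply horizontal_continuous.
  ring.
Qed.

Lemma rect_swap_y x0 x1 y0 y1 : rect F x0 x1 y1 y0 = (- rect F x0 x1 y0 y1)%C.
Proof.
  unfold rect, vseg. rewrite (CInt_swap _ y0 y1), (CInt_swap _ y0 y1) by apply vertical_continuous.
  ring.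
Qed.

Lemma rect_bound x0 x1 y0 y1 M :
  (forall x y, Rmin x0 x1 <= x <= Rmax x0 x1 -> Rmin y0 y1 <= y <= Rmax y0 y1 ->
     Cmod (F (x, y)) <= M) ->
  Cmod (rect F x0 x1 y0 y1) <= 2 * M * (Rabs (x1 - x0) + Rabs (y1 - y0)).
Proof.
  intros H.
  assert (Hx0 : Rmin x0 x1 <= x0 <= Rmax x0 x1) by (split; [apply Rmin_l|apply Rmax_l]).
  assert (Hx1 : Rmin x0 x1 <= x1 <= Rmax x0 x1) by (split; [apply Rmin_r|apply Rmax_r]).
  assert (Hy0 : Rmin y0 y1 <= y0 <= Rmax y0 y1) by (split; [apply Rmin_l|apply Rmax_l]).
  assert (Hy1 : Rmin y0 y1 <= y1 <= Rmax y0 y1) by (split; [apply Rmin_r|apply Rmax_r]).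
  assert (E : forall z : C, (z - 0)%C = z) by (intros; ring).
  assert (K1 := hseg_near y0 x0 x1 0 M). assert (K2 := hseg_near y1 x0 x1 0 M).
  assert (K3 := vseg_near x0 y0 y1 0 M). assert (K4 := vseg_near x1 y0 y1 0 M).
  assert (E1 : forall (z : C) (k : R), (z - RtoC k * 0)%C = z) by (intros; ring).
  assert (E2 : forall (z : C) (k : R), (z - Ci * (RtoC k * 0))%C = z) by (intros; ring).
  rewrite E1 in K1, K2. rewrite E2 in K3, K4.
  specialize (K1 ltac:(intros; rewrite E; auto)).
  specialize (K2 ltac:(intros; rewrite E; auto)).
  specialize (K3 ltac:(intros; rewrite E; auto)).
  specialize (K4 ltac:(intros; rewrite E; auto)).
  unfold rect.
  unfold Cminus. eapply Rle_trans; [apply Cmod_triangle|].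
  rewrite Cmod_opp.
  eapply Rle_trans; [apply Rplus_le_compat_r, Cmod_triangle|].
  rewrite Cmod_opp.
  eapply Rle_trans; [apply Rplus_le_compat_r, Rplus_le_compat_r, Cmod_triangle|].
  lra.
Qed.

End Segments.

Lemma hseg_holo P F y a b :
  holo P F -> plane_continuous F -> hseg F y a b = (P (b, y) - P (a, y))%C.
Proof.
  intros HP HF. apply is_CInt_unique.
  apply (is_CInt_derive (fun t => P (t, y)) (fun t => F (t, y))).
  - intros t. assert (K := wdiff_curve P _ t _ _ _ (is_derive_horizontal y t) (HP (t, y))).
    now replace (F (t, y) * 1 + 0 * Cconj 1)%C with (F (t, y)) in K by ring.
  - now apply horizontal_continuous.
Qed.

Lemma vseg_holo P F x a b :
  holo P F -> plane_continuous F -> vseg F x a b = (P (x, b) - P (x, a))%C.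
Proof.
  intros HP HF. unfold vseg.
  assert (H := is_CInt_mult Ci _ _ _ _ (CInt_correct _ a b (vertical_continuous F HF x))).
  apply is_CInt_unique in H. rewrite <- H. apply is_CInt_unique.
  apply (is_CInt_derive (fun t => P (x, t)) (fun t => Ci * F (x, t))%C).
  - intros t. assert (K := wdiff_curve P _ t _ _ _ (is_derive_vertical x t) (HP (x, t))).
    now replace (F (x, t) * Ci + 0 * Cconj Ci)%C with (Ci * F (x, t))%C in K by ring.
  - apply (plane_continuous_comp (fun z => Ci * z)%C).
    + apply (holo_continuous _ (fun v => 0 * v + Ci * 1)%C), holo_mult;
      [apply holo_const|apply holo_id].
    + now apply vertical_continuous.
Qed.

Lemma rect_derivative P F x0 x1 y0 y1 :
  holo P F -> plane_continuous F -> rect F x0 x1 y0 y1 = 0%C.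
Proof.
  intros HP HF. unfold rect.
  rewrite !(hseg_holo P F), !(vseg_holo P F) by auto. ring.
Qed.

Lemma rect_plus F G x0 x1 y0 y1 : plane_continuous F -> plane_continuous G ->
  rect (fun v => F v + G v)%C x0 x1 y0 y1 = (rect F x0 x1 y0 y1 + rect G x0 x1 y0 y1)%C.
Proof.
  intros HF HG. unfold rect.
  assert (E1 : forall y, hseg (fun v => F v + G v)%C y x0 x1 = (hseg F y x0 x1 + hseg G y x0 x1)%C).
  { intros y. apply is_CInt_unique, is_CInt_plus; now apply CInt_correct, horizontal_continuous. }
  assert (E2 : forall x, vseg (fun v => F v + G v)%C x y0 y1 = (vseg F x y0 y1 + vseg G x y0 y1)%C).
  { intros x. unfold vseg. rewrite <- Cmult_plus_distr_l. f_equal.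
    apply is_CInt_unique, is_CInt_plus; now apply CInt_correct, vertical_continuous. }
  rewrite !E1, !E2. ring.
Qed.

Lemma plane_continuous_plus F G :
  plane_continuous F -> plane_continuous G -> plane_continuous (fun v => F v + G v)%C.
Proof.
  intros HF HG p eps He.
  destruct (HF p (eps / 2) ltac:(lra)) as [d1 [Hd1 K1]].
  destruct (HG p (eps / 2) ltac:(lra)) as [d2 [Hd2 K2]].
  exists (Rmin d1 d2); split. { now apply Rmin_glb_lt. }
  intros v Hv.
  specialize (K1 v (Rlt_le_trans _ _ _ Hv (Rmin_l _ _))).
  specialize (K2 v (Rlt_le_trans _ _ _ Hv (Rmin_r _ _))).
  replace (F (p + v) + G (p + v) - (F p + G p))%C
    with ((F (p + v) - F p) + (G (p + v) - G p))%C by ring.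
  eapply Rle_lt_trans; [apply Cmod_triangle|lra].
Qed.

Lemma Cmod_le_sum x y : Cmod (x, y) <= Rabs x + Rabs y.
Proof.
  replace (x, y) with (RtoC x + Ci * RtoC y)%C
    by (unfold Cplus, Cmult, Ci, RtoC; simpl; f_equal; ring).
  eapply Rle_trans; [apply Cmod_triangle|].
  rewrite Cmod_mult, Cmod_Ci, !Cmod_R. lra.
Qed.

Lemma Cplus_sub (p z : C) : (p + (z - p))%C = z.
Proof. ring. Qed.

(** Subtracting the first-order Taylor polynomial, whose boundary integrals
    vanish, leaves an integrand that is small relative to the diameter. *)
Lemma rect_small F p al eps : plane_continuous F -> wdiff F p al 0 -> 0 < eps ->
  exists del, 0 < del /\ forall x0 x1 y0 y1,
    x0 <= Re p <= x1 -> y0 <= Im p <= y1 -> (x1 - x0) + (y1 - y0) < del ->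
    Cmod (rect F x0 x1 y0 y1) <= 2 * eps * ((x1 - x0) + (y1 - y0)) ^ 2.
Proof.
  intros HF Hp He. destruct (Hp eps He) as [d [Hd K]].
  exists d; split; auto. intros x0 x1 y0 y1 Hx Hy Hs.
  set (s := (x1 - x0) + (y1 - y0)) in *.
  pose (L := fun v => (- (F p + al * (v - p)))%C).
  assert (HL : holo (fun v => - (F p * v + al * (v * v / 2 - p * v)))%C L).
  { intros q.
    apply wdiff_ext with (fun v => (- (F p - al * p)) * v + (- (al / 2)) * (v * v))%C.
    { intros v. field. }
    eapply wdiff_eq;
    [apply (wdiff_plus _ _ _ _ _ _ _ (wdiff_scal _ _ _ _ _ (wdiff_id q))
      (wdiff_scal _ _ _ _ _ (wdiff_mult _ _ _ _ _ _ _ (wdiff_id q) (wdiff_id q))))| |].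
    - unfold L. field.
    - field. }
  assert (HLc : plane_continuous L).
  { apply (holo_continuous L (fun _ => - al)%C). intros q.
    apply wdiff_ext with (fun v => (- F p + al * p) + ((- al) * v + 0 * Cconj v))%C;
    [intros v; unfold L; ring|apply wdiff_affine]. }
  assert (E : rect F x0 x1 y0 y1 = rect (fun v => F v + L v)%C x0 x1 y0 y1).
  { rewrite rect_plus, (rect_derivative _ L _ _ _ _ HL) by auto. ring. }
  rewrite E.
  eapply Rle_trans; [apply rect_bound with (M := eps * s)|].
  - now apply plane_continuous_plus.
  - rewrite Rmin_left, Rmax_right, Rmin_left, Rmax_right by lra.
    intros x y Hx' Hy'.
    assert (B : Cmod ((x, y) - p)%C <= s).
    { destruct p as [a b]; simpl in *. eapply Rle_trans; [apply Cmod_le_sum|]. simpl.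
      unfold s. apply Rplus_le_compat; apply Rabs_le; lra. }
    specialize (K ((x, y) - p)%C (Rle_lt_trans _ _ _ B Hs)).
    rewrite Cplus_sub in K.
    replace (F (x, y) + L (x, y))%C
      with (F (x, y) - F p - (al * ((x, y) - p) + 0 * Cconj ((x, y) - p)))%C
      by (unfold L; ring).
    eapply Rle_trans; [exact K|]. apply Rmult_le_compat_l; lra.
  - rewrite !Rabs_pos_eq by lra. fold s. right; ring.
Qed.

Section Bisection.

Variable bad : nat -> R -> R -> Prop.
Variables A B x0 y0 : R.
Hypothesis bad0 : bad 0 x0 y0.
Hypothesis bad_step : forall n x y, bad n x y ->
  exists x' y', bad (S n) x' y' /\ (x' = x \/ x' = x + A / 2 ^ S n) /\
    (y' = y \/ y' = y + B / 2 ^ S n).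

Lemma bisection_sequence : exists sx sy : nat -> R, sx O = x0 /\ sy O = y0 /\
  forall n, bad n (sx n) (sy n) /\
    (sx (S n) = sx n \/ sx (S n) = sx n + A / 2 ^ S n) /\
    (sy (S n) = sy n \/ sy (S n) = sy n + B / 2 ^ S n).
Proof.
  pose (T := fun n => {p : R * R | bad n (fst p) (snd p)}).
  assert (next : forall n (s : T n), {s' : T (S n) |
    (fst (proj1_sig s') = fst (proj1_sig s) \/
     fst (proj1_sig s') = fst (proj1_sig s) + A / 2 ^ S n) /\
    (snd (proj1_sig s') = snd (proj1_sig s) \/
     snd (proj1_sig s') = snd (proj1_sig s) + B / 2 ^ S n)}).
  { intros n [[x y] Hp]. apply constructive_indefinite_description.
    destruct (bad_step n x y Hp) as [x' [y' [K1 [K2 K3]]]].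
    exists (exist (fun p : R * R => bad (S n) (fst p) (snd p)) (x', y') K1). simpl; auto. }
  pose (seq := fix seq n : T n := match n with
     | O => exist (fun p : R * R => bad O (fst p) (snd p)) (x0, y0) bad0
     | S m => proj1_sig (next m (seq m)) end).
  exists (fun n => fst (proj1_sig (seq n))), (fun n => snd (proj1_sig (seq n))).
  split; [reflexivity|split; [reflexivity|]].
  intros n. split; [exact (proj2_sig (seq n))|].
  exact (proj2_sig (next n (seq n))).
Qed.

End Bisection.

Lemma pow2_pos n : 0 < 2 ^ n.
Proof. apply pow_lt; lra. Qed.

(** [s n] increases and [s n + A / 2 ^ n] decreases, so they enclose their common
    limit. *)
Lemma dyadic_limit (s : nat -> R) A : 0 <= A ->
  (forall n, s (S n) = s n \/ s (S n) = s n + A / 2 ^ S n) ->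
  exists X, forall n, s n <= X <= s n + A / 2 ^ n.
Proof.
  intros HA H.
  assert (Hq : forall n, 0 <= A / 2 ^ n).
  { intros n. apply Rmult_le_pos; auto. apply Rlt_le, Rinv_0_lt_compat, pow2_pos. }
  assert (Hh : forall n, A / 2 ^ S n = A / 2 ^ n / 2).
  { intros n. simpl. field. apply Rgt_not_eq, pow2_pos. }
  assert (Hi : forall n, s n <= s (S n)).
  { intros n. specialize (Hq (S n)). destruct (H n); lra. }
  assert (Hd : forall n, s (S n) + A / 2 ^ S n <= s n + A / 2 ^ n).
  { intros n. specialize (Hq n). specialize (Hh n). destruct (H n); lra. }
  assert (Hm : forall n, s n <= s O + A).
  { intros n. assert (K : s n + A / 2 ^ n <= s O + A).
    { induction n; [simpl; lra|]. specialize (Hd n); lra. }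
    specialize (Hq n); lra. }
  destruct (ex_finite_lim_seq_incr s (s O + A) Hi Hm) as [X HX].
  exists X. intros n; split.
  - now apply is_lim_seq_incr_compare with (u := s).
  - assert (L : is_lim_seq (fun n => s n + A / 2 ^ n) X).
    { replace (Finite X) with (Finite (X + A * 0)) by (f_equal; ring).
      apply is_lim_seq_plus'; auto. apply is_lim_seq_mult'; [apply is_lim_seq_const|].
      apply is_lim_seq_ext with (fun n => (/ 2) ^ n).
      - intros m. now rewrite <- pow_inv.
      - apply is_lim_seq_geom. rewrite Rabs_pos_eq; lra. }
    exact (is_lim_seq_decr_compare _ _ L Hd n).
Qed.

(** Bisection: if the integral exceeded [2 eps (A + B)^2], some quarter would exceed
    a quarter of that bound, and so on down to rectangles shrinking to a point of
    differentiability, where [rect_small] forbids it. *)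
Lemma goursat_ordered F x0 x1 y0 y1 : plane_continuous F -> x0 <= x1 -> y0 <= y1 ->
  (forall x y, x0 <= x <= x1 -> y0 <= y <= y1 -> exists al, wdiff F (x, y) al 0) ->
  rect F x0 x1 y0 y1 = 0%C.
Proof.
  intros HF Hx Hy HD.
  set (A := x1 - x0). set (B := y1 - y0).
  assert (Main : forall eps, 0 < eps -> Cmod (rect F x0 x1 y0 y1) <= 2 * eps * (A + B) ^ 2).
  2:{ apply Cmod_eq_0. apply Rle_antisym; [|apply Cmod_ge_0].
      apply Rnot_lt_le. intros Hlt.
      set (r := Cmod (rect F x0 x1 y0 y1)) in *.
      assert (Hp : 0 < 4 * ((A + B) ^ 2 + 1)) by (pose proof (pow2_ge_0 (A + B)); lra).
      specialize (Main (r / (4 * ((A + B) ^ 2 + 1))) ltac:(now apply Rdiv_lt_0_compat)).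
      replace (2 * (r / (4 * ((A + B) ^ 2 + 1))) * (A + B) ^ 2)
        with (r / 2 * ((A + B) ^ 2 / ((A + B) ^ 2 + 1))) in Main
        by (field; pose proof (pow2_ge_0 (A + B)); lra).
      assert ((A + B) ^ 2 / ((A + B) ^ 2 + 1) <= 1).
      { apply Rle_div_l; pose proof (pow2_ge_0 (A + B)); lra. }
      nra. }
  intros eps He. apply Rnot_lt_le. intros Hbig.
  set (T := 2 * eps * (A + B) ^ 2) in *.
  pose (bad := fun n x y =>
    T / 4 ^ n < Cmod (rect F x (x + A / 2 ^ n) y (y + B / 2 ^ n))).
  destruct (bisection_sequence bad A B x0 y0) as [sx [sy [Ex [Ey Hs]]]].
  - unfold bad. simpl. replace (x0 + A / 1) with x1 by (unfold A; field).
    replace (y0 + B / 1) with y1 by (unfold B; field). lra.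
  - intros n x y Hb. unfold bad in Hb.
    set (a := A / 2 ^ S n). set (b := B / 2 ^ S n).
    assert (Ea : A / 2 ^ n = a + a) by (unfold a; simpl; field; apply Rgt_not_eq, pow2_pos).
    assert (Eb : B / 2 ^ n = b + b) by (unfold b; simpl; field; apply Rgt_not_eq, pow2_pos).
    rewrite Ea, Eb, <- !Rplus_assoc in Hb.
    rewrite (rect_split_x F HF x (x + a)), (rect_split_y F HF x (x + a) y (y + b)),
      (rect_split_y F HF (x + a) (x + a + a) y (y + b)) in Hb.
    set (q := T / 4 ^ S n).
    assert (Eq : T / 4 ^ n = q + q + (q + q)).
    { unfold q; simpl; field. apply pow_nonzero; lra. }
    rewrite Eq in Hb.
    assert (Hsum := Rlt_le_trans _ _ _ Hb (Cmod_triangle _ _)).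
    assert (Hs1 := Cmod_triangle (rect F x (x + a) y (y + b)) (rect F x (x + a) (y + b) (y + b + b))).
    assert (Hs2 := Cmod_triangle (rect F (x + a) (x + a + a) y (y + b))
      (rect F (x + a) (x + a + a) (y + b) (y + b + b))).
    unfold bad. fold a b q.
    destruct (Rlt_dec q (Cmod (rect F x (x + a) y (y + b)))); [exists x, y; auto|].
    destruct (Rlt_dec q (Cmod (rect F x (x + a) (y + b) (y + b + b)))); [exists x, (y + b); auto|].
    destruct (Rlt_dec q (Cmod (rect F (x + a) (x + a + a) y (y + b)))); [exists (x + a), y; auto|].
    destruct (Rlt_dec q (Cmod (rect F (x + a) (x + a + a) (y + b) (y + b + b))));
      [exists (x + a), (y + b); auto|].
    lra.
  - assert (HA : 0 <= A) by (unfold A; lra). assert (HB : 0 <= B) by (unfold B; lra).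
    destruct (dyadic_limit sx A HA (fun n => proj1 (proj2 (Hs n)))) as [X HX].
    destruct (dyadic_limit sy B HB (fun n => proj2 (proj2 (Hs n)))) as [Y HY].
    destruct (HD X Y) as [al Hal].
    { specialize (HX O). simpl in HX. rewrite Ex in HX. unfold A in HX. lra. }
    { specialize (HY O). simpl in HY. rewrite Ey in HY. unfold B in HY. lra. }
    destruct (rect_small F (X, Y) al eps HF Hal He) as [d [Hd K]].
    assert (Hn : exists n, (A + B) / 2 ^ n < d).
    { destruct (pow_lt_1_zero (/ 2) ltac:(rewrite Rabs_pos_eq; lra) (d / (A + B + 1))
        ltac:(apply Rdiv_lt_0_compat; lra)) as [N HN].
      exists N. specialize (HN N (le_n N)).
      rewrite pow_inv, Rabs_pos_eq in HN
        by (apply Rlt_le, Rinv_0_lt_compat, pow2_pos).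
      assert (P := pow2_pos N). apply Rinv_0_lt_compat in P.
      apply (Rmult_lt_compat_l (A + B + 1)) in HN; [|lra].
      replace ((A + B + 1) * (d / (A + B + 1))) with d in HN by (field; lra).
      unfold Rdiv. nra. }
    destruct Hn as [n Hn].
    destruct (Hs n) as [Hb _]. unfold bad in Hb.
    specialize (K (sx n) (sx n + A / 2 ^ n) (sy n) (sy n + B / 2 ^ n) (HX n) (HY n)).
    replace (sx n + A / 2 ^ n - sx n + (sy n + B / 2 ^ n - sy n))
      with ((A + B) / 2 ^ n) in K by (field; apply Rgt_not_eq, pow2_pos).
    specialize (K Hn).
    replace (2 * eps * ((A + B) / 2 ^ n) ^ 2) with (T / 4 ^ n) in K. lra.
    unfold T. replace 4 with (2 * 2) by ring. rewrite Rpow_mult_distr. field.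
    apply Rgt_not_eq, pow2_pos.
Qed.

Lemma goursat F x0 x1 y0 y1 : plane_continuous F ->
  (forall x y, Rmin x0 x1 <= x <= Rmax x0 x1 -> Rmin y0 y1 <= y <= Rmax y0 y1 ->
     exists al, wdiff F (x, y) al 0) ->
  rect F x0 x1 y0 y1 = 0%C.
Proof.
  intros HF H.
  assert (Hx : forall x0 x1 y0 y1, x0 <= x1 ->
    (forall x y, x0 <= x <= x1 -> Rmin y0 y1 <= y <= Rmax y0 y1 -> exists al, wdiff F (x, y) al 0) ->
    rect F x0 x1 y0 y1 = 0%C).
  { clear x0 x1 y0 y1 H. intros x0 x1 y0 y1 Hx H.
    destruct (Rle_dec y0 y1) as [Hy|Hy].
    - rewrite Rmin_left, Rmax_right in H by auto. now apply goursat_ordered.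
    - rewrite Rmin_right, Rmax_left in H by lra.
      rewrite rect_swap_y, goursat_ordered by (auto; lra). ring. }
  destruct (Rle_dec x0 x1) as [Hl|Hl].
  - rewrite Rmin_left, Rmax_right in H by auto. now apply Hx.
  - rewrite Rmin_right, Rmax_left in H by lra.
    rewrite rect_swap_x, Hx by (auto; lra). ring.
Qed.

Lemma convex_comb_between a x s t : 0 < s <= 1 ->
  Rmin (a + s * (x - a)) x <= t <= Rmax (a + s * (x - a)) x -> t = a -> x = a.
Proof.
  intros Hs Ht ->. revert Ht. unfold Rmin, Rmax.
  destruct (Rle_dec (a + s * (x - a)) x); intros [H1 H2]; nra.
Qed.

(** A single exceptional point, at a corner, is harmless: everything outside a
    small rectangle at that corner integrates to zero, and there [F] is bounded. *)
Lemma goursat_punctured F a b x y : plane_continuous F ->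
  (forall p, p <> (a, b) -> exists al, wdiff F p al 0) ->
  rect F a x b y = 0%C.
Proof.
  intros HF HD.
  destruct (Req_dec x a) as [->|Hxa].
  { unfold rect, hseg, CInt. rewrite !(@RInt_point C_R_CompleteNormedModule).
    change zero with (RtoC 0). ring. }
  destruct (Req_dec y b) as [->|Hyb].
  { unfold rect, vseg, CInt. rewrite !(@RInt_point C_R_CompleteNormedModule).
    change zero with (RtoC 0). ring. }
  destruct (HF (a, b) 1 Rlt_0_1) as [d [Hd Kd]].
  set (M := 1 + Cmod (F (a, b))). set (L := Rabs (x - a) + Rabs (y - b)).
  assert (HL : 0 <= L) by (pose proof (Rabs_pos (x - a)); pose proof (Rabs_pos (y - b)); unfold L; lra).
  assert (HM : 0 < M) by (pose proof (Cmod_ge_0 (F (a, b))); unfold M; lra).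
  assert (Main : forall s, 0 < s <= 1 -> s * L < d -> Cmod (rect F a x b y) <= s * (2 * M * L)).
  { intros s Hs Hsd.
    rewrite (rect_split_x F HF a (a + s * (x - a)) x).
    rewrite (rect_split_y F HF a (a + s * (x - a)) b (b + s * (y - b)) y).
    rewrite (goursat F a (a + s * (x - a)) (b + s * (y - b)) y), (goursat F (a + s * (x - a)) x); auto.
    - rewrite !Cplus_0_r.
      replace (s * (2 * M * L)) with (2 * M * (s * L)) by ring.
      replace (s * L) with (Rabs (a + s * (x - a) - a) + Rabs (b + s * (y - b) - b)).
      2:{ replace (a + s * (x - a) - a) with (s * (x - a)) by ring.
          replace (b + s * (y - b) - b) with (s * (y - b)) by ring.
          rewrite !Rabs_mult, (Rabs_pos_eq s) by lra. unfold L; ring. }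
      apply rect_bound; auto. intros u v Hu Hv.
      assert (Bd : forall c z t, Rmin c (c + s * (z - c)) <= t <= Rmax c (c + s * (z - c)) ->
        Rabs (t - c) <= s * Rabs (z - c)).
      { intros c z t Ht. rewrite <- (Rabs_pos_eq s), <- Rabs_mult by lra.
        revert Ht. unfold Rmin, Rmax. destruct (Rle_dec c (c + s * (z - c))); intros Ht.
        - rewrite !Rabs_pos_eq by lra. lra.
        - rewrite !Rabs_left1 by lra. lra. }
      apply Bd in Hu. apply Bd in Hv.
      assert (Hc : Cmod (((u, v) : C) - (a, b))%C < d).
      { eapply Rle_lt_trans; [apply Cmod_le_sum|]. simpl.
        eapply Rle_lt_trans; [apply Rplus_le_compat; [exact Hu|exact Hv]|].
        unfold L in Hsd. lra. }
      specialize (Kd _ Hc). rewrite Cplus_sub in Kd.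
      replace (F (u, v)) with ((F (u, v) - F (a, b)) + F (a, b))%C by ring.
      eapply Rle_trans; [apply Cmod_triangle|]. unfold M. lra.
    - intros u v Hu _. apply HD. intros E; injection E as E1 E2.
      apply Hxa. exact (convex_comb_between a x s u Hs Hu E1).
    - intros u v _ Hv. apply HD. intros E; injection E as E1 E2.
      apply Hyb. exact (convex_comb_between b y s v Hs Hv E2). }
  apply Cmod_eq_0. apply Rle_antisym; [|apply Cmod_ge_0].
  apply Rnot_lt_le. intros Hlt. set (r := Cmod (rect F a x b y)) in *.
  set (s := Rmin 1 (Rmin (d / (2 * (L + 1))) (r / (4 * M * (L + 1))))).
  assert (H1 : 0 < d / (2 * (L + 1))) by (apply Rdiv_lt_0_compat; lra).
  assert (H2 : 0 < r / (4 * M * (L + 1))).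
  { apply Rdiv_lt_0_compat; auto. apply Rmult_lt_0_compat; lra. }
  assert (Hs : 0 < s <= 1).
  { split; [|apply Rmin_l]. unfold s. repeat apply Rmin_glb_lt; auto; lra. }
  assert (Hs1 : s <= d / (2 * (L + 1))).
  { unfold s. eapply Rle_trans; [apply Rmin_r|apply Rmin_l]. }
  assert (Hs2 : s <= r / (4 * M * (L + 1))).
  { unfold s. eapply Rle_trans; [apply Rmin_r|apply Rmin_r]. }
  assert (Hd2 : s * L < d).
  { apply (Rmult_le_compat_r (2 * (L + 1))) in Hs1; [|lra].
    replace (d / (2 * (L + 1)) * (2 * (L + 1))) with d in Hs1 by (field; lra). nra. }
  specialize (Main s Hs Hd2).
  apply (Rmult_le_compat_r (4 * M * (L + 1))) in Hs2; [|apply Rmult_le_pos; lra].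
  replace (r / (4 * M * (L + 1)) * (4 * M * (L + 1))) with r in Hs2 by (field; lra).
  assert (0 <= s * (2 * M)) by (apply Rmult_le_pos; lra).
  nra.
Qed.

(** Integration along an L-shaped path from [(a, b)]; the vanishing of rectangle
    integrals lets the last leg be either horizontal or vertical. *)
Lemma primitive_of_rect F a b : plane_continuous F ->
  (forall x y, rect F a x b y = 0%C) -> exists P, holo P F.
Proof.
  intros HF H0.
  pose (P := fun p : C => (hseg F b a (Re p) + vseg F (Re p) b (Im p))%C).
  exists P. intros p eps He.
  destruct (HF p (eps / 2) ltac:(lra)) as [d [Hd K]].
  exists (d / 2); split; [lra|]. intros v Hv.
  destruct p as [x y], v as [h k].
  assert (Hh : Rabs h <= Cmod (h, k)) by exact (Rle_trans _ _ _ (Rmax_l _ _) (Rmax_Cmod (h, k))).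
  assert (Hk : Rabs k <= Cmod (h, k)) by exact (Rle_trans _ _ _ (Rmax_r _ _) (Rmax_Cmod (h, k))).
  assert (Hd2 : forall u w, Rabs u <= Rabs h -> Rabs w <= Rabs k ->
    Cmod (F (x + u, y + w) - F (x, y)) <= eps / 2).
  { intros u w Hu Hw. left. apply (K (u, w)).
    eapply Rle_lt_trans; [apply Cmod_le_sum|]. simpl. lra. }
  assert (E : (P ((x, y) + (h, k)) - P (x, y)
     = vseg F (x + h)%R y (y + k)%R + hseg F y x (x + h)%R)%C).
  { unfold P. simpl. specialize (H0 x y) as R1. specialize (H0 (x + h) y) as R2.
    unfold rect in R1, R2.
    rewrite <- (vseg_Chasles F HF (x + h) b y (y + k)).
    rewrite <- (hseg_Chasles F HF y a x (x + h)) in R2.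
    match goal with |- (?l = ?r)%C =>
      transitivity (r + ((hseg F b a (x + h)%R + vseg F (x + h)%R b y - (hseg F y a x + hseg F y x (x + h)%R) - vseg F a b y)
        - (hseg F b a x + vseg F x b y - hseg F y a x - vseg F a b y)))%C; [ring|] end.
    rewrite R1, R2. ring. }
  rewrite E.
  assert (B : forall c l t, Rmin c (c + l) <= t <= Rmax c (c + l) ->
    exists u, t = c + u /\ Rabs u <= Rabs l).
  { intros c l t Ht. exists (t - c); split; [ring|].
    revert Ht. unfold Rmin, Rmax. destruct (Rle_dec c (c + l)); intros Ht.
    - rewrite !Rabs_pos_eq by lra. lra.
    - rewrite !Rabs_left1 by lra. lra. }
  assert (K1 := vseg_near F HF (x + h) y (y + k) (F (x, y)) (eps / 2)).
  assert (K2 := hseg_near F HF y x (x + h) (F (x, y)) (eps / 2)).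
  replace (x + h - x) with h in K2 by ring. replace (y + k - y) with k in K1 by ring.
  assert (K1' : Cmod (vseg F (x + h)%R y (y + k)%R - Ci * (RtoC k * F (x, y)))%C <= eps / 2 * Rabs k).
  { apply K1. intros t Ht. destruct (B _ _ _ Ht) as [u [-> Hu]].
    apply Hd2; auto. apply Rle_refl. }
  assert (K2' : Cmod (hseg F y x (x + h)%R - RtoC h * F (x, y))%C <= eps / 2 * Rabs h).
  { apply K2. intros t Ht. destruct (B _ _ _ Ht) as [u [-> Hu]].
    replace (F (x + u, y)) with (F (x + u, y + 0)) by (do 2 f_equal; ring).
    apply Hd2; auto. rewrite Rabs_R0; apply Rabs_pos. }
  replace (vseg F (x + h)%R y (y + k)%R + hseg F y x (x + h)%R
     - (F (x, y) * (h, k) + 0 * Cconj (h, k)))%C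
    with ((vseg F (x + h)%R y (y + k)%R - Ci * (RtoC k * F (x, y)))
      + (hseg F y x (x + h)%R - RtoC h * F (x, y)))%C.
  2:{ replace ((h, k) : C) with (RtoC h + Ci * RtoC k)%C
        by (unfold Cplus, Cmult, Ci, RtoC; simpl; f_equal; ring). ring. }
  eapply Rle_trans; [apply Cmod_triangle|]. nra.
Qed.

(** * Cauchy's formula on the unit circle and its consequences *)

Lemma wdiff_ext_loc F G p al be :
  (exists del, 0 < del /\ forall v, Cmod v < del -> F (p + v)%C = G (p + v)%C) ->
  wdiff F p al be -> wdiff G p al be.
Proof.
  intros [d [Hd E]] H eps He. destruct (H eps He) as [d2 [Hd2 K]].
  assert (E0 : F p = G p).
  { replace p with (p + 0)%C by ring. apply E. now rewrite Cmod_0. }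
  exists (Rmin d d2); split. { now apply Rmin_glb_lt. }
  intros v Hv. rewrite <- E0, <- E by exact (Rlt_le_trans _ _ _ Hv (Rmin_l _ _)).
  apply K. exact (Rlt_le_trans _ _ _ Hv (Rmin_r _ _)).
Qed.

Lemma wdiff_inv (p : C) : p <> 0%C -> wdiff Cinv p (- (/ p * / p)) 0.
Proof.
  intros Hp. assert (P := proj1 (Cmod_gt_0 p) Hp).
  apply little_o_quadratic with (2 / Cmod p ^ 3).
  exists (Cmod p / 2); split; [lra|]. intros v Hv.
  assert (B : Cmod p / 2 <= Cmod (p + v)%C).
  { assert (T := Cmod_triangle (p + v) (- v)).
    replace (p + v + - v)%C with p in T by ring. rewrite Cmod_opp in T. lra. }
  assert (Hpv : (p + v)%C <> 0%C).
  { apply Cmod_gt_0. lra. }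
  replace (/ (p + v) - / p - (- (/ p * / p) * v + 0 * Cconj v))%C
    with (v * v * / (p * p * (p + v)))%C by (field; auto).
  rewrite !Cmod_mult, Cmod_inv, !Cmod_mult.
  2:{ auto using Cmult_neq_0. }
  replace (2 / Cmod p ^ 3 * Cmod v ^ 2) with
    (Cmod v * Cmod v * / (Cmod p * Cmod p * (Cmod p / 2))) by (field; lra).
  apply Rmult_le_compat_l. { pose proof (Cmod_ge_0 v); nra. }
  apply Rinv_le_contravar. { repeat apply Rmult_lt_0_compat; lra. }
  apply Rmult_le_compat_l; auto. nra.
Qed.

(** ** Primitives and the difference quotient *)

Lemma holo_primitive F dF : holo F dF -> exists P, holo P F.
Proof.
  intros H. assert (HF := holo_continuous _ _ H).
  apply (primitive_of_rect F 0 0 HF). intros x y. apply goursat; auto.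
  intros u v _ _. exists (dF (u, v)). apply H.
Qed.

Definition diff_quotient (F dF : C -> C) (w v : C) : C :=
  if Ceq_dec v w then dF w else ((F v - F w) / (v - w))%C.

Lemma diff_quotient_wdiff F dF w p : holo F dF -> p <> w ->
  exists al, wdiff (diff_quotient F dF w) p al 0.
Proof.
  intros H Hpw.
  assert (Hn : (p - w)%C <> 0%C).
  { intros E. apply Hpw. replace p with (p - w + w)%C by ring. rewrite E. ring. }
  assert (K : exists al, wdiff (fun v => (F v - F w) * / (v - w))%C p al 0).
  { eexists. eapply wdiff_eq; [|reflexivity|].
    - apply wdiff_mult.
      + apply wdiff_minus; [apply H|apply wdiff_const].
      + apply (wdiff_comp Cinv (fun v => v - w)%C).
        * apply wdiff_minus; [apply wdiff_id|apply wdiff_const].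
        * now apply wdiff_inv.
    - ring. }
  destruct K as [al K]. exists al.
  apply wdiff_ext_loc with (2 := K).
  exists (Cmod (p - w)%C); split; [now apply Cmod_gt_0|]. intros v Hv.
  unfold diff_quotient. destruct (Ceq_dec (p + v) w) as [E|E]; [|reflexivity].
  exfalso. subst w. replace (p - (p + v))%C with (- v)%C in Hv by ring.
  rewrite Cmod_opp in Hv. lra.
Qed.

Lemma diff_quotient_continuous F dF w : holo F dF ->
  plane_continuous (diff_quotient F dF w).
Proof.
  intros H p. destruct (Ceq_dec p w) as [->|Hp].
  - intros eps He. destruct (H w (eps / 2) ltac:(lra)) as [d [Hd K]].
    exists d; split; auto. intros v Hv. unfold diff_quotient.
    destruct (Ceq_dec w w) as [_|E]; [|congruence].
    destruct (Ceq_dec (w + v) w) as [E|E].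
    + replace (dF w - dF w)%C with (RtoC 0) by ring. now rewrite Cmod_0.
    + assert (Hv0 : v <> 0%C) by (intros ->; apply E; ring).
      specialize (K v Hv). assert (P := proj1 (Cmod_gt_0 v) Hv0).
      replace (w + v - w)%C with v by ring.
      replace ((F (w + v) - F w) / v - dF w)%C
        with ((F (w + v) - F w - (dF w * v + 0 * Cconj v)) / v)%C by (field; auto).
      rewrite Cmod_div by auto.
      apply Rle_lt_trans with (eps / 2); [|lra].
      apply Rle_div_l; lra.
  - destruct (diff_quotient_wdiff F dF w p H Hp) as [al K].
    exact (wdiff_cont _ _ _ _ K).
Qed.

(** The quotient is continuous and holomorphic off [w]. Taking [w] as the base
    point of the primitive puts the exceptional point at a corner. *)
Lemma diff_quotient_primitive F dF w : holo F dF ->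
  exists P, holo P (diff_quotient F dF w).
Proof.
  intros H. assert (Hc := diff_quotient_continuous F dF w H).
  apply (primitive_of_rect _ (Re w) (Im w) Hc). intros x y.
  apply goursat_punctured; auto. intros p Hp. apply diff_quotient_wdiff; auto.
  intros ->. apply Hp. symmetry; apply C_eta.
Qed.

(** ** Means over the unit circle *)

Definition cis (t : R) : C := (cos t, sin t).

Definition cmean (f : C -> C) : C := (RtoC (/ (2 * PI)) * CInt (fun t => f (cis t)) 0 (2 * PI))%C.

Definition circle_continuous (f : C -> C) : Prop := curve_continuous (fun t => f (cis t)).

Lemma Cmod_cis t : Cmod (cis t) = 1.
Proof.
  unfold Cmod, cis; simpl. rewrite !Rmult_1_r.
  replace (cos t * cos t + sin t * sin t) with 1 by (pose proof (sin2_cos2 t); unfold Rsqr in *; lra).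
  apply sqrt_1.
Qed.

Lemma is_derive_cis t : @is_derive R_AbsRing C_R_NormedModule cis t (Ci * cis t)%C.
Proof.
  replace (Ci * cis t)%C with ((- sin t)%R, cos t)
    by (unfold Cmult, Ci, cis; simpl; f_equal; ring).
  apply is_derive_C_pair; auto_derive; auto; ring.
Qed.

Lemma two_pi_pos : 0 < 2 * PI.
Proof. pose proof PI_RGT_0; lra. Qed.

Lemma circle_continuous_plane F p : plane_continuous F -> circle_continuous (fun xi => F (p + xi)%C).
Proof.
  intros H. apply (plane_continuous_comp (fun v => F (p + v)%C)).
  - intros q eps He. destruct (H (p + q)%C eps He) as [d [Hd K]].
    exists d; split; auto. intros v Hv. rewrite Cplus_assoc. auto.
  - apply curve_derive_continuous with (fun t => Ci * cis t)%C. apply is_derive_cis.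
Qed.

Lemma circle_continuous_wdiff f :
  (forall xi, Cmod xi = 1 -> exists al be, wdiff f xi al be) -> circle_continuous f.
Proof.
  intros H t. destruct (H (cis t) (Cmod_cis t)) as [al [be K]].
  apply (@ex_derive_continuous R_AbsRing C_R_NormedModule (fun t => f (cis t))).
  eexists. exact (wdiff_curve f cis t _ _ _ (is_derive_cis t) K).
Qed.

Lemma C_continuous_mult {U : UniformSpace} (f g : U -> C) x :
  @continuous U C_R_NormedModule f x -> @continuous U C_R_NormedModule g x ->
  @continuous U C_R_NormedModule (fun y => f y * g y)%C x.
Proof.
  assert (A : forall h, @continuous U C_R_NormedModule h x ->
    @continuous U (AbsRing_UniformSpace C_AbsRing) h x).
  { intros h H P HP. apply H. now apply locally_C. }
  intros Hf Hg P HP.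
  apply (@continuous_mult U C_AbsRing _ _ x (A _ Hf) (A _ Hg)). now apply locally_C.
Qed.

Lemma circle_continuous_mult f g : circle_continuous f -> circle_continuous g ->
  circle_continuous (fun xi => f xi * g xi)%C.
Proof. intros Hf Hg t. exact (C_continuous_mult _ _ t (Hf t) (Hg t)). Qed.

Lemma circle_continuous_conj : circle_continuous Cconj.
Proof.
  apply circle_continuous_wdiff. intros xi _. exists 0%C, 1%C.
  apply wdiff_ext with (fun v => 0 + (0 * v + 1 * Cconj v))%C; [intros; ring|apply wdiff_affine].
Qed.

Lemma cmean_plus f g : circle_continuous f -> circle_continuous g ->
  cmean (fun xi => f xi + g xi)%C = (cmean f + cmean g)%C.
Proof.
  intros Hf Hg. unfold cmean. rewrite <- Cmult_plus_distr_l. f_equal.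
  apply is_CInt_unique, is_CInt_plus; now apply CInt_correct.
Qed.

Lemma cmean_minus f g : circle_continuous f -> circle_continuous g ->
  cmean (fun xi => f xi - g xi)%C = (cmean f - cmean g)%C.
Proof.
  intros Hf Hg. unfold cmean.
  replace (RtoC (/ (2 * PI)) * CInt (fun t => f (cis t)) 0 (2 * PI) - RtoC (/ (2 * PI)) * CInt (fun t => g (cis t)) 0 (2 * PI))%C
    with (RtoC (/ (2 * PI)) * (CInt (fun t => f (cis t)) 0 (2 * PI)%R - CInt (fun t => g (cis t)) 0 (2 * PI)%R))%C by ring.
  f_equal. apply is_CInt_unique, is_CInt_minus; now apply CInt_correct.
Qed.

Lemma cmean_mult c f : circle_continuous f ->
  cmean (fun xi => c * f xi)%C = (c * cmean f)%C.
Proof.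
  intros Hf. unfold cmean.
  rewrite (is_CInt_unique _ _ _ _ (is_CInt_mult c _ _ _ _ (CInt_correct _ _ _ Hf))). ring.
Qed.

Lemma cmean_ext f g : (forall xi, Cmod xi = 1 -> f xi = g xi) -> cmean f = cmean g.
Proof.
  intros H. unfold cmean. f_equal. apply (@RInt_ext C_R_CompleteNormedModule).
  intros t _. apply H, Cmod_cis.
Qed.

Lemma cmean_const c : cmean (fun _ => c) = c.
Proof.
  unfold cmean. rewrite (is_CInt_unique _ _ _ _ (is_CInt_const c _ _)).
  rewrite Cmult_assoc, <- RtoC_mult. replace (/ (2 * PI) * (2 * PI - 0)) with 1.
  ring. field. apply Rgt_not_eq, PI_RGT_0.
Qed.

Lemma cmean_bound f M : circle_continuous f ->
  (forall xi, Cmod xi = 1 -> Cmod (f xi) <= M) -> Cmod (cmean f) <= M.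
Proof.
  intros Hf H. unfold cmean. assert (P := two_pi_pos).
  assert (K := is_CInt_Cmod_le _ 0 (2 * PI) _ M (Rlt_le _ _ P)
    (fun t _ => H _ (Cmod_cis t)) (CInt_correct _ 0 (2 * PI) Hf)).
  rewrite Cmod_mult, Cmod_R, Rabs_pos_eq by (apply Rlt_le, Rinv_0_lt_compat, P).
  apply (Rmult_le_compat_l (/ (2 * PI))) in K; [|apply Rlt_le, Rinv_0_lt_compat, P].
  replace (/ (2 * PI) * ((2 * PI - 0) * M)) with M in K by (field; apply Rgt_not_eq, PI_RGT_0).
  exact K.
Qed.

Lemma is_CInt_conj f a b l : is_CInt f a b l -> is_CInt (fun t => Cconj (f t)) a b (Cconj l).
Proof.
  intros H.
  assert (H1 := is_RInt_fct_extend_fst _ _ _ _ H).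
  assert (H2 := is_RInt_fct_extend_snd _ _ _ _ H).
  apply (@is_RInt_fct_extend_pair R_NormedModule R_NormedModule).
  - exact H1.
  - exact (is_RInt_opp _ _ _ _ H2).
Qed.

Lemma cmean_conj f : circle_continuous f -> cmean (fun xi => Cconj (f xi)) = Cconj (cmean f).
Proof.
  intros H. unfold cmean. rewrite Cmult_conj, RtoC_conj. f_equal.
  apply is_CInt_unique, is_CInt_conj, CInt_correct, H.
Qed.

(** Up to a constant factor this is the integral around the circle of [F(w) dw],
    that is, of the derivative of [P] along a closed curve. *)
Lemma cmean_closed P F p : holo P F -> plane_continuous F ->
  cmean (fun xi => xi * F (p + xi))%C = 0%C.
Proof.
  intros HP HF. unfold cmean.
  assert (D : forall t, @is_derive R_AbsRing C_R_NormedModule (fun t => P (p + cis t)%C) t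
     (Ci * (cis t * F (p + cis t)%C))%C).
  { intros t.
    assert (K := wdiff_curve (fun v => P (p + v)%C) cis t _ (F (p + cis t)%C) 0 (is_derive_cis t)).
    replace (F (p + cis t) * (Ci * cis t) + 0 * Cconj (Ci * cis t))%C
      with (Ci * (cis t * F (p + cis t)))%C in K by ring.
    apply K. eapply wdiff_eq; [apply (wdiff_comp P (fun v => p + v)%C)| |].
    - apply wdiff_plus; [apply wdiff_const|apply wdiff_id].
    - apply HP.
    - ring.
    - ring. }
  assert (Hc : circle_continuous (fun xi => xi * F (p + xi))%C).
  { apply circle_continuous_mult; [|now apply circle_continuous_plane].
    apply circle_continuous_wdiff. intros xi _. exists 1%C, 0%C. apply wdiff_id. }
  assert (Hc2 : circle_continuous (fun xi => Ci * (xi * F (p + xi)))%C).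
  { apply circle_continuous_mult; auto. apply circle_continuous_wdiff.
    intros xi _. exists 0%C, 0%C. apply wdiff_const. }
  assert (E := is_CInt_unique _ _ _ _ (is_CInt_derive _ _ 0 (2 * PI) D Hc2)).
  rewrite (is_CInt_unique _ _ _ _ (is_CInt_mult Ci _ _ _ _ (CInt_correct _ _ _ Hc))) in E.
  replace (cis (2 * PI)) with (cis 0) in E
    by (unfold cis; now rewrite cos_0, sin_0, cos_2PI, sin_2PI).
  match goal with |- (_ * ?I)%C = _ => assert (E0 : I = 0%C) end.
  { match goal with |- ?I = _ => replace I with (- Ci * (Ci * I))%C end.
    - rewrite E. ring.
    - match goal with |- (_ * (_ * ?I))%C = _ => destruct I as [i1 i2] end.
      unfold Ci, Cmult, Copp; simpl; f_equal; ring. }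
  rewrite E0. ring.
Qed.

(** The Cauchy kernel: [d zeta / (zeta - om)] is [i * kernel om] in the angle on
    the unit circle. *)
Definition kernel (om xi : C) : C := (xi * / (xi - om))%C.

Lemma kernel_denominator om xi : Cmod om < 1 -> Cmod xi = 1 -> 1 - Cmod om <= Cmod (xi - om)%C.
Proof.
  intros Ho Hx. assert (T := Cmod_triangle (xi - om) om).
  replace (xi - om + om)%C with xi in T by ring. lra.
Qed.

Lemma kernel_bound om xi : Cmod om < 1 -> Cmod xi = 1 ->
  Cmod (kernel om xi) <= / (1 - Cmod om).
Proof.
  intros Ho Hx. assert (K := kernel_denominator om xi Ho Hx).
  unfold kernel. rewrite Cmod_mult, Hx, Rmult_1_l, Cmod_inv by (apply Cmod_gt_0; lra).
  apply Rinv_le_contravar; lra.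
Qed.

Lemma circle_conj xi : Cmod xi = 1 -> (Cconj xi * xi)%C = 1%C.
Proof.
  intros H. rewrite Cmult_comm, <- Cmod2_conj, H. f_equal; ring.
Qed.

(** One step of the geometric expansion of the kernel in powers of
    [om / xi = om * conj xi]. *)
Lemma kernel_step om xi : Cmod om < 1 -> Cmod xi = 1 ->
  kernel om xi = (1 + om * (Cconj xi * kernel om xi))%C.
Proof.
  intros Ho Hx. assert (K := kernel_denominator om xi Ho Hx).
  assert (H0 : (xi - om)%C <> 0%C) by (apply Cmod_gt_0; lra).
  unfold kernel.
  replace (1 + om * (Cconj xi * (xi * / (xi - om))))%C
    with (1 + om * (Cconj xi * xi) * / (xi - om))%C by ring.
  rewrite circle_conj by auto. field. auto.
Qed.

Lemma kernel_continuous om : Cmod om < 1 -> circle_continuous (kernel om).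
Proof.
  intros Ho. apply circle_continuous_wdiff. intros xi Hx.
  assert (K := kernel_denominator om xi Ho Hx).
  assert (H0 : (xi - om)%C <> 0%C) by (apply Cmod_gt_0; lra).
  do 2 eexists. apply wdiff_mult; [apply wdiff_id|].
  apply (wdiff_comp Cinv (fun v => v - om)%C).
  - apply wdiff_minus; [apply wdiff_id|apply wdiff_const].
  - now apply wdiff_inv.
Qed.

Lemma circle_continuous_const c : circle_continuous (fun _ => c).
Proof.
  apply circle_continuous_wdiff. intros xi _. exists 0%C, 0%C. apply wdiff_const.
Qed.

Lemma circle_continuous_conj_pow n : circle_continuous (fun xi => Cconj xi ^ n)%C.
Proof.
  induction n; [apply (circle_continuous_const 1)|].
  apply (circle_continuous_mult Cconj (fun xi => Cconj xi ^ n)%C); auto.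
  apply circle_continuous_conj.
Qed.

Lemma Cmod_conj_pow_circle n xi : Cmod xi = 1 -> Cmod (Cconj xi ^ n)%C = 1.
Proof. intros H. now rewrite Cmod_pow, Cmod_conj, H, pow1. Qed.

Lemma holo_pow n : exists dF, holo (fun v => v ^ n)%C dF.
Proof.
  induction n as [|n [dF H]]; [exists (fun _ => 0%C); apply (holo_const 1)|].
  eexists. exact (holo_mult _ _ _ _ holo_id H).
Qed.

Lemma cmean_conj_pow n : cmean (fun xi => Cconj xi ^ S n)%C = 0%C.
Proof.
  destruct (holo_pow n) as [dF H].
  destruct (holo_primitive _ _ H) as [P HP].
  assert (E := cmean_closed P _ 0 HP (holo_continuous _ _ H)).
  assert (E2 : cmean (fun xi => xi * xi ^ n)%C = 0%C).
  { rewrite <- E. apply cmean_ext. intros xi _. now rewrite Cplus_0_l. }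
  destruct (holo_pow (S n)) as [dG HG].
  assert (Hc := circle_continuous_plane _ 0 (holo_continuous _ _ HG)).
  rewrite <- (RtoC_conj 0), <- E2, <- cmean_conj.
  - apply cmean_ext. intros xi _. now rewrite <- Cpow_conj.
  - intros t. eapply continuous_ext; [|exact (Hc t)]. intros s; cbv beta.
    now rewrite Cplus_0_l.
Qed.

Lemma circle_continuous_minus f g : circle_continuous f -> circle_continuous g ->
  circle_continuous (fun xi => f xi - g xi)%C.
Proof.
  intros Hf Hg t.
  exact (@continuous_minus R_UniformSpace R_AbsRing C_R_NormedModule _ _ t (Hf t) (Hg t)).
Qed.

Fixpoint poly_sum (e : nat -> C) (om : C) (N : nat) : C :=
  match N with O => 0%C | S n => (poly_sum e om n + e n * om ^ n)%C end.

Lemma kernel_expansion f om N : circle_continuous f -> Cmod om < 1 ->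
  cmean (fun xi => f xi * kernel om xi)%C =
  (poly_sum (fun n => cmean (fun xi => f xi * Cconj xi ^ n)) om N
   + om ^ N * cmean (fun xi => f xi * (Cconj xi ^ N * kernel om xi)))%C.
Proof.
  intros Hf Ho. induction N as [|N IH].
  - simpl. rewrite Cplus_0_l, Cmult_1_l. apply cmean_ext. intros; ring.
  - rewrite IH. simpl. rewrite <- Cplus_assoc. f_equal.
    rewrite (cmean_ext (fun xi => f xi * (Cconj xi ^ N * kernel om xi))%C
      (fun xi => f xi * Cconj xi ^ N + om * (f xi * (Cconj xi * Cconj xi ^ N * kernel om xi)))%C).
    + rewrite cmean_plus, cmean_mult. ring.
      * apply circle_continuous_mult; auto. apply circle_continuous_mult; [|now apply kernel_continuous].
        apply (circle_continuous_conj_pow (S N)).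
      * apply circle_continuous_mult; auto. apply circle_continuous_conj_pow.
      * apply (circle_continuous_mult (fun _ => om)); [apply circle_continuous_const|].
        apply circle_continuous_mult; auto. apply circle_continuous_mult; [|now apply kernel_continuous].
        apply (circle_continuous_conj_pow (S N)).
    + intros xi Hx. rewrite (kernel_step om xi) at 1 by auto. ring.
Qed.

Lemma kernel_remainder f om N M : circle_continuous f -> Cmod om < 1 ->
  (forall xi, Cmod xi = 1 -> Cmod (f xi) <= M) ->
  Cmod (cmean (fun xi => f xi * (Cconj xi ^ N * kernel om xi)))%C <= M / (1 - Cmod om).
Proof.
  intros Hf Ho HM. apply cmean_bound.
  - apply circle_continuous_mult; auto. apply circle_continuous_mult; [|now apply kernel_continuous].
    apply circle_continuous_conj_pow.
  - intros xi Hx. rewrite !Cmod_mult, Cmod_conj_pow_circle, Rmult_1_l by auto.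
    apply Rmult_le_compat; auto using Cmod_ge_0. now apply kernel_bound.
Qed.

Lemma le_geometric_0 r K q : 0 <= q < 1 -> (forall N, r <= K * q ^ S N) -> r <= 0.
Proof.
  intros Hq H. apply (is_lim_seq_le (fun _ => r) (fun N => K * q ^ S N) r 0 H).
  - apply is_lim_seq_const.
  - replace (Finite 0) with (Rbar_mult K 0) by (simpl; f_equal; ring).
    apply (is_lim_seq_scal_l (fun N => q ^ S N) K 0).
    apply (is_lim_seq_incr_1 (fun n => q ^ n)), is_lim_seq_geom.
    rewrite Rabs_pos_eq; lra.
Qed.

(** In the expansion only the term [n = 0] has a nonzero mean. *)
Lemma cmean_kernel om : Cmod om < 1 -> cmean (kernel om) = 1%C.
Proof.
  intros Ho.
  assert (H0 : (cmean (kernel om) - 1)%C = 0%C).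
  { apply Cmod_eq_0. apply Rle_antisym; [|apply Cmod_ge_0].
    apply le_geometric_0 with (K := 1 / (1 - Cmod om)) (q := Cmod om).
    { split; auto. apply Cmod_ge_0. }
    intros N.
    assert (E := kernel_expansion (fun _ => RtoC 1) om (S N) (circle_continuous_const _) Ho).
    assert (B := kernel_remainder (fun _ => RtoC 1) om (S N) 1 (circle_continuous_const _) Ho
      (fun _ _ => Req_le _ _ Cmod_1)).
    assert (S1 : poly_sum (fun n => cmean (fun xi => 1 * Cconj xi ^ n)%C) om (S N) = 1%C).
    { clear E B. induction N as [|N IH].
      - simpl. rewrite (cmean_ext _ (fun _ => 1%C)) by (intros; ring).
        rewrite cmean_const. ring.
      - simpl in *. rewrite IH.
        rewrite (cmean_ext _ (fun xi => Cconj xi ^ S N)%C) by (intros; simpl; ring).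
        rewrite cmean_conj_pow. ring. }
    cbv beta in E, B. rewrite S1 in E.
    rewrite (cmean_ext (kernel om) (fun xi => 1 * kernel om xi)%C) by (intros; ring).
    rewrite E.
    match goal with |- Cmod (RtoC 1 + ?x - RtoC 1)%C <= _ => replace (RtoC 1 + x - RtoC 1)%C with x by ring end.
    rewrite Cmod_mult, Cmod_pow, Rmult_comm.
    apply Rmult_le_compat_r; auto. apply pow_le, Cmod_ge_0. }
  replace (cmean (kernel om)) with (cmean (kernel om) - 1 + 1)%C by ring. rewrite H0. ring.
Qed.

(** The difference quotient of [F] at [w + om] has a primitive, so its integral
    around the circle is zero; splitting the quotient gives the formula. *)
Lemma cauchy_formula F dF w om : holo F dF -> Cmod om < 1 ->
  cmean (fun xi => F (w + xi) * kernel om xi)%C = F (w + om)%C.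
Proof.
  intros H Ho.
  destruct (diff_quotient_primitive F dF (w + om)%C H) as [P HP].
  assert (E := cmean_closed P _ w HP (diff_quotient_continuous F dF (w + om)%C H)).
  rewrite (cmean_ext _ (fun xi => F (w + xi) * kernel om xi - F (w + om) * kernel om xi)%C) in E.
  - assert (Hc := circle_continuous_plane F w (holo_continuous _ _ H)).
    assert (Hk := kernel_continuous om Ho).
    rewrite cmean_minus, cmean_mult, cmean_kernel in E; auto.
    + rewrite Cmult_1_r in E.
      match type of E with (?a - ?b)%C = _ => replace a with (a - b + b)%C by ring end.
      rewrite E. ring.
    + now apply circle_continuous_mult.
    + apply (circle_continuous_mult (fun _ => F (w + om)%C)); auto. apply circle_continuous_const.
  - intros xi Hx. unfold diff_quotient, kernel.
    assert (K := kernel_denominator om xi Ho Hx).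
    assert (H0 : (xi - om)%C <> 0%C) by (apply Cmod_gt_0; lra).
    destruct (Ceq_dec (w + xi) (w + om)) as [E1|E1].
    + exfalso. apply H0. replace (xi - om)%C with (w + xi - (w + om))%C by ring. rewrite E1. ring.
    + replace (w + xi - (w + om))%C with (xi - om)%C by ring. field. auto.
Qed.

Definition taylor_coef (F : C -> C) (w : C) (n : nat) : C :=
  cmean (fun xi => F (w + xi) * Cconj xi ^ n)%C.

Lemma taylor_coef_bound F dF w M n : holo F dF ->
  (forall xi, Cmod xi = 1 -> Cmod (F (w + xi)%C) <= M) -> Cmod (taylor_coef F w n) <= M.
Proof.
  intros H HM. assert (Hc := circle_continuous_plane F w (holo_continuous _ _ H)).
  apply cmean_bound.
  - apply circle_continuous_mult; auto. apply circle_continuous_conj_pow.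
  - intros xi Hx. rewrite Cmod_mult, Cmod_conj_pow_circle, Rmult_1_r by auto. auto.
Qed.

Lemma taylor F dF w M om N : holo F dF -> Cmod om < 1 ->
  (forall xi, Cmod xi = 1 -> Cmod (F (w + xi)%C) <= M) ->
  Cmod (F (w + om) - poly_sum (taylor_coef F w) om N)%C <= M / (1 - Cmod om) * Cmod om ^ N.
Proof.
  intros H Ho HM. assert (Hc := circle_continuous_plane F w (holo_continuous _ _ H)).
  rewrite <- (cauchy_formula F dF w om H Ho), (kernel_expansion _ om N Hc Ho).
  fold (taylor_coef F w). unfold taylor_coef at 1.
  match goal with |- Cmod (?s + ?r - ?s')%C <= _ =>
    replace (s + r - s')%C with r by (change s' with s; ring) end.
  rewrite Cmod_mult, Cmod_pow, Rmult_comm.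
  apply Rmult_le_compat_r; [apply pow_le, Cmod_ge_0|].
  now apply (kernel_remainder (fun xi => F (w + xi)%C)).
Qed.

(** Cauchy's formula at the centre. *)
Lemma mean_value F dF w : holo F dF -> cmean (fun xi => F (w + xi)%C) = F w.
Proof.
  intros H. assert (H0 : Cmod 0 < 1) by (rewrite Cmod_0; lra).
  assert (E := cauchy_formula F dF w 0 H H0). rewrite Cplus_0_r in E. rewrite <- E.
  apply cmean_ext. intros xi Hx. unfold kernel.
  assert (xi <> 0%C) by (apply Cmod_gt_0; lra).
  replace (xi - 0)%C with xi by ring. field. auto.
Qed.

(** Compactness with the gauge [d <= 1 / (1 + |F|)], below which [F] varies by less
    than 1: a positive lower bound on the gauge is an upper bound on [|F|]. *)
Lemma plane_continuous_bounded F p r : plane_continuous F ->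
  exists M, forall v, Cmod v <= r -> Cmod (F (p + v)%C) <= M.
Proof.
  intros HF.
  assert (G : forall u v, {d : posreal | forall z, Cmod z < 2 * d ->
      Cmod (F ((p + (u, v)) + z) - F (p + (u, v)))%C < 1 /\ d * Cmod (F (p + (u, v))%C) <= 1}).
  { intros u v. apply constructive_indefinite_description.
    destruct (HF (p + (u, v))%C 1 Rlt_0_1) as [d [Hd K]].
    assert (HB := Cmod_ge_0 (F (p + (u, v))%C)). set (B := Cmod (F (p + (u, v))%C)) in *.
    assert (Hm : 0 < Rmin (d / 2) (/ (B + 1))).
    { apply Rmin_glb_lt; [lra|]. apply Rinv_0_lt_compat; lra. }
    exists (mkposreal _ Hm). simpl. intros z Hz. split.
    - apply K. pose proof (Rmin_l (d / 2) (/ (B + 1))). lra.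
    - pose proof (Rmin_r (d / 2) (/ (B + 1))) as Q.
      apply Rle_trans with (/ (B + 1) * B); [now apply Rmult_le_compat_r|].
      apply Rle_trans with (/ (B + 1) * (B + 1)); [|right; field; lra].
      apply Rmult_le_compat_l; [|lra]. apply Rlt_le, Rinv_0_lt_compat; lra. }
  destruct (compactness_value_2d (- r) r (- r) r (fun u v => proj1_sig (G u v))) as [d Hd].
  exists (/ d + 1). intros [x y] Hv.
  assert (Hx : Rabs x <= Cmod (x, y)) by exact (Rle_trans _ _ _ (Rmax_l _ _) (Rmax_Cmod (x, y))).
  assert (Hy : Rabs y <= Cmod (x, y)) by exact (Rle_trans _ _ _ (Rmax_r _ _) (Rmax_Cmod (x, y))).
  apply Rnot_lt_le. intros Hlt.
  apply (Hd x y); [apply Rabs_le_between; lra|apply Rabs_le_between; lra|].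
  intros [u [v [_ [_ [Hu [Hw Hdd]]]]]]. revert Hlt. apply Rle_not_lt.
  destruct (G u v) as [e He]. simpl in *.
  destruct (He ((x, y) - (u, v))%C) as [K1 K2].
  { eapply Rle_lt_trans; [apply Cmod_le_sum|]. simpl. unfold Rminus in *. lra. }
  replace (p + (u, v) + ((x, y) - (u, v)))%C with (p + (x, y))%C in K1 by ring.
  replace (F (p + (x, y)))%C with ((F (p + (x, y)) - F (p + (u, v))) + F (p + (u, v)))%C by ring.
  eapply Rle_trans; [apply Cmod_triangle|]. set (B := Cmod (F (p + (u, v))%C)) in *.
  assert (B <= / d); [|lra].
  apply Rmult_le_reg_l with d; [apply cond_pos|].
  rewrite Rinv_r by (apply Rgt_not_eq, cond_pos).
  apply Rle_trans with (2 := K2). apply Rmult_le_compat_r; auto. apply Cmod_ge_0.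
Qed.

Lemma wdiff_unique F p al be al' be' : wdiff F p al be -> wdiff F p al' be' -> al = al' /\ be = be'.
Proof.
  intros H H'. destruct (wdiff_wirtinger _ _ _ _ H) as [<- <-].
  destruct (wdiff_wirtinger _ _ _ _ H') as [<- <-]. auto.
Qed.

Lemma taylor_second_order F dF w M om : holo F dF -> Cmod om <= / 2 ->
  (forall xi, Cmod xi = 1 -> Cmod (F (w + xi)%C) <= M) ->
  Cmod (F (w + om) - F w - taylor_coef F w 1 * om)%C <= 2 * M * Cmod om ^ 2.
Proof.
  intros H Ho HM. assert (K := taylor F dF w M om 2 H ltac:(lra) HM).
  assert (E0 : taylor_coef F w 0 = F w).
  { unfold taylor_coef. rewrite <- (mean_value F dF w H). apply cmean_ext. intros; simpl; ring. }
  replace (F (w + om) - F w - taylor_coef F w 1 * om)%C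
    with (F (w + om) - poly_sum (taylor_coef F w) om 2)%C by (simpl; rewrite E0; ring).
  eapply Rle_trans; [exact K|].
  apply Rmult_le_compat_r; [apply pow2_ge_0|].
  assert (0 <= M).
  { eapply Rle_trans; [apply Cmod_ge_0|apply (HM 1%C Cmod_1)]. }
  apply Rle_div_l; nra.
Qed.

(** The second-order expansion identifies the derivative, by uniqueness. *)
Lemma holo_derivative_coef F dF w : holo F dF -> dF w = taylor_coef F w 1.
Proof.
  intros H. destruct (plane_continuous_bounded F w 1 (holo_continuous _ _ H)) as [M HM].
  apply (wdiff_unique F w _ 0 _ 0); [apply H|].
  apply little_o_quadratic with (2 * M). exists (/ 2); split; [lra|]. intros v Hv.
  replace (F (w + v) - F w - (taylor_coef F w 1 * v + 0 * Cconj v))%C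
    with (F (w + v) - F w - taylor_coef F w 1 * v)%C by ring.
  apply taylor_second_order with dF; auto; [lra|].
  intros xi Hx. apply HM. lra.
Qed.

(** [F' w] is the mean of [F (w + xi) / xi]; expanding [F] to second order,
    uniformly in [xi], differentiates this mean. *)
Lemma holo_derivative F dF : holo F dF -> exists ddF, holo dF ddF.
Proof.
  intros H.
  assert (Hcoef : forall w, dF w = cmean (fun xi => F (w + xi) * Cconj xi)%C).
  { intros w. rewrite (holo_derivative_coef F dF w H). apply cmean_ext.
    intros; simpl; ring. }
  assert (Hc : forall p, circle_continuous (fun xi => F (p + xi)%C))
    by (intros; apply circle_continuous_plane, (holo_continuous _ _ H)).
  assert (Hbar := circle_continuous_conj).
  assert (Key : forall w, exists M, forall c v, Cmod c <= 1 -> Cmod v <= / 2 ->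
    Cmod (F (w + c + v) - F (w + c) - dF (w + c) * v)%C <= M * Cmod v ^ 2).
  { intros w. destruct (plane_continuous_bounded F w 2 (holo_continuous _ _ H)) as [M HM].
    exists (2 * M). intros c v Hcc Hv. rewrite (holo_derivative_coef F dF (w + c)%C H).
    apply taylor_second_order with dF; auto.
    intros xi Hx. rewrite <- Cplus_assoc. apply HM.
    eapply Rle_trans; [apply Cmod_triangle|lra]. }
  assert (HdFc : plane_continuous dF).
  { assert (Dpt : forall w, exists M, forall v, Cmod v <= / 2 -> Cmod (dF (w + v) - dF w)%C <= M * Cmod v).
    { intros w. destruct (plane_continuous_bounded F w 2 (holo_continuous _ _ H)) as [M HM].
      exists (2 * M). intros v Hv. rewrite !Hcoef, <- cmean_minus
        by (apply circle_continuous_mult; auto).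
      assert (HM0 : 0 <= M).
      { eapply Rle_trans; [apply Cmod_ge_0|apply (HM 0%C)]. rewrite Cmod_0; lra. }
      apply cmean_bound.
      - apply circle_continuous_minus; apply circle_continuous_mult; auto.
      - intros xi Hx.
        replace (F (w + v + xi) * Cconj xi - F (w + xi) * Cconj xi)%C
          with ((F (w + xi + v) - F (w + xi)) * Cconj xi)%C
          by (replace (w + v + xi)%C with (w + xi + v)%C by ring; ring).
        rewrite Cmod_mult, Cmod_conj, Hx, Rmult_1_r.
        assert (K := taylor F dF (w + xi)%C M v 1 H ltac:(lra)).
        assert (E0 : taylor_coef F (w + xi)%C 0 = F (w + xi)%C).
        { unfold taylor_coef. rewrite <- (mean_value F dF (w + xi)%C H).
          apply cmean_ext. intros; simpl; ring. }
        simpl in K. rewrite E0 in K.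
        replace (0 + F (w + xi) * 1)%C with (F (w + xi)%C) in K by ring.
        rewrite Rmult_1_r in K.
        eapply Rle_trans; [apply K|].
        + intros y Hy. rewrite <- Cplus_assoc. apply HM.
          eapply Rle_trans; [apply Cmod_triangle|lra].
        + apply Rmult_le_compat_r; [apply Cmod_ge_0|]. apply Rle_div_l; nra. }
    intros w eps He. destruct (Dpt w) as [M HM].
    assert (P : 0 < Rabs M + 1) by (pose proof (Rabs_pos M); lra).
    exists (Rmin (/ 2) (eps / (Rabs M + 1))); split.
    { apply Rmin_glb_lt; [lra|now apply Rdiv_lt_0_compat]. }
    intros v Hv. assert (H1 := Rlt_le_trans _ _ _ Hv (Rmin_l _ _)).
    assert (H2 := Rlt_le_trans _ _ _ Hv (Rmin_r _ _)).
    eapply Rle_lt_trans; [apply HM; lra|].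
    apply Rle_lt_trans with ((Rabs M + 1) * Cmod v).
    - apply Rmult_le_compat_r; [apply Cmod_ge_0|]. pose proof (Rle_abs M); lra.
    - apply (Rmult_lt_compat_l (Rabs M + 1)) in H2; auto.
      replace ((Rabs M + 1) * (eps / (Rabs M + 1))) with eps in H2 by (field; lra). lra. }
  assert (Hdc : forall p, circle_continuous (fun xi => dF (p + xi)%C))
    by (intros; now apply circle_continuous_plane).
  exists (fun w => cmean (fun xi => dF (w + xi) * Cconj xi)%C). intros w.
  destruct (Key w) as [M HM].
  apply little_o_quadratic with M. exists (/ 2); split; [lra|]. intros v Hv.
  rewrite !Hcoef.
  replace (_ - _ - _)%C with
    (cmean (fun xi => F (w + v + xi) * Cconj xi)%C - cmean (fun xi => F (w + xi) * Cconj xi)%C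
     - v * cmean (fun xi => dF (w + xi) * Cconj xi)%C)%C by ring.
  rewrite <- cmean_mult by (apply circle_continuous_mult; auto).
  assert (C1 : circle_continuous (fun xi => F (w + v + xi) * Cconj xi)%C)
    by (apply circle_continuous_mult; auto).
  assert (C2 : circle_continuous (fun xi => F (w + xi) * Cconj xi)%C)
    by (apply circle_continuous_mult; auto).
  assert (C3 : circle_continuous (fun xi => v * (dF (w + xi) * Cconj xi))%C).
  { apply (circle_continuous_mult (fun _ => v)); [apply circle_continuous_const|].
    apply circle_continuous_mult; auto. }
  rewrite <- !cmean_minus by auto using circle_continuous_minus.
  apply cmean_bound; [auto using circle_continuous_minus|].
  intros xi Hx.
  replace (F (w + v + xi) * Cconj xi - F (w + xi) * Cconj xi - v * (dF (w + xi) * Cconj xi))%C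
    with ((F (w + xi + v) - F (w + xi) - dF (w + xi) * v) * Cconj xi)%C
    by (replace (w + v + xi)%C with (w + xi + v)%C by ring; ring).
  rewrite Cmod_mult, Cmod_conj, Hx, Rmult_1_r. apply HM; lra.
Qed.

(** * The complex exponential *)

Definition cexp (w : C) : C := (RtoC (exp (Re w)) * cis (Im w))%C.

Lemma Ci_neq_0 : Ci <> 0%C.
Proof. intros E; injection E; lra. Qed.

(** [Re v = (v + conj v) / 2] has both Wirtinger derivatives equal to [1 / 2]. *)
Lemma wdiff_of_Re (g : R -> C) p dg :
  @is_derive R_AbsRing C_R_NormedModule g (Re p) dg ->
  wdiff (fun v => g (Re v)) p (dg / 2) (dg / 2).
Proof.
  intros H. apply filterdiff_wdiff. eapply filterdiff_ext_lin.
  - apply (filterdiff_comp' (fun z : C_R_NormedModule => fst z) g p _ _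
      (filterdiff_linear _ (@is_linear_fst R_AbsRing R_NormedModule R_NormedModule)) H).
  - intros v. simpl. rewrite real_scal_C.
    replace (fst v) with (Re v) by reflexivity. rewrite re_alt. Cfield.
Qed.

Lemma wdiff_of_Im (g : R -> C) p dg :
  @is_derive R_AbsRing C_R_NormedModule g (Im p) dg ->
  wdiff (fun v => g (Im v)) p (dg / (2 * Ci)) (- dg / (2 * Ci)).
Proof.
  intros H. apply filterdiff_wdiff. eapply filterdiff_ext_lin.
  - apply (filterdiff_comp' (fun z : C_R_NormedModule => snd z) g p _ _
      (filterdiff_linear _ (@is_linear_snd R_AbsRing R_NormedModule R_NormedModule)) H).
  - intros v. simpl. rewrite real_scal_C.
    replace (snd v) with (Im v) by reflexivity. rewrite im_alt. Cfield. exact Ci_neq_0.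
Qed.

Lemma holo_cexp : holo cexp cexp.
Proof.
  intros p.
  assert (H1 : @is_derive R_AbsRing C_R_NormedModule (fun t => RtoC (exp t)) (Re p) (RtoC (exp (Re p)))).
  { apply is_derive_C_pair; auto_derive; auto; ring. }
  eapply wdiff_eq.
  - apply wdiff_mult; [exact (wdiff_of_Re _ p _ H1)|exact (wdiff_of_Im _ p _ (is_derive_cis (Im p)))].
  - unfold cexp. Cfield. exact Ci_neq_0.
  - unfold cexp. Cfield. exact Ci_neq_0.
Qed.

Lemma cis_add s t : cis (s + t) = (cis s * cis t)%C.
Proof. unfold cis, Cmult; simpl. rewrite cos_plus, sin_plus. f_equal; ring. Qed.

Lemma cexp_opp w : (cexp w * cexp (- w))%C = 1%C.
Proof.
  unfold cexp. destruct w as [x y]; simpl.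
  replace (RtoC (exp x) * cis y * (RtoC (exp (- x)) * cis (- y)))%C
    with ((RtoC (exp x) * RtoC (exp (- x))) * (cis y * cis (- y)))%C by ring.
  rewrite <- RtoC_mult, <- exp_plus, <- cis_add.
  rewrite !Rplus_opp_r, exp_0. unfold cis. rewrite cos_0, sin_0.
  unfold Cmult, RtoC; simpl; f_equal; ring.
Qed.

Lemma cexp_conj w : (cexp w * Cconj (cexp w))%C = RtoC (exp (2 * Re w)).
Proof.
  unfold cexp. rewrite <- Cmod2_conj, Cmod_mult, Cmod_cis, Rmult_1_r, Cmod_R.
  rewrite Rabs_pos_eq by (apply Rlt_le, exp_pos). f_equal.
  simpl. rewrite Rmult_1_r, <- exp_plus. f_equal; ring.
Qed.

(** * Normal form of the potential *)

(** Integrate the derivative along horizontal and vertical segments. *)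
Lemma holo_zero_constant F : holo F (fun _ => 0%C) -> forall p q, F p = F q.
Proof.
  intros H.
  assert (H0 : plane_continuous (fun _ => RtoC 0)).
  { apply (holo_continuous _ (fun _ => 0%C)), holo_const. }
  assert (Hh : forall y a b, F (b, y) = F (a, y)).
  { intros y a b. assert (E := hseg_holo F _ y a b H H0).
    unfold hseg in E. rewrite (is_CInt_unique _ _ _ _ (is_CInt_const 0 a b)) in E.
    replace (F (b, y)) with ((F (b, y) - F (a, y)) + F (a, y))%C by ring. rewrite <- E. ring. }
  assert (Hv : forall x a b, F (x, b) = F (x, a)).
  { intros x a b. assert (E := vseg_holo F _ x a b H H0).
    unfold vseg in E. rewrite (is_CInt_unique _ _ _ _ (is_CInt_const 0 a b)) in E.
    replace (F (x, b)) with ((F (x, b) - F (x, a)) + F (x, a))%C by ring. rewrite <- E. ring. }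
  intros [x y] [x' y']. rewrite (Hh y x' x). apply Hv.
Qed.

(** [conj D = d r / dw] is entire; if [P] is a primitive of it, then
    [r - 2 Re P] has zero differential, and the constant can be moved into [P]. *)
Lemma harmonic_real_part (r : C -> C) (D : C -> C) :
  (forall w, Cconj (r w) = r w) -> (forall w, wdiff r w (Cconj (D w)) (D w)) ->
  (forall w, exists be, wdiff D w 0 be) ->
  exists Phi dPhi, holo Phi dPhi /\ forall w, r w = (Phi w + Cconj (Phi w))%C.
Proof.
  intros Hr HD HH.
  assert (Hphi : exists dphi, holo (fun w => Cconj (D w)) dphi).
  { destruct (choice (fun w be => wdiff D w 0 be) HH) as [be Hbe].
    exists (fun w => Cconj (be w)). intros w.
    eapply wdiff_eq; [apply (wdiff_conj _ _ _ _ (Hbe w))|reflexivity|apply RtoC_conj]. }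
  destruct Hphi as [dphi Hphi].
  destruct (holo_primitive _ _ Hphi) as [P HP].
  assert (Hz : holo (fun w => r w - (P w + Cconj (P w)))%C (fun _ => 0%C)).
  { intros w. eapply wdiff_eq.
    - apply wdiff_minus; [apply HD|]. apply wdiff_plus; [apply HP|apply wdiff_conj, HP].
    - rewrite RtoC_conj. ring.
    - rewrite Cconj_conj. ring. }
  set (k := (r 0 - (P 0 + Cconj (P 0)))%C).
  assert (Hk : Cconj k = k).
  { unfold k. rewrite Cminus_conj, Cplus_conj, Cconj_conj, Hr. ring. }
  exists (fun w => P w + k / 2)%C, (fun w => Cconj (D w) + 0)%C. split.
  - apply holo_plus; [exact HP|apply holo_const].
  - intros w.
    assert (E := holo_zero_constant _ Hz w 0). cbv beta in E. fold k in E.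
    replace (Cconj (P w + k / 2)) with (Cconj (P w) + k / 2)%C.
    2:{ rewrite Cplus_conj, Cdiv_conj by (intros E0; injection E0; lra).
        now rewrite Hk, RtoC_conj. }
    replace (r w) with ((r w - (P w + Cconj (P w))) + (P w + Cconj (P w)))%C by ring.
    rewrite E. field.
Qed.

(** With [E = exp h], primitives [G] of [E f] and [K] of [1 / E] turn the two
    equations into [d c / dwbar = E * conj G'] and
    [d^2 d / dw dwbar = |G'|^2 + |K'|^2]. Hence [c - E * conj G] is entire and
    [d - |G|^2 - |K|^2] is harmonic, and completing the square gives [u]. *)
Lemma potential_normal_form (h f b c : C -> C) (a d : C -> R) (u : C * C -> R)
  (h_entire : entire h) (f_entire : entire f) (b_entire : entire b)
  (a_def : forall w : C, a w = exp (2 * Re (h w)))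
  (c_diff : real_differentiable c)
  (c_eq : forall w : C, wirtinger_bar c w = (a w * Cconj (f w))%C)
  (d_diff : real_differentiable (fun w => RtoC (d w)))
  (dbar_diff : real_differentiable (wirtinger_bar (fun w => RtoC (d w))))
  (d_eq : forall w : C,
     wirtinger (wirtinger_bar (fun w' => RtoC (d w'))) w
     = RtoC (a w * Cmod (f w) ^ 2 + 1 / a w))
  (u_def : forall z w : C,
     RtoC (u (z, w))
     = (RtoC (a w * Cmod z ^ 2) + b w * z ^ 2 + Cconj (b w * z ^ 2)
        + c w * z + Cconj (c w * z) + RtoC (d w))%C) :
  exists E dE G dG K dK db k dk Phi dPhi : C -> C,
    (holo E dE /\ holo G dG /\ holo K dK /\ holo b db /\ holo k dk /\ holo Phi dPhi) /\
    (forall w, (E w * dK w)%C = 1%C) /\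
    forall z w, RtoC (u (z, w)) =
      ((E w * z + G w) * Cconj (E w * z + G w) + K w * Cconj (K w)
       + ((b w * (z * z) + k w * z + Phi w) + Cconj (b w * (z * z) + k w * z + Phi w)))%C.
Proof.
  destruct (entire_holo _ h_entire) as [dh Hh].
  destruct (entire_holo _ f_entire) as [df Hf].
  destruct (entire_holo _ b_entire) as [db Hb].
  set (E := fun w => cexp (h w)). set (L := fun w => cexp (0 - h w)%C).
  assert (HE : holo E (fun w => cexp (h w) * dh w)%C) by exact (holo_comp _ _ _ _ holo_cexp Hh).
  assert (HL : exists dL, holo L dL).
  { eexists. exact (holo_comp _ _ _ _ holo_cexp (holo_minus _ _ _ _ (holo_const 0) Hh)). }
  destruct HL as [dL HL].
  assert (HEL : forall w, (E w * L w)%C = 1%C).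
  { intros w. unfold E, L. replace (0 - h w)%C with (- h w)%C by ring. apply cexp_opp. }
  assert (HEf := holo_mult _ _ _ _ HE Hf).
  destruct (holo_primitive _ _ HEf) as [G HG].
  destruct (holo_primitive _ _ HL) as [K HK].
  assert (Ha : forall w, RtoC (a w) = (E w * Cconj (E w))%C).
  { intros w. rewrite a_def. symmetry. apply cexp_conj. }
  assert (Hk : holo (fun w => c w - E w * Cconj (G w))%C
     (fun w => wirtinger c w - cexp (h w) * dh w * Cconj (G w))%C).
  { intros w. eapply wdiff_eq.
    - apply wdiff_minus; [apply (real_differentiable_wdiff c w c_diff)|].
      apply wdiff_mult; [apply HE|apply wdiff_conj, HG].
    - rewrite RtoC_conj. ring.
    - rewrite c_eq, Ha, Cmult_conj. ring. }
  assert (Hd : exists Phi dPhi, holo Phi dPhi /\ forall w,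
     (RtoC (d w) - (G w * Cconj (G w) + K w * Cconj (K w)))%C = (Phi w + Cconj (Phi w))%C).
  { set (D := wirtinger_bar (fun w => RtoC (d w))) in *.
    set (D' := fun w => (D w - (G w * Cconj (E w * f w) + K w * Cconj (L w)))%C).
    apply harmonic_real_part with D'.
    - intros w. push_conj. ring.
    - intros w.
      assert (W : wdiff (fun w => RtoC (d w) - (G w * Cconj (G w) + K w * Cconj (K w)))%C w
        (wirtinger (fun w => RtoC (d w)) w - (Cconj (G w) * (E w * f w) + Cconj (K w) * L w))%C (D' w)).
      { eapply wdiff_eq.
        - apply wdiff_minus; [apply (real_differentiable_wdiff _ w d_diff)|].
          apply wdiff_plus; (apply wdiff_mult; [|apply wdiff_conj]); auto.
        - rewrite RtoC_conj. ring.
        - unfold D', D. ring. }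
      eapply wdiff_eq; [exact W| |reflexivity].
      (* the function is real-valued, so its two Wirtinger derivatives are conjugate *)
      refine (proj1 (wdiff_unique _ _ _ _ _ _ W (wdiff_ext _ _ _ _ _ _ (wdiff_conj _ _ _ _ W)))).
      intros v. push_conj. ring.
    - intros w. eexists. eapply wdiff_eq.
      + apply wdiff_minus; [apply (real_differentiable_wdiff _ w dbar_diff)|].
        apply wdiff_plus; (apply wdiff_mult; [auto|apply wdiff_conj; auto]).
      + rewrite d_eq, !RtoC_conj, RtoC_plus, RtoC_mult, RtoC_div
          by (rewrite a_def; apply Rgt_not_eq, exp_pos).
        rewrite Ha, Cmod2_conj.
        rewrite Cmult_conj.
        assert (En : E w <> 0%C).
        { intros E0. generalize (HEL w). rewrite E0, Cmult_0_l. intros X; injection X; lra. }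
        assert (HLi : L w = (/ E w)%C).
        { replace (L w) with (/ E w * (E w * L w))%C by (field; auto). rewrite HEL. ring. }
        rewrite HLi, Cinv_conj by auto.
        assert (Enc : Cconj (E w) <> 0%C).
        { intros E0. apply En. now rewrite <- (Cconj_conj (E w)), E0, RtoC_conj. }
        field. auto.
      + reflexivity. }
  destruct Hd as [Phi [dPhi [HPhi EPhi]]].
  exists E, (fun w => cexp (h w) * dh w)%C, G, (fun w => E w * f w)%C, K, L, db,
    (fun w => c w - E w * Cconj (G w))%C,
    (fun w => wirtinger c w - cexp (h w) * dh w * Cconj (G w))%C, Phi, dPhi.
  repeat split; auto.
  intros z w. rewrite u_def.
  replace (RtoC (d w)) with ((RtoC (d w) - (G w * Cconj (G w) + K w * Cconj (K w)))
    + (G w * Cconj (G w) + K w * Cconj (K w)))%C by ring.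
  rewrite EPhi, RtoC_mult, Ha, Cmod2_conj.
  replace (z ^ 2)%C with (z * z)%C by ring. push_conj. ring.
Qed.

(** * The metric and its curvature *)

Lemma wdiff_wirtinger_eq F p al be : wdiff F p al be -> wirtinger F p = al.
Proof. intros H. apply (wdiff_wirtinger _ _ _ _ H). Qed.

Lemma wdiff_wirtinger_bar_eq F p al be : wdiff F p al be -> wirtinger_bar F p = be.
Proof. intros H. apply (wdiff_wirtinger _ _ _ _ H). Qed.

(** [u = |E z + G|^2 + |K|^2 + 2 Re H] with [H] holomorphic: the Euclidean
    potential pulled back by [(z, w) |-> (E z + G, K)], up to a pluriharmonic
    function. *)
Definition is_normal_form (u : C * C -> R) (E G K b k Phi : C -> C) : Prop :=
  forall z w, RtoC (u (z, w)) =
    ((E w * z + G w) * Cconj (E w * z + G w) + K w * Cconj (K w)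
     + ((b w * (z * z) + k w * z + Phi w) + Cconj (b w * (z * z) + k w * z + Phi w)))%C.

Ltac wdiff_rules :=
  cbv beta;
  lazymatch goal with
  | |- wdiff (fun _ => ?k) _ _ _ => apply (wdiff_const k)
  | |- wdiff (fun v => v) _ _ _ => apply wdiff_id
  | |- wdiff (fun v => Cplus (@?F v) (@?G v)) _ _ _ => apply (wdiff_plus F G); wdiff_rules
  | |- wdiff (fun v => Cminus (@?F v) (@?G v)) _ _ _ => apply (wdiff_minus F G); wdiff_rules
  | |- wdiff (fun v => Cmult (@?F v) (@?G v)) _ _ _ => apply (wdiff_mult F G); wdiff_rules
  | |- wdiff (fun v => Cconj (@?F v)) _ _ _ => apply (wdiff_conj F); wdiff_rules
  | H : holo ?F _ |- wdiff (fun v => ?F v) _ _ _ => exact (H _)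
  | H : holo ?F _ |- wdiff ?F _ _ _ => exact (H _)
  end.

Ltac wdiff_solve :=
  cbn [fst snd]; eapply wdiff_eq; [wdiff_rules| |];
  cbn [fst snd]; push_conj; first [ring | reflexivity].

Section NormalForm.

Variables (u : C * C -> R) (E dE ddE dddE G dG ddG dddG K dK ddK dddK b db ddb k dk ddk
  Phi dPhi ddPhi : C -> C).
Hypotheses (HE : holo E dE) (HE1 : holo dE ddE) (HE2 : holo ddE dddE)
  (HG : holo G dG) (HG1 : holo dG ddG) (HG2 : holo ddG dddG)
  (HK : holo K dK) (HK1 : holo dK ddK) (HK2 : holo ddK dddK)
  (Hb : holo b db) (Hb1 : holo db ddb) (Hk : holo k dk) (Hk1 : holo dk ddk)
  (HPhi : holo Phi dPhi) (HPhi1 : holo dPhi ddPhi).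
Hypothesis HEK : forall w, (E w * dK w)%C = 1%C.
Hypothesis Hu : is_normal_form u E G K b k Phi.

(** The entry [A = d_w (E z + G)] of the Jacobian matrix
    [[E, 0], [A, dK]] (rows: variables, columns: components). *)
Let A (z w : C) : C := (dE w * z + dG w)%C.

(** The matrix [J J^*] for the Jacobian matrix [J = [[E, 0], [A, L]]]. *)
Definition metric (E A L : C) : cmat := fun i j =>
  match i, j with
  | cz, cz => (E * Cconj E)%C
  | cz, cw => (E * Cconj A)%C
  | cw, cz => (A * Cconj E)%C
  | cw, cw => (A * Cconj A + L * Cconj L)%C
  end.

Lemma dbar_z_potential z w : dbar cz (fun q => RtoC (u q)) (z, w)
  = ((E w * z + G w) * Cconj (E w) + Cconj ((1 + 1) * b w * z + k w))%C.
Proof.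
  apply wdiff_wirtinger_bar_eq with
    (E w * Cconj (E w * z + G w) + ((1 + 1) * b w * z + k w))%C.
  eapply wdiff_ext; [intros v; symmetry; apply (Hu v w)|]. simpl. wdiff_solve.
Qed.

Lemma dbar_w_potential z w : dbar cw (fun q => RtoC (u q)) (z, w)
  = ((E w * z + G w) * Cconj (A z w) + K w * Cconj (dK w)
     + Cconj (db w * (z * z) + dk w * z + dPhi w))%C.
Proof.
  apply wdiff_wirtinger_bar_eq with
    (A z w * Cconj (E w * z + G w) + dK w * Cconj (K w) + (db w * (z * z) + dk w * z + dPhi w))%C.
  eapply wdiff_ext; [intros v; symmetry; apply (Hu z v)|]. simpl. unfold A. wdiff_solve.
Qed.

Lemma complex_hessian_normal_form z w i j :
  complex_hessian u (z, w) i j = metric (E w) (A z w) (dK w) i j.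
Proof.
  unfold complex_hessian, dhol.
  destruct i, j; simpl metric; eapply wdiff_wirtinger_eq.
  - eapply wdiff_ext; [intros v; symmetry; exact (dbar_z_potential v w)|]. wdiff_solve.
  - eapply wdiff_ext; [intros v; symmetry; exact (dbar_w_potential v w)|]. unfold A. wdiff_solve.
  - eapply wdiff_ext; [intros v; symmetry; exact (dbar_z_potential z v)|]. unfold A. wdiff_solve.
  - eapply wdiff_ext; [intros v; symmetry; exact (dbar_w_potential z v)|]. unfold A. wdiff_solve.
Qed.

Lemma metric_det e a l : (e * l)%C = 1%C -> cdet (metric e a l) = RtoC 1.
Proof.
  intros H. unfold cdet, metric.
  transitivity ((e * l) * Cconj (e * l))%C; [push_conj; ring|rewrite H; push_conj; ring].
Qed.

(** The Hermitian form is [|e v_z + a v_w|^2 + |l v_w|^2]. *)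
Lemma metric_posdef e a l : (e * l)%C = 1%C -> hermitian_posdef (metric e a l).
Proof.
  intros H. split.
  - intros i j. destruct i, j; unfold metric; push_conj; ring.
  - intros v Hv.
    set (X := (e * v cz + a * v cw)%C). set (Y := (l * v cw)%C).
    replace (csum _) with (X * Cconj X + Y * Cconj Y)%C
      by (unfold csum, metric, X, Y; push_conj; ring).
    rewrite <- !Cmod2_conj, <- RtoC_plus, re_RtoC.
    assert (HX := pow2_ge_0 (Cmod X)). assert (HY := pow2_ge_0 (Cmod Y)).
    apply Rnot_le_lt. intros Hle.
    assert (X0 : X = 0%C) by (apply Cmod_eq_0; nra).
    assert (Y0 : Y = 0%C) by (apply Cmod_eq_0; nra).
    assert (V2 : v cw = 0%C).
    { replace (v cw) with (e * Y - (e * l - 1) * v cw)%C by (unfold Y; ring).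
      rewrite H, Y0. ring. }
    assert (V1 : v cz = 0%C).
    { replace (v cz) with (l * (X - a * v cw) - (e * l - 1) * v cz)%C by (unfold X; ring).
      rewrite H, X0, V2. ring. }
    destruct Hv as [[|] Hv]; auto.
Qed.

(** The derivatives of the Jacobian entries [E], [A], [dK] along [m]. *)
Let DE (m : coord) (w : C) : C := match m with cz => 0%C | cw => dE w end.
Let DA (m : coord) (z w : C) : C := match m with cz => dE w | cw => (ddE w * z + ddG w)%C end.
Let DL (m : coord) (w : C) : C := match m with cz => 0%C | cw => ddK w end.

Lemma dhol_metric m z w i j :
  dhol m (fun q => complex_hessian u q i j) (z, w) =
  match i, j with
  | cz, cz => (DE m w * Cconj (E w))%C
  | cz, cw => (DE m w * Cconj (A z w))%C
  | cw, cz => (DA m z w * Cconj (E w))%C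
  | cw, cw => (DA m z w * Cconj (A z w) + DL m w * Cconj (dK w))%C
  end.
Proof.
  destruct m; unfold dhol; simpl fst; simpl snd; destruct i, j; unfold DE, DA, DL;
    eapply wdiff_wirtinger_eq.
  all: eapply wdiff_ext; [intros v; symmetry; apply complex_hessian_normal_form|];
    unfold metric, A; wdiff_solve.
Qed.

(** In matrix form the connection is [(d_m J) J^-1] for the holomorphic Jacobian
    matrix [J], hence holomorphic. *)
Lemma christoffel_normal_form l m i z w :
  christoffel (complex_hessian u) l m i (z, w) =
  match i, l with
  | cz, cz => (DE m w * dK w)%C
  | cz, cw => 0%C
  | cw, cz => (DA m z w * dK w - DL m w * A z w)%C
  | cw, cw => (DL m w * E w)%C
  end.
Proof.
  unfold christoffel, csum. rewrite !dhol_metric.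
  assert (Hdet : cdet (complex_hessian u (z, w)) = RtoC 1).
  { rewrite <- (metric_det (E w) (A z w) (dK w) (HEK w)). unfold cdet.
    now rewrite !complex_hessian_normal_form. }
  assert (H1 := HEK w).
  assert (H2 : (Cconj (E w) * Cconj (dK w))%C = 1%C)
    by (rewrite <- Cmult_conj, H1; apply RtoC_conj).
  unfold cinv. rewrite !Hdet. set (a := A z w). set (e := E w) in *. set (n := dK w) in *.
  set (e' := Cconj e) in *. set (n' := Cconj n) in *.
  assert (Hdiv : forall x : C, (x / 1)%C = x) by (intros; field).
  destruct l; rewrite !complex_hessian_normal_form; unfold metric; fold a e n e' n'; rewrite !Hdiv.
  - destruct i.
    + transitivity (DE m w * n * (e' * n'))%C; [ring|rewrite H2; ring].
    + transitivity (DA m z w * n * (e' * n') - DL m w * a * (e' * n'))%C; [ring|rewrite H2; ring].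
  - destruct i.
    + ring.
    + transitivity (DL m w * e * (e' * n'))%C; [ring|rewrite H2; ring].
Qed.

(** The connection coefficients are holomorphic, so their [dbar] vanishes. *)
Lemma flat_normal_form : flat_metric (complex_hessian u).
Proof.
  intros [z w] i j m l. unfold curvature.
  assert (H0 : forall n, dbar l (christoffel (complex_hessian u) n m i) (z, w) = RtoC 0).
  { intros n. unfold dbar. destruct l; cbn [fst snd]; destruct i, n, m;
      eapply wdiff_wirtinger_bar_eq;
      (eapply wdiff_ext; [intros v; symmetry; apply christoffel_normal_form|]);
      unfold DE, DA, DL, A; wdiff_solve. }
  unfold csum. rewrite !H0. ring.
Qed.

End NormalForm.

(** * Plurisubharmonicity *)

Lemma holo_circle_continuous F dF : holo F dF -> circle_continuous F.
Proof.
  intros H. apply circle_continuous_wdiff. intros xi _. exists (dF xi), 0%C. apply H.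
Qed.

Lemma circle_continuous_conj_comp f : circle_continuous f -> circle_continuous (fun xi => Cconj (f xi)).
Proof.
  intros H. apply (plane_continuous_comp Cconj (fun t => f (cis t))); auto.
  intros p eps He. exists eps; split; auto. intros v Hv.
  replace (Cconj (p + v) - Cconj p)%C with (Cconj v) by (push_conj; ring).
  now rewrite Cmod_conj.
Qed.

Lemma circle_continuous_plus f g : circle_continuous f -> circle_continuous g ->
  circle_continuous (fun xi => f xi + g xi)%C.
Proof.
  intros Hf Hg t.
  exact (@continuous_plus R_UniformSpace R_AbsRing C_R_NormedModule _ _ t (Hf t) (Hg t)).
Qed.

Lemma mean_value_0 F dF : holo F dF -> cmean F = F 0%C.
Proof.
  intros H. rewrite <- (mean_value F dF 0 H). apply cmean_ext. intros xi _. now rewrite Cplus_0_l.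
Qed.

Lemma cmean_Re f : circle_continuous f ->
  ex_RInt (fun t => Re (f (cis t))) 0 (2 * PI) /\
  Re (cmean f) = / (2 * PI) * RInt (fun t => Re (f (cis t))) 0 (2 * PI).
Proof.
  intros H. assert (K := is_RInt_fct_extend_fst _ _ _ _ (CInt_correct _ 0 (2 * PI) H)).
  split.
  - eexists. exact K.
  - unfold cmean. rewrite re_scal_l. f_equal. symmetry. exact (is_RInt_unique _ _ _ _ K).
Qed.

Lemma cmean_nonneg f : circle_continuous f -> (forall xi, 0 <= Re (f xi)) -> 0 <= Re (cmean f).
Proof.
  intros H H0. destruct (cmean_Re f H) as [K ->]. apply Rmult_le_pos.
  - apply Rlt_le, Rinv_0_lt_compat, two_pi_pos.
  - apply RInt_ge_0; auto. apply Rlt_le, two_pi_pos.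
Qed.

Lemma Re_mult_conj z : Re (z * Cconj z)%C = Cmod z ^ 2.
Proof. now rewrite <- Cmod2_conj, re_RtoC. Qed.

(** The mean of [|Z|^2] exceeds [|Z 0|^2] by the mean of [|Z - Z 0|^2]. *)
Lemma square_submean Z dZ : holo Z dZ ->
  Re (Z 0 * Cconj (Z 0))%C <= Re (cmean (fun xi => Z xi * Cconj (Z xi)))%C.
Proof.
  intros H. set (z0 := Z 0%C).
  assert (C1 := holo_circle_continuous _ _ H).
  assert (C2 := circle_continuous_conj_comp _ C1).
  assert (C3 := circle_continuous_mult _ _ C1 C2).
  assert (C4 := circle_continuous_mult _ _ (circle_continuous_const z0) C2).
  assert (C5 := circle_continuous_mult _ _ (circle_continuous_const (Cconj z0)) C1).
  assert (P : 0 <= Re (cmean (fun xi => (Z xi - z0) * Cconj (Z xi - z0)))%C).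
  { apply cmean_nonneg.
    - apply (circle_continuous_mult (fun xi => Z xi - z0)%C (fun xi => Cconj (Z xi - z0)%C)).
      + apply circle_continuous_minus; auto. apply circle_continuous_const.
      + apply (circle_continuous_conj_comp (fun xi => Z xi - z0)%C).
        apply circle_continuous_minus; auto. apply circle_continuous_const.
    - intros xi. rewrite Re_mult_conj. apply pow2_ge_0. }
  rewrite (cmean_ext _ (fun xi => (Z xi * Cconj (Z xi) - z0 * Cconj (Z xi)) -
    (Cconj z0 * Z xi - z0 * Cconj z0))%C) in P by (intros; push_conj; ring).
  rewrite cmean_minus, cmean_minus, cmean_minus, cmean_const, !cmean_mult, cmean_conj,
    (mean_value_0 _ _ H) in P; auto using circle_continuous_minus, circle_continuous_const.
  fold z0 in P.
  replace (cmean (fun xi => Z xi * Cconj (Z xi)) - z0 * Cconj z0 - (Cconj z0 * z0 - z0 * Cconj z0))%C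
    with (cmean (fun xi => Z xi * Cconj (Z xi)) - z0 * Cconj z0)%C in P by ring.
  unfold Cminus in P. rewrite re_plus, re_opp in P. lra.
Qed.

Section NormalForm.

Variables (u : C * C -> R) (E dE G dG K dK b db k dk Phi dPhi : C -> C).
Hypotheses (HE : holo E dE) (HG : holo G dG) (HK : holo K dK) (Hb : holo b db)
  (Hk : holo k dk) (HPhi : holo Phi dPhi).
Hypothesis Hu : is_normal_form u E G K b k Phi.

(** On a complex line the two squares are submeans and the pluriharmonic part is
    its own mean. *)
Lemma normal_form_submean (p v : C * C) :
  ex_RInt (on_circle u p v) 0 (2 * PI) /\
  u p <= / (2 * PI) * RInt (on_circle u p v) 0 (2 * PI).
Proof.
  destruct p as [p1 p2], v as [v1 v2].
  pose (z := fun xi => (p1 + xi * v1)%C). pose (w := fun xi => (p2 + xi * v2)%C).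
  assert (Hz : exists dz, holo z dz).
  { eexists. exact (holo_plus _ _ _ _ (holo_const p1) (holo_mult _ _ _ _ holo_id (holo_const v1))). }
  assert (Hw : exists dw, holo w dw).
  { eexists. exact (holo_plus _ _ _ _ (holo_const p2) (holo_mult _ _ _ _ holo_id (holo_const v2))). }
  destruct Hz as [dz Hz], Hw as [dw Hw].
  pose (X := fun xi => (E (w xi) * z xi + G (w xi))%C).
  pose (Y := fun xi => K (w xi)).
  pose (H := fun xi => (b (w xi) * (z xi * z xi) + k (w xi) * z xi + Phi (w xi))%C).
  assert (HX : exists dX, holo X dX).
  { eexists. exact (holo_plus _ _ _ _ (holo_mult _ _ _ _ (holo_comp _ _ _ _ HE Hw) Hz)
      (holo_comp _ _ _ _ HG Hw)). }
  assert (HY : exists dY, holo Y dY) by (eexists; exact (holo_comp _ _ _ _ HK Hw)).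
  assert (HH : exists dH, holo H dH).
  { eexists. exact (holo_plus _ _ _ _ (holo_plus _ _ _ _
      (holo_mult _ _ _ _ (holo_comp _ _ _ _ Hb Hw) (holo_mult _ _ _ _ Hz Hz))
      (holo_mult _ _ _ _ (holo_comp _ _ _ _ Hk Hw) Hz)) (holo_comp _ _ _ _ HPhi Hw)). }
  destruct HX as [dX HX], HY as [dY HY], HH as [dH HH].
  pose (S := fun xi => (X xi * Cconj (X xi) + Y xi * Cconj (Y xi) + (H xi + Cconj (H xi)))%C).
  assert (ES : forall xi, S xi = RtoC (u (z xi, w xi))).
  { intros xi. rewrite Hu. reflexivity. }
  assert (CX := holo_circle_continuous _ _ HX). assert (CY := holo_circle_continuous _ _ HY).
  assert (CH := holo_circle_continuous _ _ HH).
  assert (CX2 := circle_continuous_mult _ _ CX (circle_continuous_conj_comp _ CX)).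
  assert (CY2 := circle_continuous_mult _ _ CY (circle_continuous_conj_comp _ CY)).
  assert (CH2 := circle_continuous_plus _ _ CH (circle_continuous_conj_comp _ CH)).
  assert (CS : circle_continuous S)
    by exact (circle_continuous_plus _ _ (circle_continuous_plus _ _ CX2 CY2) CH2).
  assert (Sub : u (p1, p2) <= Re (cmean S)).
  { assert (E0 : RtoC (u (p1, p2)) = S 0%C).
    { rewrite ES. unfold z, w. do 2 f_equal; f_equal; ring. }
    rewrite <- (re_RtoC (u (p1, p2))), E0. unfold S.
    rewrite !cmean_plus, cmean_conj, (mean_value_0 _ _ HH);
      auto using circle_continuous_plus, circle_continuous_conj_comp.
    assert (QX := square_submean _ _ HX). assert (QY := square_submean _ _ HY).
    rewrite !re_plus. lra. }
  destruct (cmean_Re S CS) as [I1 I2].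
  assert (Eo : forall t, Re (S (cis t)) = on_circle u (p1, p2) (v1, v2) t).
  { intros t. rewrite ES, re_RtoC. reflexivity. }
  split.
  - apply ex_RInt_ext with (2 := I1). intros t _. apply Eo.
  - rewrite <- (RInt_ext _ _ _ _ (fun t _ => Eo t)), <- I2. exact Sub.
Qed.

Lemma normal_form_continuous (p : C * C) :
  @continuous (prod_UniformSpace C_R_NormedModule C_R_NormedModule) R_UniformSpace u p.
Proof.
  pose (U := prod_UniformSpace C_R_NormedModule C_R_NormedModule).
  pose (cont := fun f : C * C -> C => @continuous U C_R_NormedModule f p).
  assert (Cz : cont fst) by apply (@continuous_fst C_R_NormedModule C_R_NormedModule).
  assert (Cw : forall F dF, holo F dF -> cont (fun q => F (snd q))).
  { intros F dF HF. apply (@continuous_comp U C_R_NormedModule C_R_NormedModule snd F).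
    - apply (@continuous_snd C_R_NormedModule C_R_NormedModule).
    - apply plane_continuous_at, (holo_continuous _ _ HF). }
  assert (Cp : forall f g, cont f -> cont g -> cont (fun q => f q + g q)%C).
  { intros f g. apply (@continuous_plus U R_AbsRing C_R_NormedModule). }
  assert (Cm : forall f g, cont f -> cont g -> cont (fun q => f q * g q)%C).
  { intros f g. apply (@C_continuous_mult U). }
  assert (Cc : forall f, cont f -> cont (fun q => Cconj (f q))).
  { intros f Hf. apply (@continuous_comp U C_R_NormedModule C_R_NormedModule f Cconj); auto.
    apply plane_continuous_at. intros q eps He. exists eps; split; auto. intros v Hv.
    replace (Cconj (q + v) - Cconj q)%C with (Cconj v) by (push_conj; ring).
    now rewrite Cmod_conj. }
  assert (CE := Cw _ _ HE). assert (CG := Cw _ _ HG). assert (CK := Cw _ _ HK).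
  assert (Cb := Cw _ _ Hb). assert (Ck := Cw _ _ Hk). assert (CPhi := Cw _ _ HPhi).
  assert (CX := Cp _ _ (Cm _ _ CE Cz) CG).
  assert (CH := Cp _ _ (Cp _ _ (Cm _ _ Cb (Cm _ _ Cz Cz)) (Cm _ _ Ck Cz)) CPhi).
  assert (Ct := Cp _ _ (Cp _ _ (Cm _ _ CX (Cc _ CX)) (Cm _ _ CK (Cc _ CK))) (Cp _ _ CH (Cc _ CH))).
  assert (CRe : forall z : C, @continuous C_R_NormedModule R_UniformSpace Re z)
    by (intros [x y]; apply (@continuous_fst R_UniformSpace R_UniformSpace)).
  assert (Cf := @continuous_comp U C_R_NormedModule R_UniformSpace _ Re p Ct (CRe _)).
  eapply continuous_ext; [|exact Cf].
  intros [z w]. cbv beta. cbn [fst snd]. rewrite <- Hu. apply re_RtoC.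
Qed.

Lemma plurisubharmonic_normal_form : plurisubharmonic u.
Proof.
  split; [|exact normal_form_submean].
  intros p eps.
  assert (H := proj1 (filterlim_locally u (u p)) (normal_form_continuous p) eps).
  apply filter_imp with (2 := H). intros q Hq.
  unfold ball in Hq; simpl in Hq. unfold AbsRing_ball, abs, minus, plus, opp in Hq; simpl in Hq.
  apply Rabs_lt_between in Hq. lra.
Qed.

End NormalForm.

(** * Multiple power series *)

Fixpoint rsum (f : nat -> R) (N : nat) : R :=
  match N with O => f O | S n => rsum f n + f (S n) end.

Lemma sum_n_rsum f N : sum_n f N = rsum f N.
Proof. induction N; [now rewrite sum_O|]. rewrite sum_Sn, IHN. reflexivity. Qed.

Lemma rsum_ext f g N : (forall i, (i <= N)%nat -> f i = g i) -> rsum f N = rsum g N.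
Proof.
  induction N; intros H; simpl; [apply H; lia|]. rewrite IHN, (H (S N)); auto.
Qed.

Lemma rsum_plus f g N : rsum (fun i => f i + g i) N = rsum f N + rsum g N.
Proof. induction N; simpl; auto. rewrite IHN. ring. Qed.

Lemma rsum_scal c f N : rsum (fun i => c * f i) N = c * rsum f N.
Proof. induction N; simpl; auto. rewrite IHN. ring. Qed.

Lemma rsum_le f g N : (forall i, (i <= N)%nat -> f i <= g i) -> rsum f N <= rsum g N.
Proof.
  induction N; intros H; simpl; [apply H; lia|].
  apply Rplus_le_compat; [apply IHN; auto|apply H; lia].
Qed.

Lemma rsum_0 N : rsum (fun _ => 0) N = 0.
Proof. induction N; simpl; auto. rewrite IHN; ring. Qed.

Lemma rsum_nonneg f N : (forall i, (i <= N)%nat -> 0 <= f i) -> 0 <= rsum f N.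
Proof. intros H. rewrite <- (rsum_0 N). now apply rsum_le. Qed.

Lemma rsum_abs f N : Rabs (rsum f N) <= rsum (fun i => Rabs (f i)) N.
Proof.
  induction N; simpl; [lra|]. eapply Rle_trans; [apply Rabs_triang|lra].
Qed.

Lemma rsum_incr f N M : (N <= M)%nat -> (forall i, 0 <= f i) -> rsum f N <= rsum f M.
Proof.
  intros H Hf. induction H; [lra|]. simpl. specialize (Hf (S m)). lra.
Qed.

Lemma rsum_switch (f : nat -> nat -> R) N M :
  rsum (fun i => rsum (f i) M) N = rsum (fun j => rsum (fun i => f i j) N) M.
Proof.
  induction N; simpl; auto. rewrite IHN, <- rsum_plus. reflexivity.
Qed.

Lemma rsum_prod f g N : rsum f N * rsum g N = rsum (fun p => rsum (fun q => f p * g q) N) N.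
Proof.
  rewrite Rmult_comm, <- rsum_scal. apply rsum_ext. intros i _. rewrite rsum_scal. ring.
Qed.

Lemma rsum_S_first f N : rsum f (S N) = f O + rsum (fun i => f (S i)) N.
Proof. induction N; simpl; [ring|]. simpl in IHN. rewrite IHN. ring. Qed.

Lemma rsum_single f m N : rsum (fun i => if Nat.eqb i m then f i else 0) N =
  if Nat.leb m N then f m else 0.
Proof.
  induction N; simpl.
  - destruct m; reflexivity.
  - rewrite IHN. destruct (Nat.leb_spec m N), (Nat.leb_spec m (S N)); try lia.
    + destruct m; [ring|]. destruct (Nat.eqb_spec N m); [lia|ring].
    + assert (m = S N) as -> by lia. rewrite Nat.eqb_refl. ring.
    + destruct m; [lia|]. destruct (Nat.eqb_spec N m); [lia|ring].
Qed.

(** Products of partial sums run over a square of index pairs, partial sums of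
    products over a triangle. *)
Definition square (m : nat -> nat -> R) (N : nat) : R := rsum (fun p => rsum (m p) N) N.
Definition diag (m : nat -> nat -> R) (n : nat) : R := rsum (fun p => m p (n - p)%nat) n.
Definition triangle_sum (m : nat -> nat -> R) (N : nat) : R := rsum (diag m) N.

Definition mask (N p q : nat) (x : R) : R := if Nat.leb (p + q) N then x else 0.

Lemma triangle_mask m N :
  triangle_sum m N = square (fun p q => mask N p q (m p q)) N.
Proof.
  enough (H : forall M, (N <= M)%nat ->
    triangle_sum m N = rsum (fun p => rsum (fun q => mask N p q (m p q)) M) M)
    by (apply H; lia).
  induction N as [|N IH]; intros M HM.
  - unfold triangle_sum, diag; simpl.
    rewrite (rsum_ext _ (fun p => if Nat.eqb p 0 then m p O else 0)).
    + rewrite rsum_single. reflexivity.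
    + intros p _. rewrite (rsum_ext _ (fun q => if Nat.eqb q 0 then (if Nat.eqb p 0 then m p q else 0) else 0)).
      * rewrite rsum_single. reflexivity.
      * intros q _. unfold mask. destruct p, q; reflexivity.
  - unfold triangle_sum in *; simpl. rewrite (IH M) by lia.
    assert (E : diag m (S N) = rsum (fun p => rsum (fun q =>
      if Nat.eqb (p + q) (S N) then m p q else 0) M) M).
    { rewrite (rsum_ext (fun p => rsum _ M) (fun p => if Nat.leb p (S N) then m p (S N - p)%nat else 0)).
      - unfold diag. clear IH. induction HM as [|M HM IH].
        + apply rsum_ext. intros i Hi. now rewrite (proj2 (Nat.leb_le _ _) Hi).
        + rewrite IH. simpl. destruct (Nat.leb_spec M N); [lia|ring].
      - intros p Hp. destruct (Nat.leb_spec p (S N)).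
        + rewrite (rsum_ext _ (fun q => if Nat.eqb q (S N - p) then m p q else 0)).
          * rewrite rsum_single. destruct (Nat.leb_spec (S N - p) M); [reflexivity|lia].
          * intros q _. destruct (Nat.eqb_spec (p + q) (S N)), (Nat.eqb_spec q (S N - p)); auto; lia.
        + transitivity (rsum (fun _ => 0) M); [|apply rsum_0]. apply rsum_ext. intros q _.
          destruct (Nat.eqb_spec (p + q) (S N)); auto; lia. }
    rewrite E, <- rsum_plus. apply rsum_ext. intros p _. rewrite <- rsum_plus.
    apply rsum_ext. intros q _. unfold mask.
    destruct (Nat.leb_spec (p + q) N), (Nat.leb_spec (p + q) (S N)), (Nat.eqb_spec (p + q) (S N));
      try lia; ring.
Qed.

Lemma square_le m m' N : (forall p q, (p <= N)%nat -> (q <= N)%nat -> m p q <= m' p q) ->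
  square m N <= square m' N.
Proof. intros H. apply rsum_le. intros p Hp. apply rsum_le. auto. Qed.

Lemma square_abs m N : Rabs (square m N) <= square (fun p q => Rabs (m p q)) N.
Proof.
  eapply Rle_trans; [apply rsum_abs|]. apply rsum_le. intros p _. apply rsum_abs.
Qed.

Lemma square_minus m m' N : square (fun p q => m p q - m' p q) N = square m N - square m' N.
Proof.
  unfold square. replace (_ - _) with (rsum (fun p => rsum (m p) N) N + (-1) * rsum (fun p => rsum (m' p) N) N) by ring.
  rewrite <- rsum_scal, <- rsum_plus. apply rsum_ext. intros p _.
  rewrite <- rsum_scal, <- rsum_plus. apply rsum_ext. intros q _. ring.
Qed.

Lemma square_incr m N M : (N <= M)%nat -> (forall p q, 0 <= m p q) -> square m N <= square m M.
Proof.
  intros H Hm. apply Rle_trans with (rsum (fun p => rsum (m p) M) N).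
  - apply rsum_le. intros p _. apply rsum_incr; auto.
  - apply rsum_incr; auto. intros p. apply rsum_nonneg; auto.
Qed.

(** Entrywise comparison on the square: the first bound serves inside the
    triangle, the second one outside it, where [c] and [C] do not contribute. *)
Lemma square_triangle_error (s c S C : nat -> nat -> R) N :
  (forall p q, Rabs (s p q - c p q) <= S p q - C p q) -> (forall p q, Rabs (s p q) <= S p q) ->
  Rabs (square s N - triangle_sum c N) <= square S N - triangle_sum C N.
Proof.
  intros H1 H2. rewrite !triangle_mask, <- !square_minus.
  eapply Rle_trans; [apply square_abs|]. apply square_le. intros p q _ _. unfold mask.
  destruct (Nat.leb (p + q) N); auto. rewrite !Rminus_0_r. auto.
Qed.

Lemma square_le_triangle m m' N : (forall p q, 0 <= m' p q) ->
  (forall p q, m p q <= m' p q) -> square m N <= triangle_sum m' (2 * N).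
Proof.
  intros H0 H. rewrite triangle_mask.
  apply Rle_trans with (square (fun p q => mask (2 * N) p q (m' p q)) N).
  - apply square_le. intros p q Hp Hq. unfold mask.
    destruct (Nat.leb_spec (p + q) (2 * N)); [auto|lia].
  - apply square_incr; [lia|]. intros p q. unfold mask.
    destruct (Nat.leb (p + q) (2 * N)); auto. lra.
Qed.

Lemma triangle_le_square m m' N : (forall p q, 0 <= m' p q) ->
  (forall p q, m p q <= m' p q) -> triangle_sum m N <= square m' N.
Proof.
  intros H0 H. rewrite triangle_mask. apply square_le. intros p q _ _. unfold mask.
  destruct (Nat.leb (p + q) N); auto.
Qed.

(** Curried families of coefficients, so that [fam 4] is by computation the type
    [nat -> nat -> nat -> nat -> R]. *)
Fixpoint fam (n : nat) : Type := match n with O => R | S n => nat -> fam n end.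

Fixpoint cube n : fam n -> nat -> R :=
  match n with
  | O => fun T _ => T
  | S n => fun T N => rsum (fun i => cube n (T i) N) N
  end.

Fixpoint fmap (f : R -> R) n : fam n -> fam n :=
  match n with O => f | S n => fun T i => fmap f n (T i) end.

Fixpoint fmap2 (f : R -> R -> R) n : fam n -> fam n -> fam n :=
  match n with O => f | S n => fun T T' i => fmap2 f n (T i) (T' i) end.

Fixpoint fconst (c : R) n : fam n :=
  match n with O => c | S n => fun _ => fconst c n end.

Fixpoint fsum n : (nat -> fam n) -> nat -> fam n :=
  match n with
  | O => rsum
  | S n => fun F i j => fsum n (fun p => F p j) i
  end.

(** The Cauchy product of power series: iterating it over the indices keeps every
    proof about it an induction on [n] over one-dimensional convolutions. *)
Fixpoint conv n : fam n -> fam n -> fam n :=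
  match n with
  | O => Rmult
  | S n => fun T T' i => fsum n (fun p => conv n (T p) (T' (i - p)%nat)) i
  end.

Fixpoint fnonneg n : fam n -> Prop :=
  match n with O => fun T => 0 <= T | S n => fun T => forall i, fnonneg n (T i) end.

Notation fabs := (fmap Rabs).

Lemma cube_fsum n F i N : cube n (fsum n F i) N = rsum (fun p => cube n (F p) N) i.
Proof.
  revert F i. induction n; intros F i; simpl; auto.
  rewrite rsum_switch. apply rsum_ext. intros j _. apply IHn.
Qed.

Lemma cube_conv n (T T' : fam (S n)) N : cube (S n) (conv (S n) T T') N =
  triangle_sum (fun p q => cube n (conv n (T p) (T' q)) N) N.
Proof. simpl. apply rsum_ext. intros i _. apply cube_fsum. Qed.

Lemma cube_prod n (T T' : fam (S n)) N : cube (S n) T N * cube (S n) T' N =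
  square (fun p q => cube n (T p) N * cube n (T' q) N) N.
Proof. apply rsum_prod. Qed.

Lemma cube_nonneg n T N : fnonneg n T -> 0 <= cube n T N.
Proof.
  revert T. induction n; intros T H; simpl; auto. apply rsum_nonneg. auto.
Qed.

Lemma cube_abs n T N : Rabs (cube n T N) <= cube n (fabs n T) N.
Proof.
  revert T. induction n; intros T; simpl; [lra|].
  eapply Rle_trans; [apply rsum_abs|]. apply rsum_le. auto.
Qed.

Lemma fabs_nonneg n T : fnonneg n (fabs n T).
Proof. induction n; simpl; auto. apply Rabs_pos. Qed.

Lemma cube_incr n T N M : (N <= M)%nat -> fnonneg n T -> cube n T N <= cube n T M.
Proof.
  intros H. revert T. induction n; intros T HT; simpl; [lra|].
  apply Rle_trans with (rsum (fun i => cube n (T i) M) N).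
  - apply rsum_le. intros i _. apply IHn, HT.
  - apply rsum_incr; auto. intros i. apply cube_nonneg, HT.
Qed.

Lemma fsum_nonneg n F i : (forall p, fnonneg n (F p)) -> fnonneg n (fsum n F i).
Proof.
  revert F. induction n; intros F H; simpl; [apply rsum_nonneg; intros p _; apply (H p)|].
  intros j. apply IHn. intros p. apply H.
Qed.

Lemma conv_nonneg n T T' : fnonneg n T -> fnonneg n T' -> fnonneg n (conv n T T').
Proof.
  revert T T'. induction n; intros T T' H H'; simpl; [now apply Rmult_le_pos|].
  intros i. apply fsum_nonneg. intros p. apply IHn; [apply H|apply H'].
Qed.

Lemma conv_le_prod n T T' N : fnonneg n T -> fnonneg n T' ->
  cube n (conv n T T') N <= cube n T N * cube n T' N.
Proof.
  revert T T'. induction n; intros T T' H H'; [simpl; lra|].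
  rewrite cube_conv, cube_prod. apply triangle_le_square.
  - intros p q. apply Rmult_le_pos; apply cube_nonneg; [apply H|apply H'].
  - intros p q. apply IHn; [apply H|apply H'].
Qed.

(** Every pair of indices in [{0..N}^n] has its sum in [{0..2N}^n]. *)
Lemma prod_le_conv n T T' N : fnonneg n T -> fnonneg n T' ->
  cube n T N * cube n T' N <= cube n (conv n T T') (2 * N).
Proof.
  revert T T'. induction n; intros T T' H H'; [simpl; lra|].
  rewrite cube_conv, cube_prod. apply square_le_triangle.
  - intros p q. apply cube_nonneg, conv_nonneg; [apply H|apply H'].
  - intros p q. apply IHn; [apply H|apply H'].
Qed.

(** The terms of the product that the cube sum of the convolution omits are bounded
    by the corresponding terms for the absolute values. *)
Lemma conv_error n T T' N :
  Rabs (cube n T N * cube n T' N - cube n (conv n T T') N) <=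
  cube n (fabs n T) N * cube n (fabs n T') N - cube n (conv n (fabs n T) (fabs n T')) N.
Proof.
  revert T T'. induction n; intros T T'.
  - simpl. rewrite !Rminus_diag, Rabs_R0. lra.
  - rewrite !cube_conv, !cube_prod. apply square_triangle_error.
    + intros p q. apply IHn.
    + intros p q. rewrite Rabs_mult. apply Rmult_le_compat; try apply Rabs_pos; apply cube_abs.
Qed.

Lemma cube_abs_fsum n F i N :
  cube n (fabs n (fsum n F i)) N <= rsum (fun p => cube n (fabs n (F p)) N) i.
Proof.
  revert F i. induction n; intros F i; simpl; [apply rsum_abs|].
  rewrite rsum_switch. apply rsum_le. intros j _. apply IHn.
Qed.

Lemma cube_abs_conv n T T' N :
  cube n (fabs n (conv n T T')) N <= cube n (fabs n T) N * cube n (fabs n T') N.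
Proof.
  revert T T'. induction n; intros T T'; [simpl; rewrite Rabs_mult; lra|].
  rewrite cube_prod.
  apply Rle_trans with (triangle_sum (fun p q => cube n (fabs n (conv n (T p) (T' q))) N) N).
  - simpl. apply rsum_le. intros i _. apply cube_abs_fsum.
  - apply triangle_le_square.
    + intros p q. apply Rmult_le_pos; apply cube_nonneg, fabs_nonneg.
    + intros p q. apply IHn.
Qed.

Definition abs_summable n (T : fam n) : Prop := exists M, forall N, cube n (fabs n T) N <= M.

Definition sums_to n (T : fam n) (s : R) : Prop :=
  abs_summable n T /\ is_lim_seq (cube n T) s.

Lemma is_lim_seq_double (s : nat -> R) (l : R) :
  is_lim_seq s l -> is_lim_seq (fun N => s (2 * N)%nat) l.
Proof.
  intros H. apply (is_lim_seq_subseq s l (fun N => (2 * N)%nat)); auto.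
  apply eventually_subseq. intros n; lia.
Qed.

Lemma is_lim_seq_abs_le_0 (s e : nat -> R) :
  (forall N, Rabs (s N) <= e N) -> is_lim_seq e 0 -> is_lim_seq s 0.
Proof.
  intros H He. apply is_lim_seq_abs_0.
  apply is_lim_seq_le_le with (u := fun _ => 0) (w := e); auto.
  - intros N; split; auto. apply Rabs_pos.
  - apply is_lim_seq_const.
Qed.

Lemma sums_to_conv n T T' s s' :
  sums_to n T s -> sums_to n T' s' -> sums_to n (conv n T T') (s * s').
Proof.
  intros [[M HM] Hs] [[M' HM'] Hs'].
  set (A := cube n (fabs n T)) in *. set (B := cube n (fabs n T')) in *.
  set (D := cube n (conv n (fabs n T) (fabs n T'))).
  assert (HA0 : forall N, 0 <= A N) by (intros; apply cube_nonneg, fabs_nonneg).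
  assert (HB0 : forall N, 0 <= B N) by (intros; apply cube_nonneg, fabs_nonneg).
  assert (AB : forall N, A N * B N <= M * M').
  { intros N. apply Rmult_le_compat; auto. }
  assert (Hnn : fnonneg n (conv n (fabs n T) (fabs n T'))) by (apply conv_nonneg; apply fabs_nonneg).
  split.
  - exists (M * M'). intros N. eapply Rle_trans; [apply cube_abs_conv|apply AB].
  - destruct (ex_finite_lim_seq_incr A M) as [a Ha]; auto.
    { intros N. apply cube_incr; [lia|apply fabs_nonneg]. }
    destruct (ex_finite_lim_seq_incr B M') as [b Hb]; auto.
    { intros N. apply cube_incr; [lia|apply fabs_nonneg]. }
    assert (Hab : is_lim_seq (fun N => A N * B N) (a * b)) by now apply is_lim_seq_mult'.
    destruct (ex_finite_lim_seq_incr D (M * M')) as [d Hd].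
    { intros N. apply cube_incr; [lia|auto]. }
    { intros N. eapply Rle_trans; [apply conv_le_prod; apply fabs_nonneg|apply AB]. }
    (* [D N <= A N * B N <= D (2 N)], so both have the same limit *)
    assert (E : d = a * b).
    { apply Rle_antisym.
      - apply (is_lim_seq_le D (fun N => A N * B N) d (a * b)); auto.
        intros N. apply conv_le_prod; apply fabs_nonneg.
      - apply (is_lim_seq_le (fun N => A N * B N) (fun N => D (2 * N)%nat) (a * b) d); auto.
        + intros N. apply prod_le_conv; apply fabs_nonneg.
        + now apply is_lim_seq_double. }
    assert (H0 : is_lim_seq (fun N => cube n T N * cube n T' N - cube n (conv n T T') N) 0).
    { apply is_lim_seq_abs_le_0 with (fun N => A N * B N - D N).
      - intros N. apply conv_error.
      - replace 0 with (a * b - d) by (rewrite E; ring). now apply is_lim_seq_minus'. }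
    assert (H1 := is_lim_seq_minus' _ _ _ _ (is_lim_seq_mult' _ _ _ _ Hs Hs') H0).
    replace (s * s' - 0) with (s * s') in H1 by ring.
    apply is_lim_seq_ext with (2 := H1). intros N; ring.
Qed.

Lemma cube_fmap2_plus n T T' N : cube n (fmap2 Rplus n T T') N = cube n T N + cube n T' N.
Proof.
  revert T T'. induction n; intros T T'; simpl; auto.
  rewrite <- rsum_plus. apply rsum_ext. auto.
Qed.

Lemma cube_abs_plus n T T' N :
  cube n (fabs n (fmap2 Rplus n T T')) N <= cube n (fabs n T) N + cube n (fabs n T') N.
Proof.
  revert T T'. induction n; intros T T'; simpl; [apply Rabs_triang|].
  rewrite <- rsum_plus. apply rsum_le. auto.
Qed.

Lemma sums_to_plus n T T' s s' :
  sums_to n T s -> sums_to n T' s' -> sums_to n (fmap2 Rplus n T T') (s + s').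
Proof.
  intros [[M HM] Hs] [[M' HM'] Hs']. split.
  - exists (M + M'). intros N. eapply Rle_trans; [apply cube_abs_plus|].
    specialize (HM N). specialize (HM' N). lra.
  - apply is_lim_seq_ext with (2 := is_lim_seq_plus' _ _ _ _ Hs Hs').
    intros N. symmetry. apply cube_fmap2_plus.
Qed.

Lemma cube_scal n c T N : cube n (fmap (Rmult c) n T) N = c * cube n T N.
Proof.
  revert T. induction n; intros T; simpl; auto.
  rewrite <- rsum_scal. apply rsum_ext. auto.
Qed.

Lemma cube_abs_scal n c T N :
  cube n (fabs n (fmap (Rmult c) n T)) N = Rabs c * cube n (fabs n T) N.
Proof.
  revert T. induction n; intros T; simpl; [apply Rabs_mult|].
  rewrite <- rsum_scal. apply rsum_ext. auto.
Qed.

(** * Real-analytic germs *)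

Fixpoint vec (n : nat) : Type := match n with O => unit | S n => (R * vec n)%type end.

(** The terms [c * A i_1 .. i_n * x_1 ^ i_1 * .. * x_n ^ i_n] of a power series;
    [c] accumulates the powers of the coordinates already read. *)
Fixpoint terms n (c : R) : vec n -> fam n -> fam n :=
  match n with
  | O => fun _ A => c * A
  | S n => fun x A i => terms n (c * fst x ^ i) (snd x) (A i)
  end.

Fixpoint small n (r : R) : vec n -> Prop :=
  match n with
  | O => fun _ => True
  | S n => fun x => Rabs (fst x) < r /\ small n r (snd x)
  end.

Definition analytic n (F : vec n -> R) : Prop :=
  exists (A : fam n) (r : R), 0 < r /\
    forall x, small n r x -> sums_to n (terms n 1 x A) (F x).

Lemma small_le n r r' x : r <= r' -> small n r x -> small n r' x.
Proof.
  intros H. induction n; simpl; auto. intros [H1 H2]. split; [lra|auto].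
Qed.

Lemma fsum_ext n F G i : (forall p, (p <= i)%nat -> F p = G p) -> fsum n F i = fsum n G i.
Proof.
  revert F G. induction n; intros F G H; simpl; [now apply rsum_ext|].
  apply functional_extensionality. intros j. apply IHn. intros p Hp. now rewrite H.
Qed.

Lemma terms_fsum n c x F i : terms n c x (fsum n F i) = fsum n (fun p => terms n c x (F p)) i.
Proof.
  revert c x F. induction n; intros c x F; simpl; [symmetry; apply rsum_scal|].
  apply functional_extensionality. intros j. apply IHn.
Qed.

Lemma terms_conv n c c' x A A' :
  terms n (c * c') x (conv n A A') = conv n (terms n c x A) (terms n c' x A').
Proof.
  revert c c' x A A'. induction n; intros c c' x A A'; simpl; [ring|].
  apply functional_extensionality. intros i. rewrite terms_fsum.
  apply fsum_ext. intros p Hp. rewrite <- IHn. f_equal.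
  replace (fst x ^ i) with (fst x ^ p * fst x ^ (i - p)); [ring|].
  rewrite <- pow_add. f_equal; lia.
Qed.

Lemma terms_plus n c x A A' :
  terms n c x (fmap2 Rplus n A A') = fmap2 Rplus n (terms n c x A) (terms n c x A').
Proof.
  revert c x A A'. induction n; intros c x A A'; simpl; [ring|].
  apply functional_extensionality. intros i. apply IHn.
Qed.

Lemma terms_scal n k c x A : terms n (k * c) x A = fmap (Rmult k) n (terms n c x A).
Proof.
  revert c x A. induction n; intros c x A; simpl; [ring|].
  apply functional_extensionality. intros i. rewrite <- IHn. f_equal; ring.
Qed.

Lemma analytic_ext n F G : (forall x, F x = G x) -> analytic n F -> analytic n G.
Proof.
  intros H [A [r [Hr K]]]. exists A, r; split; auto. intros x Hx. rewrite <- H; auto.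
Qed.

Lemma analytic_plus n F G : analytic n F -> analytic n G -> analytic n (fun x => F x + G x).
Proof.
  intros [A [r [Hr K]]] [A' [r' [Hr' K']]].
  exists (fmap2 Rplus n A A'), (Rmin r r'); split; [now apply Rmin_glb_lt|].
  intros x Hx. rewrite terms_plus. apply sums_to_plus.
  - apply K, (small_le n (Rmin r r')); auto. apply Rmin_l.
  - apply K', (small_le n (Rmin r r')); auto. apply Rmin_r.
Qed.

Lemma analytic_mult n F G : analytic n F -> analytic n G -> analytic n (fun x => F x * G x).
Proof.
  intros [A [r [Hr K]]] [A' [r' [Hr' K']]].
  exists (conv n A A'), (Rmin r r'); split; [now apply Rmin_glb_lt|].
  intros x Hx. replace 1 with (1 * 1) by ring. rewrite terms_conv. apply sums_to_conv.
  - apply K, (small_le n (Rmin r r')); auto. apply Rmin_l.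
  - apply K', (small_le n (Rmin r r')); auto. apply Rmin_r.
Qed.

(** The coefficients of [x_1 ^ k * B (x_2, ..)]. *)
Definition slice n (k : nat) (B : fam n) : fam (S n) :=
  fun i => if Nat.eqb i k then B else fconst 0 n.

Lemma terms_zero n c x : terms n c x (fconst 0 n) = fconst 0 n.
Proof.
  revert c x. induction n; intros c x; simpl; [ring|].
  apply functional_extensionality. intros i. apply IHn.
Qed.

Lemma fabs_zero n : fabs n (fconst 0 n) = fconst 0 n.
Proof.
  induction n; simpl; [apply Rabs_R0|]. apply functional_extensionality. intros i. apply IHn.
Qed.

Lemma cube_zero n N : cube n (fconst 0 n) N = 0.
Proof.
  induction n; simpl; auto. rewrite (rsum_ext _ (fun _ => 0)); auto. apply rsum_0.
Qed.

Lemma cube_slice n k (x : vec (S n)) B N : cube (S n) (terms (S n) 1 x (slice n k B)) N =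
  if Nat.leb k N then fst x ^ k * cube n (terms n 1 (snd x) B) N else 0.
Proof.
  rewrite <- (rsum_single (fun i => fst x ^ i * cube n (terms n 1 (snd x) B) N)).
  simpl. apply rsum_ext. intros i _. unfold slice. destruct (Nat.eqb i k).
  - rewrite (Rmult_comm 1), terms_scal. apply cube_scal.
  - rewrite terms_zero. apply cube_zero.
Qed.

Lemma cube_abs_slice n k (x : vec (S n)) B N :
  cube (S n) (fabs (S n) (terms (S n) 1 x (slice n k B))) N =
  if Nat.leb k N then Rabs (fst x ^ k) * cube n (fabs n (terms n 1 (snd x) B)) N else 0.
Proof.
  rewrite <- (rsum_single (fun i => Rabs (fst x ^ i) * cube n (fabs n (terms n 1 (snd x) B)) N)).
  simpl. apply rsum_ext. intros i _. unfold slice. destruct (Nat.eqb i k).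
  - rewrite (Rmult_comm 1), terms_scal. apply cube_abs_scal.
  - rewrite terms_zero, fabs_zero. apply cube_zero.
Qed.

(** The case [k = 0] adds a variable in front, the case [k = 1] gives the
    coordinate functions. *)
Lemma analytic_slice n k F : analytic n F -> analytic (S n) (fun x => fst x ^ k * F (snd x)).
Proof.
  intros [B [r [Hr K]]]. exists (slice n k B), r; split; auto.
  intros x [_ Hx]. destruct (K _ Hx) as [[M HM] HL]. split.
  - exists (Rabs (fst x ^ k) * M). intros N. rewrite cube_abs_slice.
    assert (0 <= M) by (eapply Rle_trans; [apply cube_nonneg, fabs_nonneg|apply (HM O)]).
    destruct (Nat.leb k N).
    + apply Rmult_le_compat_l; auto. apply Rabs_pos.
    + apply Rmult_le_pos; auto. apply Rabs_pos.
  - apply is_lim_seq_ext_loc with (fun N => fst x ^ k * cube n (terms n 1 (snd x) B) N).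
    + exists k. intros N HN. rewrite cube_slice. now rewrite (proj2 (Nat.leb_le _ _) HN).
    + apply (is_lim_seq_scal_l _ (fst x ^ k) (F (snd x))). exact HL.
Qed.

Lemma analytic_tail n F : analytic n F -> analytic (S n) (fun x => F (snd x)).
Proof.
  intros H. apply analytic_ext with (2 := analytic_slice n 0 F H). intros x; simpl; ring.
Qed.

Lemma analytic_const n c : analytic n (fun _ => c).
Proof.
  induction n; [|now apply (analytic_tail n (fun _ => c))].
  exists (c : fam O), 1; split; [lra|]. intros x _. simpl. split.
  - exists (Rabs (1 * c)). intros N; simpl; lra.
  - apply is_lim_seq_ext with (fun _ => c); [intros; simpl; ring|apply is_lim_seq_const].
Qed.

Lemma analytic_head n : analytic (S n) (fun x => fst x).
Proof.
  apply analytic_ext with (2 := analytic_slice n 1 _ (analytic_const n 1)). intros x; simpl; ring.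
Qed.

(** ** Holomorphic functions are analytic in the two real coordinates *)

(** The binomial coefficient [C(k + l, k)]; this indexing makes Pascal's rule hold
    by computation and fits sums over [k + l = n]. *)
Fixpoint bin (k : nat) : nat -> R :=
  match k with
  | O => fun _ => 1
  | S k' => fix bin_S l := match l with O => 1 | S l' => bin k' l + bin_S l' end
  end.

Lemma bin_nonneg k l : 0 <= bin k l.
Proof.
  revert l. induction k; intros l; [simpl; lra|].
  induction l; [simpl; lra|]. change (0 <= bin k (S l) + bin (S k) l). specialize (IHk (S l)). lra.
Qed.

Lemma bin_0_r k : bin k 0 = 1.
Proof. destruct k; reflexivity. Qed.

Lemma bin_pascal k l : bin (S k) (S l) = bin k (S l) + bin (S k) l.
Proof. reflexivity. Qed.

Definition binomial_term (x y : R) (g : nat -> R) (k l : nat) : R := bin k l * x ^ k * y ^ l * g l.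

Lemma diag_first m n : diag m (S n) = m O (S n) + diag (fun k l => m (S k) l) n.
Proof. unfold diag. rewrite rsum_S_first. f_equal. Qed.

Lemma diag_last m n : diag m (S n) = diag (fun k l => m k (S l)) n + m (S n) O.
Proof.
  unfold diag. simpl. rewrite Nat.sub_diag. f_equal. apply rsum_ext. intros i Hi.
  f_equal. destruct i; lia.
Qed.

Lemma diag_plus m m' n : diag (fun k l => m k l + m' k l) n = diag m n + diag m' n.
Proof. apply rsum_plus. Qed.

Lemma diag_scal c m n : diag (fun k l => c * m k l) n = c * diag m n.
Proof. unfold diag. now rewrite <- rsum_scal. Qed.

Lemma diag_ext m m' n : (forall k l, (k + l = n)%nat -> m k l = m' k l) -> diag m n = diag m' n.
Proof. intros H. apply rsum_ext. intros i Hi. apply H. lia. Qed.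

Lemma diag_le m m' n : (forall k l, m k l <= m' k l) -> diag m n <= diag m' n.
Proof. intros H. apply rsum_le. auto. Qed.

Lemma diag_binomial_step x y g n : diag (binomial_term x y g) (S n) =
  x * diag (binomial_term x y g) n + y * diag (binomial_term x y (fun l => g (S l))) n.
Proof.
  set (left := fun k l => match k with O => 0 | S k' => x * binomial_term x y g k' l end).
  set (right := fun k l => match l with O => 0
    | S l' => y * binomial_term x y (fun l => g (S l)) k l' end).
  rewrite (diag_ext _ (fun k l => left k l + right k l)).
  - rewrite diag_plus, (diag_first left), (diag_last right). unfold left, right.
    rewrite !diag_scal. ring.
  - intros [|k] [|l] Hkl; unfold left, right, binomial_term; try lia.
    + simpl. ring.
    + rewrite !bin_0_r. simpl. ring.
    + rewrite bin_pascal. simpl. ring.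
Qed.

(** The binomial theorem for [(x + i y) ^ n]; the general factor [c] lets the power
    of [i] pass through the induction. *)
Lemma diag_binomial_C x y (c : C) n :
  diag (binomial_term x y (fun l => Re (c * Ci ^ l)%C)) n = Re (c * (x, y) ^ n)%C.
Proof.
  revert c. induction n; intros c.
  - unfold diag, binomial_term. simpl. ring.
  - rewrite diag_binomial_step, IHn.
    rewrite (diag_ext _ (binomial_term x y (fun l => Re (c * Ci * Ci ^ l)%C))).
    + rewrite IHn. simpl Cpow. destruct c as [c1 c2], ((x, y) ^ n)%C as [a b]. simpl. ring.
    + intros k l _. unfold binomial_term. do 2 f_equal. simpl. ring.
Qed.

Lemma diag_binomial_R x y M n : diag (binomial_term x y (fun _ => M)) n = M * (x + y) ^ n.
Proof.
  induction n.
  - unfold diag, binomial_term. simpl. ring.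
  - rewrite diag_binomial_step, IHn. simpl. ring.
Qed.

Lemma geometric_half s N : 0 <= s <= / 2 -> rsum (fun n => s ^ n) N <= 2.
Proof.
  intros Hs. enough (H : rsum (fun n => s ^ n) N <= 2 - s ^ N).
  { assert (0 <= s ^ N) by (apply pow_le; lra). lra. }
  induction N; simpl; [lra|]. assert (0 <= s ^ N) by (apply pow_le; lra). nra.
Qed.

Lemma Re_poly_sum e om N :
  Re (poly_sum e om (S N)) = rsum (fun n => Re (e n * om ^ n)%C) N.
Proof.
  induction N.
  - simpl. ring.
  - change (poly_sum e om (S (S N))) with (poly_sum e om (S N) + e (S N) * om ^ (S N))%C.
    rewrite re_plus, IHN. reflexivity.
Qed.

Lemma is_lim_seq_taylor E dE w om : holo E dE -> Cmod om < 1 ->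
  is_lim_seq (fun N => Re (poly_sum (taylor_coef E w) om (S N))) (Re (E (w + om)%C)).
Proof.
  intros H Ho.
  destruct (plane_continuous_bounded E w 1 (holo_continuous _ _ H)) as [M HM].
  assert (L : is_lim_seq (fun N => Re (poly_sum (taylor_coef E w) om (S N)) - Re (E (w + om)%C)) 0).
  { apply is_lim_seq_abs_le_0 with (fun N => M / (1 - Cmod om) * Cmod om ^ S N).
    - intros N. rewrite <- Rabs_Ropp.
      replace (- _) with (Re (E (w + om) - poly_sum (taylor_coef E w) om (S N))%C)
        by (unfold Cminus; rewrite re_plus, re_opp; ring).
      eapply Rle_trans; [apply re_le_Cmod|]. apply taylor with dE; auto.
      intros xi Hx. apply HM. lra.
    - replace (Finite 0) with (Rbar_mult (M / (1 - Cmod om)) 0) by (simpl; f_equal; ring).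
      apply (is_lim_seq_scal_l (fun N => Cmod om ^ S N) _ 0).
      apply (is_lim_seq_incr_1 (fun n => Cmod om ^ n)), is_lim_seq_geom.
      rewrite Rabs_pos_eq; auto. apply Cmod_ge_0. }
  apply is_lim_seq_ext with (fun N => Re (poly_sum (taylor_coef E w) om (S N)) - Re (E (w + om)%C) + Re (E (w + om)%C)).
  - intros; ring.
  - replace (Finite (Re (E (w + om)%C))) with (Finite (0 + Re (E (w + om)%C))) by (f_equal; ring).
    apply is_lim_seq_plus'; auto. apply is_lim_seq_const.
Qed.

(** Expanding [om ^ n = (x + i y) ^ n] turns the Taylor series into a double
    series; the terms with [k + l <= N] and with [k, l <= N] have the same sum in
    the limit, by absolute convergence. *)
Lemma analytic_holo E dE w : holo E dE ->
  analytic 2 (fun x => Re (E (w + (fst x, fst (snd x)))%C)).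
Proof.
  intros H. set (e := taylor_coef E w).
  destruct (plane_continuous_bounded E w 1 (holo_continuous _ _ H)) as [M HM].
  assert (He : forall n, Cmod (e n) <= M).
  { intros n. apply taylor_coef_bound with dE; auto. intros xi Hx. apply HM; lra. }
  set (A := (fun k l => bin k l * Re (e (k + l)%nat * Ci ^ l)%C) : fam 2).
  exists A, (/ 4). split; [lra|].
  intros [x [y []]] [Hx [Hy _]]. cbn [fst snd] in *.
  set (T := terms 2 1 (x, (y, tt)) A).
  assert (ET : forall k l, T k l = binomial_term x y (fun l => Re (e (k + l)%nat * Ci ^ l)%C) k l).
  { intros k l. unfold T, A, binomial_term. simpl. ring. }
  set (s := Rabs x + Rabs y).
  assert (Hs : 0 <= s <= / 2) by (pose proof (Rabs_pos x); pose proof (Rabs_pos y); unfold s; lra).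
  assert (HM0 : 0 <= M) by (eapply Rle_trans; [apply Cmod_ge_0|apply (He O)]).
  set (aT := fun k l => Rabs (T k l)).
  assert (Hdiag : forall n, diag aT n <= M * s ^ n).
  { intros n. unfold s. rewrite <- diag_binomial_R. apply diag_le. intros k l.
    unfold aT. rewrite ET. unfold binomial_term.
    rewrite !Rabs_mult, <- !RPow_abs, (Rabs_pos_eq (bin k l)) by apply bin_nonneg.
    apply Rmult_le_compat_l.
    - repeat apply Rmult_le_pos; try apply pow_le; try apply Rabs_pos. apply bin_nonneg.
    - eapply Rle_trans; [apply re_le_Cmod|].
      rewrite Cmod_mult, Cmod_pow, Cmod_Ci, pow1, Rmult_1_r. apply He. }
  assert (Htri : forall N, triangle_sum aT N <= 2 * M).
  { intros N. apply Rle_trans with (rsum (fun n => M * s ^ n) N); [apply rsum_le; intros n _; apply Hdiag|].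
    rewrite rsum_scal. assert (G := geometric_half s N Hs).
    rewrite Rmult_comm. now apply Rmult_le_compat_r. }
  assert (aT0 : forall k l, 0 <= aT k l) by (intros; apply Rabs_pos).
  assert (Hsq : forall N, square aT N <= triangle_sum aT (2 * N)).
  { intros N. apply square_le_triangle; auto. intros; lra. }
  split.
  - exists (2 * M). intros N. exact (Rle_trans _ _ _ (Hsq N) (Htri _)).
  - assert (L1 : is_lim_seq (triangle_sum T) (Re (E (w + (x, y))%C))).
    { apply is_lim_seq_ext with (fun N => Re (poly_sum e (x, y) (S N))).
      - intros N. rewrite Re_poly_sum. apply rsum_ext. intros n _.
        rewrite <- diag_binomial_C. apply diag_ext. intros k l Hkl. rewrite ET.
        unfold binomial_term. now rewrite Hkl.
      - apply is_lim_seq_taylor with dE; auto.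
        eapply Rle_lt_trans; [apply Cmod_le_sum|]. fold s. lra. }
    destruct (ex_finite_lim_seq_incr (triangle_sum aT) (2 * M)) as [t Ht]; auto.
    { intros N. apply rsum_incr; [lia|]. intros n. apply rsum_nonneg. auto. }
    assert (L2 : is_lim_seq (fun N => square T N - triangle_sum T N) 0).
    { apply is_lim_seq_abs_le_0 with (fun N => triangle_sum aT (2 * N) - triangle_sum aT N).
      - intros N. apply Rle_trans with (square aT N - triangle_sum aT N).
        + apply square_triangle_error; intros p q; [|apply Rle_refl].
          rewrite !Rminus_diag, Rabs_R0. lra.
        + specialize (Hsq N). lra.
      - replace 0 with (t - t) by ring. apply is_lim_seq_minus'; auto.
        now apply is_lim_seq_double. }
    assert (L3 := is_lim_seq_plus' _ _ _ _ L2 L1).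
    rewrite Rplus_0_l in L3. apply is_lim_seq_ext with (2 := L3).
    intros N. change (square T N - triangle_sum T N + triangle_sum T N = square T N). ring.
Qed.

(** ** The potential *)

Definition canalytic (F : vec 4 -> C) : Prop :=
  analytic 4 (fun x => Re (F x)) /\ analytic 4 (fun x => Im (F x)).

Lemma canalytic_plus F G : canalytic F -> canalytic G -> canalytic (fun x => F x + G x)%C.
Proof. intros [H1 H2] [K1 K2]. split; now apply analytic_plus. Qed.

Lemma analytic_opp n F : analytic n F -> analytic n (fun x => - F x).
Proof.
  intros H. apply analytic_ext with (2 := analytic_mult _ _ _ (analytic_const n (-1)) H).
  intros x; ring.
Qed.

Lemma canalytic_mult F G : canalytic F -> canalytic G -> canalytic (fun x => F x * G x)%C.
Proof.
  intros [H1 H2] [K1 K2]. split.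
  - exact (analytic_plus _ _ _ (analytic_mult _ _ _ H1 K1) (analytic_opp _ _ (analytic_mult _ _ _ H2 K2))).
  - exact (analytic_plus _ _ _ (analytic_mult _ _ _ H1 K2) (analytic_mult _ _ _ H2 K1)).
Qed.

Lemma canalytic_conj F : canalytic F -> canalytic (fun x => Cconj (F x)).
Proof. intros [H1 H2]. split; [exact H1|now apply (analytic_opp 4 (fun x => Im (F x)))]. Qed.

Definition z_part (x : vec 4) : C := (fst x, fst (snd x)).
Definition w_part (x : vec 4) : C := (fst (snd (snd x)), fst (snd (snd (snd x)))).

Lemma canalytic_z p : canalytic (fun x => p + z_part x)%C.
Proof.
  split.
  - apply (analytic_plus 4 (fun _ => Re p) (fun x => fst x)); [apply analytic_const|apply analytic_head].
  - apply (analytic_plus 4 (fun _ => Im p) (fun x => fst (snd x))); [apply analytic_const|].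
    apply (analytic_tail 3 (fun x => fst x)), analytic_head.
Qed.

Lemma canalytic_holo E dE p : holo E dE -> canalytic (fun x => E (p + w_part x)%C).
Proof.
  intros H. split.
  - apply (analytic_tail 3 (fun x => Re (E (p + (fst (snd x), fst (snd (snd x))))%C))).
    apply (analytic_tail 2 (fun x => Re (E (p + (fst x, fst (snd x)))%C))).
    now apply analytic_holo with dE.
  - assert (H' := holo_mult _ _ _ _ (holo_const (- Ci)) H).
    apply (analytic_tail 3 (fun x => Im (E (p + (fst (snd x), fst (snd (snd x))))%C))).
    apply (analytic_tail 2 (fun x => Im (E (p + (fst x, fst (snd x)))%C))).
    apply analytic_ext with (2 := analytic_holo _ _ p H'). intros x. simpl.
    destruct (E _) as [a b]. simpl. ring.
Qed.

Lemma real_analytic_of_germs u :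
  (forall p : C * C, analytic 4 (fun x => u ((fst p + z_part x)%C, (snd p + w_part x)%C))) ->
  real_analytic u.
Proof.
  intros H p. destruct (H p) as [A [r [Hr K]]]. exists A, (mkposreal r Hr).
  intros x1 y1 x2 y2 H1 H2 H3 H4 T. simpl in H1, H2, H3, H4.
  destruct (K (x1, (y1, (x2, (y2, tt))))) as [[M HM] HL]; [simpl; auto|].
  assert (EB : forall (f : fam 4) N, box_sum f N = cube 4 f N).
  { intros f N. unfold box_sum. simpl.
    rewrite sum_n_rsum. apply rsum_ext. intros i _.
    rewrite sum_n_rsum. apply rsum_ext. intros j _.
    rewrite sum_n_rsum. apply rsum_ext. intros k _.
    apply sum_n_rsum. }
  assert (ET : T = terms 4 1 (x1, (y1, (x2, (y2, tt)))) A).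
  { do 4 (apply functional_extensionality; intro). unfold T. simpl. ring. }
  split.
  - exists M. intros N. rewrite EB, ET. exact (HM N).
  - apply is_lim_seq_ext with (cube 4 T); [intros N; symmetry; apply EB|].
    rewrite ET. exact HL.
Qed.

Lemma real_analytic_normal_form u E dE G dG K dK b db k dk Phi dPhi :
  holo E dE -> holo G dG -> holo K dK -> holo b db -> holo k dk -> holo Phi dPhi ->
  is_normal_form u E G K b k Phi -> real_analytic u.
Proof.
  intros HE HG HK Hb Hk HPhi Hu. apply real_analytic_of_germs. intros p.
  assert (Cz := canalytic_z (fst p)).
  assert (CE := canalytic_holo _ _ (snd p) HE). assert (CG := canalytic_holo _ _ (snd p) HG).
  assert (CK := canalytic_holo _ _ (snd p) HK). assert (Cb := canalytic_holo _ _ (snd p) Hb).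
  assert (Ck := canalytic_holo _ _ (snd p) Hk). assert (CP := canalytic_holo _ _ (snd p) HPhi).
  assert (CX := canalytic_plus _ _ (canalytic_mult _ _ CE Cz) CG).
  assert (CH := canalytic_plus _ _ (canalytic_plus _ _ (canalytic_mult _ _ Cb (canalytic_mult _ _ Cz Cz))
    (canalytic_mult _ _ Ck Cz)) CP).
  assert (Ct := canalytic_plus _ _ (canalytic_plus _ _ (canalytic_mult _ _ CX (canalytic_conj _ CX))
    (canalytic_mult _ _ CK (canalytic_conj _ CK))) (canalytic_plus _ _ CH (canalytic_conj _ CH))).
  apply analytic_ext with (2 := proj1 Ct). intros x. cbv beta. rewrite <- Hu. apply re_RtoC.
Qed.

(** The derivatives up to third order that the curvature involves exist by
    [holo_derivative]. *)
Theorem theorem4p1 (h f b c : C -> C) (a d : C -> R) (u : C * C -> R)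
  (h_entire : entire h) (f_entire : entire f) (b_entire : entire b)
  (a_def : forall w : C, a w = exp (2 * Re (h w)))
  (c_diff : real_differentiable c)
  (c_eq : forall w : C, wirtinger_bar c w = (a w * Cconj (f w))%C)
  (d_diff : real_differentiable (fun w => RtoC (d w)))
  (dbar_diff : real_differentiable (wirtinger_bar (fun w => RtoC (d w))))
  (d_eq : forall w : C,
     wirtinger (wirtinger_bar (fun w' => RtoC (d w'))) w
     = RtoC (a w * Cmod (f w) ^ 2 + 1 / a w))
  (u_def : forall z w : C,
     RtoC (u (z, w))
     = (RtoC (a w * Cmod z ^ 2) + b w * z ^ 2 + Cconj (b w * z ^ 2)
        + c w * z + Cconj (c w * z) + RtoC (d w))%C) :
  real_analytic u /\
  plurisubharmonic u /\
  (forall p : C * C, cdet (complex_hessian u p) = RtoC 1) /\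
  (forall p : C * C, hermitian_posdef (complex_hessian u p)) /\
  flat_metric (complex_hessian u).
Proof.
  destruct (potential_normal_form h f b c a d u h_entire f_entire b_entire a_def c_diff c_eq
    d_diff dbar_diff d_eq u_def)
    as (E & dE & G & dG & K & dK & db & k & dk & Phi & dPhi & (HE & HG & HK & Hb & Hk & HP) & HEK & Hu).
  destruct (holo_derivative _ _ HE) as [ddE HE1]. destruct (holo_derivative _ _ HE1) as [dddE HE2].
  destruct (holo_derivative _ _ HG) as [ddG HG1]. destruct (holo_derivative _ _ HG1) as [dddG HG2].
  destruct (holo_derivative _ _ HK) as [ddK HK1]. destruct (holo_derivative _ _ HK1) as [dddK HK2].
  destruct (holo_derivative _ _ Hb) as [ddb Hb1]. destruct (holo_derivative _ _ Hk) as [ddk Hk1].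
  destruct (holo_derivative _ _ HP) as [ddPhi HP1].
  assert (Hmetric : forall z w, complex_hessian u (z, w) =
    metric (E w) (dE w * z + dG w)%C (dK w)).
  { intros z w. apply functional_extensionality; intros i. apply functional_extensionality; intros j.
    exact (complex_hessian_normal_form u _ _ _ _ _ _ _ _ _ _ _ _ _ _ _ _ _ _
      HE HE1 HG HG1 HK HK1 Hb Hb1 Hk Hk1 HP HP1 Hu z w i j). }
  split; [|split; [|split; [|split]]].
  - exact (real_analytic_normal_form _ _ _ _ _ _ _ _ _ _ _ _ _ HE HG HK Hb Hk HP Hu).
  - exact (plurisubharmonic_normal_form _ _ _ _ _ _ _ _ _ _ _ _ _ HE HG HK Hb Hk HP Hu).
  - intros [z w]. rewrite Hmetric. now apply metric_det.
  - intros [z w]. rewrite Hmetric. now apply metric_posdef.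
  - exact (flat_normal_form u _ _ _ _ _ _ _ _ _ _ _ _ _ _ _ _ _ _ _ _ _
      HE HE1 HE2 HG HG1 HG2 HK HK1 HK2 Hb Hb1 Hk Hk1 HP HP1 HEK Hu).
Qed.
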